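(* Let $K\subset K(x)$ be a simple transcendental field extension, $\nu$ a valuation of $K(x)$ with $\nu(x)>0$ whose restriction $\nu_K$ to $K$ has rank $1$, and let $k_{\nu_K}$ be the residue field of $\nu_K$. Then there exists a complete set $\{Q_i\}_{i\in\bar\Lambda}$ of key polynomials for $\nu$ such that: the order type of $\bar\Lambda$ is at most $\omega\times\omega$; if $\operatorname{char} k_{\nu_K}=0$, the order type of $\bar\Lambda$ is at most $\omega+1$; if $\operatorname{char} k_{\nu_K}=0$ and $\operatorname{rank}\nu=1$, the order type of $\bar\Lambda$ is at most $\omega$.
   Context: Setting. $K\subset K(x)$ is a simple transcendental extension, $\nu$ a valuation of $K(x)$ with value group $\Gamma$, $\nu_K=\nu|_K$ with value group $\Gamma_0$; $\operatorname{rank}\nu_K=1$, $\nu(x)>0$. $\tilde\Gamma_0=\Gamma_0\otimes_{\mathbb Z}\mathbb Q$, with a fixed ordered embedding into $\mathbb R$; values are compared in $\Gamma\otimes\mathbb Q$. $\mathbb N$ = positive integers, $\mathbb N_0=\mathbb N\cup\{0\}$. $G_\nu=\bigoplus_{\beta\in\Gamma}\mathbf P_\beta/\mathbf P_{\beta+}$ with $\mathbf P_\beta=\{y\in K(x):\nu(y)\ge\beta\}$, $\mathbf P_{\beta+}=\{y:\nu(y)>\beta\}$; $\mathrm{in}_\nu y$ is the class of $y$ in degree $\nu(y)$; $G_{\nu_K}$ is the analogous algebra for $(K,\nu_K)$. For a graded domain $G$, $G^*=\{g/h: g,h\in G,\ h\ne0 \text{ homogeneous}\}$. Index sets. $\Lambda$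 is a countable well ordered set with least element $0$; $i+1$ is the successor of $i$, etc. $(\alpha_i)_{i\in\Lambda}$ are positive integers, $\alpha_0=1$. $i$ is inessential if $i+\omega\in\Lambda$ and $\alpha_{i+t}=1$ for all $t\in\mathbb N_0$. For non-maximal $i$, $i+$ denotes $i+\omega$ if $i$ is inessential, and $i+1$ otherwise. Pre-key polynomials: monic $Q_i\in K[x]$ $(i\in\Lambda)$, $Q_0=x$, with $\deg Q_i=\alpha_i\deg Q_{i_0}$ for all non-maximal $i\ge1$ and $i_0<i$ with $i_0+=i$. Put $\beta_i=\nu(Q_i)$, $\bar\alpha_i=\deg_xQ_i$, $\mathbf Q_i=\{Q_q\}_{q<i}$. Standard expansions. An $\ell$-standard monomial is $c\prod_{i\le\ell}Q_i^{\gamma_i}$, $c\in K$, $\gamma_i\in\mathbb N_0$ almost all $0$, with $\gamma_i<\alpha_{i+}$ for $i<\ell$ and, for each inessential $i$, at most one $j$ with $j+=i+$ and $\gamma_j\neq0$ (here $i+$ is computed in $\{q\in\Lambda:q\le\ell\}$). It is $Q_\ell$-free if $\gamma_\ell=0$. A $Q_\ell$-free $\ell$-standard expansion is a finite sum of $Q_\ell$-free $\ell$-standard monomials whose $\nu$-value is the minimum of the values of the monomials. An $\ell$-standard expansion of $g\in K[x]$ is $g=\sum_jc_jQ_\ell^j$ with each $c_j$ a $Q_\ell$-free $\ell$-standard expansion. Set of key polynomials for $\nu$: a set of pre-key polynomials such that (a) $\beta_i\in\tilde\Gamma_0$ for $i\ne\max\Lambda$; (b) if $i\ge1$ has an immediate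 predecessor, $Q_i$ has an $(i-1)$-standard expansion $Q_i=Q_{i-1}^{\alpha_i}+\sum_{j<\alpha_i}\big(\sum_\gamma c_{j,\gamma}M_\gamma\big)Q_{i-1}^j$ where the $c_{j,\gamma}M_\gamma$ are $Q_{i-1}$-free $(i-1)$-standard monomials ($c_{j,\gamma}\in K$, $M_\gamma$ a product of powers of elements of $\mathbf Q_{i-1}$; elements of $K$ if $i=1$), all the monomials appearing have the same $\nu$-value, and $(\mathrm{in}_\nu Q_{i-1})^{\alpha_i}+\sum_{j}\big(\sum_\gamma \mathrm{in}_{\nu_K}c_{j,\gamma}\,\mathrm{in}_\nu M_\gamma\big)(\mathrm{in}_\nu Q_{i-1})^j=0$ is the minimal algebraic relation of $\mathrm{in}_\nu Q_{i-1}$ over $G_{\nu_K}[\mathrm{in}_\nu\mathbf Q_{i-1}]^*$; (c) if $i\geq 1$ has no immediate predecessor, there is $i_0$ with $i_0+=i$, and for every such $i_0$ there is an $i_0$-standard expansion $Q_i=\sum_{j=0}^{\alpha_i}c_{j,i_0}Q_{i_0}^j$; every such expansion satisfies $\nu(Q_i)>\min_j\nu(c_{j,i_0}Q_{i_0}^j)$, and $Q_i$ has the smallest degree among polynomials with this property for all $i_0$ with $i_0+=i$; if $\{\beta_{i'}:i'<i\}$ is bounded in $\tilde\Gamma_0$ (in particular if $i\ne\max\Lambda$) then $c_{\alpha_i,i_0}=1$ and $\min_j\nu(c_{j,i_0}Q_{i_0}^j)=\alpha_i\beta_{i_0}=\nu(c_{0,i_0})$; (d) if for some $n$ the set $\{i:\deg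 Q_i=n\}$ is infinite, then $\{\nu(Q_i):\deg Q_i=n\}$ is cofinal in $\{\nu(f): f\in K[x]\text{ monic},\deg f=n\}$. Truncations. Each $f\in K[x]$ has a unique $Q_i$-expansion $f=\sum_jd_{j,i}Q_i^j$ with $\deg d_{j,i}<\deg Q_i$; put $\nu_i(f)=\min_j\{\nu(d_{j,i})+j\beta_i\}$. A set of key polynomials is complete if for every nonzero $f\in K[x]$ there is $i\in\Lambda$ with $\nu_i(f)=\nu(f)$. *)

(* Defs.v *)
From HB Require Import structures.
From mathcomp Require Import all_boot all_order all_algebra.
From mathcomp Require Import generic_quotient ring_quotient fraction.
From mathcomp Require Import finmap.
From mathcomp Require Import boolp classical_sets cardinality.
From mathcomp.multinomials Require Import monalg.

Set Implicit Arguments.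
Unset Strict Implicit.
Unset Printing Implicit Defensive.

Import Order.TTheory GRing.Theory.

Local Open Scope ring_scope.
Local Open Scope quotient_scope.

Local Notation tofrac := (@FracField.tofrac _).
Local Notation "x %:F" := (tofrac x).

(** * Ordered abelian groups, and [option] as the adjunction of a top element *)

HB.mixin Record POrderedZmodule_isOrdAbGroup G of Num.POrderedZmodule G := {
  oag_le_total : total (<=%R : rel G);
  oag_leD2l : forall z x y : G, x <= y -> z + x <= z + y
}.

#[short(type="ordAbGroupType")]
HB.structure Definition OrdAbGroup :=
  { G of Num.POrderedZmodule G & POrderedZmodule_isOrdAbGroup G }.

(* [option T] is [T] with [None] added as a largest element (infinity). *)
Section Top.
Context {d : Order.disp_t} {T : porderType d}.
Implicit Types a b : option T.

Definition top_le a b : bool :=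
  match a, b with
  | _, None => true
  | None, Some _ => false
  | Some x, Some y => (x <= y)%O
  end.

Definition top_lt a b : bool := ~~ top_le b a.

Definition top_min a b := if top_le a b then a else b.

End Top.

Section TopAdd.
Context {G : zmodType}.

Definition top_add (a b : option G) : option G :=
  match a, b with Some x, Some y => Some (x + y) | _, _ => None end.

Definition top_muln (n : nat) (a : option G) : option G :=
  omap (fun x => x *+ n) a.

End TopAdd.

(** * Valuations *)

(* Additive (Krull) valuations; the value group is the image, so that the same
   ordered group can serve for a valuation and for its restrictions. *)
Record valuation (F : fieldType) (G : ordAbGroupType) := Valuation {
  val_fun :> F -> option G;
  val_eq_top : forall x, val_fun x = None <-> x = 0;
  valuationM : forall x y, val_fun (x * y) = top_add (val_fun x) (val_fun y);
  valuationD : forall x y,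
    top_le (top_min (val_fun x) (val_fun y)) (val_fun (x + y))
}.

Section ValuationTheory.
Variables (F : fieldType) (G : ordAbGroupType) (v : valuation F G).

Lemma val0 : v 0 = None. Proof. exact/val_eq_top. Qed.

Lemma oag_ltNge (a b : G) : (a < b) = ~~ (b <= a).
Proof.
rewrite lt_neqAle; have [le_ba|] := boolP (b <= a); last first.
  by have /orP[->|->] // := oag_le_total a b => nba; rewrite andbT; apply: contraNneq nba => ->.
by apply/negP => /andP[/eqP ab le_ab]; apply: ab; apply/le_anti/andP.
Qed.

Lemma top_leD (a b c e : option G) :
  top_le a b -> top_le c e -> top_le (top_add a c) (top_add b e).
Proof.
case: a b c e => [a|] [b|] [c|] [e|] //= ab ce.
apply: (@le_trans _ _ (a + e)); first exact: oag_leD2l.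
by rewrite ![_ + e]addrC; apply: oag_leD2l.
Qed.

Lemma top_ltD (a b : G) (c e : option G) :
  top_le (Some a) c -> top_lt (Some b) e -> top_lt (Some (a + b)) (top_add c e).
Proof.
rewrite /top_lt; case: c e => [c|] [e|] //= ac; rewrite -!oag_ltNge => be.
have le_e : a + e <= c + e.
  by rewrite ![_ + e]addrC; apply: oag_leD2l.
apply: lt_le_trans le_e; rewrite lt_neqAle oag_leD2l ?ltW // andbT.
by apply: contraTneq be => /addrI ->; rewrite ltxx.
Qed.

Lemma val1 : v 1 = Some 0.
Proof.
have := valuationM v 1 1; rewrite mulr1.
case E: (v 1) => [a|] /= => [[/eqP]|].
  by rewrite -subr_eq0 opprD addNKr oppr_eq0 => /eqP ->.
by move/val_eq_top: E => /eqP; rewrite oner_eq0.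
Qed.

Lemma val_opp x : v (- x) = v x.
Proof.
have vN1 : v (-1) = Some 0.
  have := valuationM v (-1) (-1); rewrite mulrNN mulr1 val1.
  case: (v (-1)) => [a|] //= [e]; congr Some.
  have /orP[a0|a0] := oag_le_total 0 a; apply/eqP; rewrite eq_le a0 /= ?andbT.
    by have := oag_leD2l a _ _ a0; rewrite addr0 e.
  by have := oag_leD2l a _ _ a0; rewrite addr0 e.
by rewrite -mulN1r valuationM vN1; case: (v x) => //= a; rewrite add0r.
Qed.

Lemma top_lexx (a : option G) : top_le a a. Proof. by case: a => /=. Qed.

Lemma val_leD (b : G) x y : top_le (Some b) (v x) -> top_le (Some b) (v y) ->
  top_le (Some b) (v (x + y)).
Proof.
have := valuationD v x y; rewrite /top_min.
case: (v x) (v y) (v (x + y)) => [a|] [c|] [e|] //=.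
- by case: ifP => _ /= h h1 h2; apply: le_trans h.
- by move=> h h1 _; apply: le_trans h.
- by move=> h _ h2; apply: le_trans h.
Qed.

Lemma val_ltD (b : G) x y : top_lt (Some b) (v x) -> top_lt (Some b) (v y) ->
  top_lt (Some b) (v (x + y)).
Proof.
have := valuationD v x y; rewrite /top_min /top_lt.
case: (v x) (v y) (v (x + y)) => [a|] [c|] [e|] //=; rewrite -?oag_ltNge.
- by case: ifP => _ /= h h1 h2; apply: lt_le_trans h.
- by move=> h h1 _; apply: lt_le_trans h.
- by move=> h _ h2; apply: lt_le_trans h.
Qed.

Lemma val_le_sum (b : G) (I : Type) (r : seq I) (P : pred I) (f : I -> F) :
  (forall i, P i -> top_le (Some b) (v (f i))) ->
  top_le (Some b) (v (\sum_(i <- r | P i) f i)).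
Proof.
move=> h; elim/big_ind: _ => //; first by rewrite val0.
by move=> x y; apply: val_leD.
Qed.

Lemma val_lt_sum (b : G) (I : Type) (r : seq I) (P : pred I) (f : I -> F) :
  (forall i, P i -> top_lt (Some b) (v (f i))) ->
  top_lt (Some b) (v (\sum_(i <- r | P i) f i)).
Proof.
move=> h; elim/big_ind: _ => //; first by rewrite /top_lt val0.
by move=> x y; apply: val_ltD.
Qed.

Definition value_group : set G := [set g | exists x, v x = Some g].

End ValuationTheory.

Section Rank.
Variable G : ordAbGroupType.
Local Open Scope classical_set_scope.

(* [H] is a convex (isolated) subgroup of the subgroup [S] of [G]. *)
Definition convex_subgroup (S H : set G) : Prop :=
  [/\ H `<=` S, H 0, (forall x y, H x -> H y -> H (x - y)) &
      forall x y, S x -> H y -> 0 <= x -> x <= y -> H x].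

(* Exactly one convex subgroup is proper. *)
Definition rank_one (S : set G) : Prop :=
  S <> [set 0] /\
  forall H, convex_subgroup S H -> H = [set 0] \/ H = S.

(* The part of [S (x) Q], compared inside [G (x) Q], which lies in [G]. *)
Definition div_hull (S : set G) : set G :=
  [set g | exists2 n : nat, (0 < n)%N & S (g *+ n)].

End Rank.

Section Restriction.
Variables (K : fieldType) (G : ordAbGroupType).
Variables (F : fieldType) (f : {rmorphism K -> F}) (v : valuation F G).

Fact val_restr_eq_top (x : K) : v (f x) = None <-> x = 0.
Proof. by rewrite val_eq_top; split=> [/eqP|->]; rewrite ?fmorph_eq0 ?rmorph0 // => /eqP. Qed.

Fact val_restrM (x y : K) : v (f (x * y)) = top_add (v (f x)) (v (f y)).
Proof. by rewrite rmorphM valuationM. Qed.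

Fact val_restrD (x y : K) :
  top_le (top_min (v (f x)) (v (f y))) (v (f (x + y))).
Proof. by rewrite rmorphD valuationD. Qed.

Definition val_restr : valuation K G :=
  Valuation val_restr_eq_top val_restrM val_restrD.

End Restriction.

(** * Residue field *)

Section ResidueField.
Variables (F : fieldType) (G : ordAbGroupType) (v : valuation F G).

Definition val_ring_pred : {pred F} := fun x => top_le (Some 0) (v x).

Fact val_ring_subring_closed : subring_closed val_ring_pred.
Proof.
split=> [|x y|x y]; rewrite !unfold_in /val_ring_pred.
- by rewrite val1 /=.
- by move=> hx hy; apply: val_leD; rewrite ?val_opp.
- by move=> hx hy; have := top_leD hx hy; rewrite /= addr0 valuationM.
Qed.

HB.instance Definition _ :=
  GRing.isSubringClosed.Build F val_ring_pred val_ring_subring_closed.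

Definition val_ring := {x : F | x \in val_ring_pred}.
HB.instance Definition _ := SubChoice.on val_ring.
HB.instance Definition _ := [SubChoice_isSubComNzRing of val_ring by <:].

Definition val_maxideal : {pred val_ring} :=
  fun x => top_lt (Some 0) (v (val x)).

Fact val_maxideal_idealr_closed : idealr_closed val_maxideal.
Proof.
split; rewrite ?unfold_in /val_maxideal.
- by rewrite /top_lt /= val0.
- by rewrite /top_lt /= val1 /= lexx.
- move=> a x y; rewrite !unfold_in /= => hx hy; apply: val_ltD => //.
  by have := top_ltD (valP a) hx; rewrite /= addr0 valuationM.
Qed.

HB.instance Definition _ :=
  isIdealr.Build val_ring val_maxideal val_maxideal_idealr_closed.

Definition residue_field := {ideal_quot val_maxideal}.
HB.instance Definition _ := GRing.ComNzRing.on residue_field.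

End ResidueField.

(** * The group algebra *)

(* [monalg] only makes [{malg F[G]}] a ring when the monoid [G] has no
   nontrivial unit, so the convolution product is put here on a copy of it. *)
Section GroupAlgebra.
Variables (F : comNzRingType) (G : zmodType).

Definition group_alg := {malg F[G]}.
HB.instance Definition _ := GRing.Zmodule.on group_alg.

Implicit Types f g h : group_alg.

Definition gmul f g : group_alg :=
  \sum_(k <- msupp f) \sum_(l <- msupp g) << f@_k * g@_l *g k + l >>.

Lemma gmulw (d1 d2 : {fset G}) f g :
  (msupp f `<=` d1 -> msupp g `<=` d2 ->
  gmul f g = \sum_(k <- d1) \sum_(l <- d2) << f@_k * g@_l *g k + l >>)%fset.
Proof.
move=> le1 le2; rewrite /gmul (big_fset_incl _ le1) /=; last first.
  by move=> k _ /mcoeff_outdom fk; rewrite big1 // => l _; rewrite fk mul0r monalgU0.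
apply/eq_bigr=> k _; apply/big_fset_incl => // l _ /mcoeff_outdom ->.
by rewrite mulr0 monalgU0.
Qed.

Fact gmulC : commutative gmul.
Proof.
move=> f g; rewrite /gmul exchange_big; apply/eq_bigr=> k _; apply/eq_bigr=> l _.
by rewrite mulrC addrC.
Qed.

Fact gmulDl : left_distributive gmul +%R.
Proof.
move=> f1 f2 g; pose d := (msupp f1 `|` msupp f2)%fset.
rewrite (@gmulw d (msupp g)) ?msuppD_le ?fsubset_refl //.
rewrite (@gmulw d (msupp g) f1) ?fsubsetUl ?fsubset_refl //.
rewrite (@gmulw d (msupp g) f2) ?fsubsetUr ?fsubset_refl //.
rewrite -big_split /=; apply/eq_bigr=> k _.
rewrite -big_split /=; apply/eq_bigr=> l _.
by rewrite mcoeffD mulrDl monalgUD.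
Qed.

Fact gmul0 g : gmul 0 g = 0.
Proof. by rewrite /gmul msupp0 big_seq_fset0. Qed.

Fact gmulUU (a b : F) k l :
  gmul << a *g k >> << b *g l >> = << a * b *g k + l >>.
Proof. by rewrite (gmulw msuppU_le msuppU_le) !big_seq_fset1 !mcoeffUU. Qed.

Fact gmul_suml (I : Type) (r : seq I) (f : I -> group_alg) g :
  gmul (\sum_(i <- r) f i) g = \sum_(i <- r) gmul (f i) g.
Proof. exact: (big_morph (gmul^~ g) (fun x y => gmulDl x y g) (gmul0 g)). Qed.

Fact gmul_sumr (I : Type) (r : seq I) (f : I -> group_alg) g :
  gmul g (\sum_(i <- r) f i) = \sum_(i <- r) gmul g (f i).
Proof. by rewrite gmulC gmul_suml; apply/eq_bigr => i _; rewrite gmulC. Qed.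

Fact gmulA : associative gmul.
Proof.
move=> f g h; rewrite [f]monalgE (gmul_suml _ _ (gmul g h)) (gmul_suml _ _ g).
rewrite (gmul_suml _ _ h); apply/eq_bigr => k _; set u := << _ *g k >>.
rewrite [g]monalgE (gmul_suml _ _ h) (gmul_sumr _ _ u) (gmul_sumr _ _ u).
rewrite (gmul_suml _ _ h); apply/eq_bigr => l _; set w := << _ *g l >>.
rewrite [h]monalgE (gmul_sumr _ _ w) (gmul_sumr _ _ u) (gmul_sumr _ _ (gmul u w)).
by apply/eq_bigr => m _; rewrite !gmulUU mulrA addrA.
Qed.

Fact gmul1 : left_id (<< 1 *g 0 >> : group_alg) gmul.
Proof.
move=> g; rewrite [g]monalgE gmul_sumr; apply/eq_bigr => k _.
by rewrite gmulUU mul1r add0r.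
Qed.

Fact gone_neq0 : (<< 1 *g 0 >> : group_alg) != 0.
Proof. by rewrite monalgU_eq0 oner_eq0. Qed.

HB.instance Definition _ := GRing.Zmodule_isComNzRing.Build group_alg
  gmulA gmulC gmul1 gmulDl gone_neq0.

Lemma group_algM f g :
  f * g = \sum_(k <- msupp f) \sum_(l <- msupp g) << f@_k * g@_l *g k + l >>.
Proof. by []. Qed.

Lemma group_alg1 : 1 = << 1 *g 0 >> :> group_alg.
Proof. by []. Qed.

End GroupAlgebra.

(** * The graded algebra of a valuation *)

(* [gr v] is the direct sum over [b : G] of P_b / P_b+, obtained as the quotient
   of the subring [rees v] of the group algebra formed by the families (f_b)
   with f_b in P_b, by the ideal of the families with f_b in P_b+. *)
Section GradedAlgebra.
Variables (F : fieldType) (G : ordAbGroupType) (v : valuation F G).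

Definition rees_pred : {pred group_alg F G} :=
  fun f => all (fun b => top_le (Some b) (v f@_b)) (msupp f).

Lemma rees_predP (f : group_alg F G) :
  reflect (forall b, top_le (Some b) (v f@_b)) (f \in rees_pred).
Proof.
apply: (iffP allP) => h b; last by move=> _; apply: h.
by have [/h|] := msuppP f b; rewrite // val0.
Qed.

Fact rees_subring_closed : subring_closed rees_pred.
Proof.
split=> [|f g /rees_predP hf /rees_predP hg|f g /rees_predP hf /rees_predP hg].
- apply/rees_predP => b; rewrite group_alg1 mcoeffU.
  by case: eqP => [<-|_]; rewrite ?val1 ?mulr0n ?val0 /=.
- by apply/rees_predP => b; rewrite mcoeffB val_leD ?val_opp.
apply/rees_predP => b; rewrite group_algM raddf_sum /=; apply: val_le_sum => k _.
rewrite raddf_sum /=; apply: val_le_sum => l _; rewrite mcoeffU.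
case: eqP => [<-|_]; last by rewrite mulr0n val0.
by rewrite mulr1n valuationM; apply: (top_leD (hf k) (hg l)).
Qed.

HB.instance Definition _ :=
  GRing.isSubringClosed.Build (group_alg F G) rees_pred rees_subring_closed.

Definition rees := {f : group_alg F G | f \in rees_pred}.
HB.instance Definition _ := SubChoice.on rees.
HB.instance Definition _ := [SubChoice_isSubComNzRing of rees by <:].

Definition rees_plus : {pred rees} :=
  fun f => all (fun b => top_lt (Some b) (v (val f)@_b)) (msupp (val f)).

Lemma rees_plusP (f : rees) :
  reflect (forall b, top_lt (Some b) (v (val f)@_b)) (f \in rees_plus).
Proof.
apply: (iffP allP) => h b; last by move=> _; apply: h.
by have [/h|] := msuppP (val f) b; rewrite // /top_lt val0.
Qed.

Fact rees_plus_idealr_closed : idealr_closed rees_plus.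
Proof.
split.
- by apply/rees_plusP => b; rewrite /= mcoeff0 /top_lt val0.
- apply/rees_plusP => /(_ 0); rewrite /= group_alg1 mcoeffUU val1.
  by rewrite /top_lt /= lexx.
move=> a f g /rees_plusP hf /rees_plusP hg; apply/rees_plusP => b /=.
rewrite mcoeffD; apply: val_ltD => //.
rewrite group_algM raddf_sum /=; apply: val_lt_sum => k _.
rewrite raddf_sum /=; apply: val_lt_sum => l _; rewrite mcoeffU.
case: eqP => [<-|_]; last by rewrite mulr0n /top_lt val0.
by rewrite mulr1n valuationM; apply: top_ltD (hf l); apply/rees_predP/(valP a).
Qed.

HB.instance Definition _ := isIdealr.Build rees rees_plus rees_plus_idealr_closed.

Definition gr := {ideal_quot rees_plus}.
HB.instance Definition _ := GRing.ComNzRing.on gr.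

(* The class of [y] in P_b / P_b+ (0 if [y] is not in P_b). *)
Definition gr_class (b : G) (y : F) : gr :=
  \pi_gr (insubd (0 : rees) (<< y *g b >> : group_alg F G)).

Lemma gr_class_eq0 (b : G) (y : F) : top_le (Some b) (v y) ->
  (gr_class b y == 0) = top_lt (Some b) (v y).
Proof.
move=> vy; have hy : (<< y *g b >> : group_alg F G) \in rees_pred.
  apply/rees_predP => c; rewrite mcoeffU.
  by case: eqP => [<-|_]; rewrite ?mulr1n ?mulr0n ?val0.
have <- : \pi_gr 0 = 0 :> gr by exact: (rmorph0 \pi_{ideal_quot rees_plus}).
rewrite /gr_class -Quotient.idealrBE subr0.
apply/rees_plusP/idP => [/(_ b)|lt_by c]; rewrite (insubdK _ hy) ?mcoeffUU //.
by rewrite mcoeffU; case: eqP => [<-|_]; rewrite ?mulr1n // mulr0n /top_lt val0.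
Qed.

Definition in_form (y : F) : gr := if v y is Some b then gr_class b y else 0.

Definition homogeneous (g : gr) : Prop :=
  exists b y, top_le (Some b) (v y) /\ g = gr_class b y.

End GradedAlgebra.

(** * Minimal relations over subrings of a commutative ring *)

Section Relations.
Variable R : comNzRingType.
Local Open Scope classical_set_scope.

(* The subring generated by [S]. *)
Definition gen_subring (S : set R) : set R :=
  [set x | forall T : set R,
     T 1 -> (forall y z, T y -> T z -> T (y - z)) ->
     (forall y z, T y -> T z -> T (y * z)) -> S `<=` T -> T x].

(* [P] is the monic polynomial of least degree among the nonzero polynomials
   with coefficients in [S] that vanish at [t]. *)
Definition minimal_relation (S : set R) (t : R) (P : {poly R}) : Prop :=
  [/\ P \is monic, forall j, S P`_j, P.[t] = 0 &
      forall P' : {poly R}, P' != 0 -> (forall j, S P'`_j) -> P'.[t] = 0 ->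
        (size P <= size P')%N].

End Relations.

(* [A^*] for a graded subring [A] of [gr v]. As [F] is a field, the nonzero
   homogeneous elements of [gr v] are units: the fractions g / h stay in [gr v],
   where g / h is the unique z with z * h = g. *)
Definition homog_fractions (F : fieldType) (G : ordAbGroupType)
    (v : valuation F G) (A : set (gr v)) : set (gr v) :=
  [set z | exists g h, [/\ A g, A h, homogeneous h, h != 0 & z * h = g]]%classic.

(** * Well-ordered index sets *)

Section OrderTypes.

(* [A] is isomorphic to an initial segment of [B]. *)
Definition order_type_le (A B : Type) (leA : rel A) (leB : rel B) : Prop :=
  exists f : A -> B, (forall a a', leB (f a) (f a') = leA a a') /\
    (forall a b, leB b (f a) -> exists a', f a' = b).

Definition omega_le : rel nat := fun m n => (m <= n)%N.

Definition omega_plus_one_le : rel (option nat) := @top_le _ nat.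

Definition omega_squared_le : rel (nat * nat) :=
  fun a b => (a.1 < b.1)%N || (a.1 == b.1) && (a.2 <= b.2)%N.

End OrderTypes.

Section IndexSet.
Context {d : Order.disp_t} {Lam : bOrderType d}.
Implicit Types (D : set Lam) (i j k l : Lam).
Local Open Scope classical_set_scope.
Local Open Scope order_scope.

Definition well_ordered : Prop :=
  forall A : set Lam, A !=set0 -> exists2 m, A m & forall a, A a -> m <= a.

Definition is_max i : Prop := forall j, j <= i.

(* [j = i + 1] *)
Definition succ_idx i j : Prop := i < j /\ forall k, ~ (i < k /\ k < j).

(* [j = i + t] *)
Fixpoint add_idx (t : nat) i j : Prop :=
  if t is s.+1 then exists2 k, add_idx s i k & succ_idx k j else i = j.

(* [j = i + omega] *)
Definition add_omega_idx i j : Prop :=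
  (forall t, exists2 k, add_idx t i k & k < j) /\
  (forall l, (forall t k, add_idx t i k -> k < l) -> j <= l).

Variable alpha : Lam -> nat.

(* [inessential D i] and [next_idx D i j] (that is, [j = i+]) are computed in
   the initial segment [D] of [Lam]. *)
Definition inessential D i : Prop :=
  (exists2 j, D j & add_omega_idx i j) /\
  (forall t k, add_idx t i k -> alpha k = 1%N).

Definition next_idx D i j : Prop :=
  D j /\ (inessential D i /\ add_omega_idx i j \/
          ~ inessential D i /\ succ_idx i j).

End IndexSet.

(** * Key polynomials *)

Section KeyPolynomials.
Context {K : fieldType} {G : ordAbGroupType}.
Variable v : valuation {fraction {poly K}} G.
Context {d : Order.disp_t} {Lam : bOrderType d}.
Variables (alpha : Lam -> nat) (Q : Lam -> {poly K}).

Implicit Types (i l p : Lam) (n : nat) (f : {poly K}).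
Local Open Scope classical_set_scope.

Definition deg f : nat := (size f).-1.

Definition pval f : option G := v f%:F.
Definition pin f : gr v := in_form v f%:F.

Definition cst_emb : {rmorphism K -> {fraction {poly K}}} :=
  ((@FracField.tofrac {poly K}) \o @polyC K)%FUN.

Definition base_val : valuation K G := val_restr cst_emb v.
Definition base_group : set G := value_group base_val.

Definition prekey_polynomials : Prop :=
  [/\ well_ordered (Lam := Lam) /\ countable [set: Lam],
      forall i, (0 < alpha i)%N,
      alpha \bot%O = 1%N,
      (forall i, Q i \is monic) /\ Q \bot%O = 'X &
      forall i i0, ~ is_max i -> (i0 < i)%O -> next_idx alpha setT i0 i ->
        deg (Q i) = (alpha i * deg (Q i0))%N].

(** ** Standard expansions *)

(* The exponents [gamma] of a monomial. *)
Definition expo := {fsfun Lam -> nat with 0%N}.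

(* A finite sum of monomials with distinct exponents, given by its nonzero
   coefficients. *)
Definition monomial_sum := {fsfun expo -> K with 0}.

Definition monomial (g : expo) : {poly K} :=
  \prod_(i <- finsupp g) Q i ^+ g i.

Definition eval_sum (E : monomial_sum) : {poly K} :=
  \sum_(g <- finsupp E) E g *: monomial g.

Definition standard_expo l (g : expo) : Prop :=
  let D := [set q | (q <= l)%O] in
  [/\ forall i, (l < i)%O -> g i = 0%N,
      forall i j, (i < l)%O -> next_idx alpha D i j -> (g i < alpha j)%N &
      forall i m j j', inessential alpha D i -> next_idx alpha D i m ->
        next_idx alpha D j m -> next_idx alpha D j' m ->
        g j <> 0%N -> g j' <> 0%N -> j = j'].

Definition free_standard_expansion l (E : monomial_sum) : Prop :=
  (forall g, g \in finsupp E -> standard_expo l g /\ g l = 0%N) /\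
  pval (eval_sum E) =
    \big[top_min/None]_(g <- finsupp E) pval (E g *: monomial g).

Definition eval_expansion l n (C : nat -> monomial_sum) : {poly K} :=
  \sum_(j < n.+1) eval_sum (C j) * Q l ^+ j.

Definition standard_expansion l n f (C : nat -> monomial_sum) : Prop :=
  (forall j, (j <= n)%N -> free_standard_expansion l (C j)) /\
  f = eval_expansion l n C.

Definition expansion_min l n (C : nat -> monomial_sum) : option G :=
  \big[top_min/None]_(j < n.+1) pval (eval_sum (C j) * Q l ^+ j).

(** ** Sets of key polynomials *)

(* [G_{nu_K}[in Q_q, q < l]]; the image of [G_{nu_K}] in [gr v] is generated by
   the initial forms of the constants. *)
Definition initial_subring l : set (gr v) :=
  gen_subring ([set pin c%:P | c in [set: K]] `|`
               [set pin (Q q) | q in [set q | (q < l)%O]]).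

(* [p] is the immediate predecessor of [i]. *)
Definition successor_key p i : Prop :=
  exists C : nat -> monomial_sum,
  [/\ forall j, (j < alpha i)%N -> free_standard_expansion p (C j),
      Q i = Q p ^+ alpha i + \sum_(j < alpha i) eval_sum (C j) * Q p ^+ j,
      forall j g, (j < alpha i)%N -> g \in finsupp (C j) ->
        pval (C j g *: monomial g * Q p ^+ j) = pval (Q p ^+ alpha i) &
      minimal_relation (homog_fractions (initial_subring p)) (pin (Q p))
        ('X^(alpha i) + \sum_(j < alpha i)
           (\sum_(g <- finsupp (C j)) pin (C j g)%:P * pin (monomial g))%:P
             * 'X^j)].

(* The value of [f] exceeds the minimum of the values of the terms of every
   [l]-standard expansion of [f], whatever its length. *)
Definition exceeds_expansions l f : Prop :=
  (exists n C, standard_expansion l n f C) /\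
  (forall n C, standard_expansion l n f C ->
     top_lt (expansion_min l n C) (pval f)).

(* The bound is [b / n], with [b] in [base_group]. *)
Definition values_bounded_below i : Prop :=
  exists2 n : nat, (0 < n)%N &
  exists2 b : G, base_group b &
  forall j, (j < i)%O -> top_le (top_muln n (pval (Q j))) (Some b).

Definition limit_key i : Prop :=
  [/\ exists i0, next_idx alpha setT i0 i,
      forall i0, next_idx alpha setT i0 i ->
        exists C, standard_expansion i0 (alpha i) (Q i) C,
      forall i0, next_idx alpha setT i0 i -> exceeds_expansions i0 (Q i),
      forall f,
        (forall i0, next_idx alpha setT i0 i -> exceeds_expansions i0 f) ->
        (deg (Q i) <= deg f)%N &
      values_bounded_below i \/ ~ is_max i ->
        forall i0 C, next_idx alpha setT i0 i ->
          standard_expansion i0 (alpha i) (Q i) C ->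
          [/\ eval_sum (C (alpha i)) = 1,
              expansion_min i0 (alpha i) C = top_muln (alpha i) (pval (Q i0)) &
              pval (eval_sum (C 0%N)) = top_muln (alpha i) (pval (Q i0))]].

Definition key_polynomials : Prop :=
  [/\ prekey_polynomials,
      forall i, ~ is_max i -> exists2 b, pval (Q i) = Some b & div_hull base_group b,
      forall p i, succ_idx p i -> successor_key p i,
      forall i, (\bot < i)%O -> (forall p, ~ succ_idx p i) -> limit_key i &
      forall n, infinite_set [set i | deg (Q i) = n] ->
        forall f, f \is monic -> deg f = n ->
          exists2 i, deg (Q i) = n & top_le (pval f) (pval (Q i))].

(** ** Truncations and completeness *)

(* [c] is the list of the coefficients d_{j,i} of the [Q_i]-expansion of [f]. *)
Definition Q_expansion i f (c : {poly {poly K}}) : Prop :=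
  f = c.[Q i] /\ forall j, (size (c`_j)%R < size (Q i))%N.

(* [nu_i(f) = a] *)
Definition truncation i f (a : option G) : Prop :=
  exists2 c, Q_expansion i f c &
    a = \big[top_min/None]_(j < size c)
          top_add (pval c`_j) (top_muln j (pval (Q i))).

Definition complete_key_polynomials : Prop :=
  key_polynomials /\ forall f, f != 0 -> exists i, truncation i f (pval f).

End KeyPolynomials.

(* Main.v *)
Require Import Defs.
From HB Require Import structures.
From mathcomp Require Import all_boot all_order all_algebra.
From mathcomp Require Import generic_quotient ring_quotient fraction.
From mathcomp Require Import finmap.
From mathcomp Require Import boolp classical_sets cardinality.
From mathcomp.multinomials Require Import monalg.
From mathcomp Require Import zify ring.

(** A polynomial [f] is exact at a monic [Q] when the truncation of the valuation at
    [Q] gives [f] its value. While some polynomial is inexact at [Q], one of least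
    degree, with its terms of non minimal value discarded, is the next key
    polynomial; this produces a row of type omega. If a row stays inexact, its degrees
    are eventually constant, and a polynomial of least degree that is inexact at all
    its members starts the next row. When the values of the row are unbounded, the
    value of this polynomial exceeds the divisible hull of the value group of [K], so
    that everything is exact at it and the construction stops.

    The degree grows at least every second row, whence completeness and the bound
    omega * omega, provided that a row starting at a limit is maximal or cofinal in
    its degree. If the values in this degree have no maximum, a large value is reached
    in finitely many steps from a start [B + sum_i c_i M_i], with one monomial [M_i]
    for each class of values modulo the value group of [K] and all [c_i M_i] of value
    less than [B]: when the terms to be added at some value cancel, the pending term
    [c_i M_i] of that class is there to keep the value of the current polynomial.

    On the first row, initial forms of standard monomials are independent, so no
    cancellation occurs and the values are cofinal in the stable degree. In residue
    characteristic 0, the classical completion of the power then contradicts the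
    existence of a bounded limit; only an unbounded limit remains, and it requires
    a valuation of rank greater than 1. *)

(** The obstacle is the cofinality required in every degree that occurs infinitely often. A step
    within a degree may only add terms whose value is that of the current polynomial. After a limit,
    initial forms of standard monomials satisfy relations: a tail member [c t] has, up to sign, the
    initial form of [c t.+1 - c t]. Terms added at one value may then cancel, and expanding their
    sum again may lead to new cancellations, so a target value need not be reached in finitely many
    steps. Pending terms restore a finite path, but room for them must be reserved before the
    target, hence its expansion, is known: this is why [key_pair] bounds the number of terms
    uniformly. Rank one enters through the Archimedean property of the divisible hull of the value
    group of [K]. It makes late increments of a bounded row arbitrarily small, which normalizes
    limit polynomials, and it provides a countable cofinal sequence of targets to schedule along a
    row. Truncations are compared with thresholds rather than computed as minima, so the zero
    polynomial seldom needs a separate case. *)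

Set Implicit Arguments.
Unset Strict Implicit.
Unset Printing Implicit Defensive.

Import Order.TTheory GRing.Theory.
Local Open Scope ring_scope.
Local Open Scope classical_set_scope.

(** * Linear arithmetic in ordered abelian groups *)


(* The square-zero extension of the integers by a group: the [ring] tactic there
   decides identities between linear expressions in the group. *)
Section TrivialExtension.
Variable G : zmodType.

Definition trivext : Type := (int * G)%type.
HB.instance Definition _ := GRing.Zmodule.on trivext.

Definition te_mul (a b : trivext) : trivext :=
  (a.1 * b.1, b.2 *~ a.1 + a.2 *~ b.1).
Definition te_one : trivext := (1, 0).

Fact te_mulA : associative te_mul.
Proof.
move=> [m x] [n y] [p z]; congr pair; rewrite /= ?mulrA //.
by rewrite !mulrzDl -!mulrzA addrA [(n * m)%R]mulrC [(p * m)%R]mulrC.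
Qed.
Fact te_mulC : commutative te_mul.
Proof. by move=> [m x] [n y]; congr pair; rewrite /= ?[m * n]mulrC // addrC. Qed.
Fact te_mul1 : left_id te_one te_mul.
Proof. by move=> [m x]; congr pair; rewrite /= ?mul1r // mulr1z mul0rz addr0. Qed.
Fact te_mulDl : left_distributive te_mul +%R.
Proof.
move=> [m x] [n y] [p z]; congr pair; rewrite /= ?mulrDl //.
by rewrite mulrzDr mulrzDl addrACA.
Qed.
Fact te_one_neq0 : te_one != 0.
Proof. by apply/eqP => -[]. Qed.
HB.instance Definition _ := GRing.Zmodule_isComNzRing.Build trivext
  te_mulA te_mulC te_mul1 te_mulDl te_one_neq0.

Definition te_inj (x : G) : trivext := (0, x).

Lemma te_injI : injective te_inj. Proof. by move=> x y []. Qed.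
Lemma te_injD x y : te_inj (x + y) = te_inj x + te_inj y.
Proof. by congr pair; rewrite /= addr0. Qed.
Lemma te_injN x : te_inj (- x) = - te_inj x.
Proof. by congr pair; rewrite /= oppr0. Qed.
Lemma te_inj0 : te_inj 0 = 0. Proof. by []. Qed.
Lemma te_injMn x n : te_inj (x *+ n) = n%:R * te_inj x.
Proof.
elim: n => [|n IH]; first by rewrite mulr0n mul0r.
by rewrite mulrS te_injD IH -add1n natrD mulrDl mul1r.
Qed.
End TrivialExtension.

Ltac gring := apply: te_injI; rewrite ?(te_injD, te_injN, te_injMn, te_inj0); ring.

Section OrderedGroup.
Variable G : ordAbGroupType.
Implicit Types a b c d : G.

Lemma gle_addl c a b : (c + a <= c + b) = (a <= b).
Proof.
apply/idP/idP => [h|]; last exact: oag_leD2l.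
by have := oag_leD2l (- c) _ _ h; rewrite !addKr.
Qed.
Lemma gle_addr c a b : (a + c <= b + c) = (a <= b).
Proof. by rewrite ![_ + c]addrC gle_addl. Qed.
Lemma gltNge a b : (a < b) = ~~ (b <= a). Proof. exact: oag_ltNge. Qed.
Lemma gleNgt a b : (a <= b) = ~~ (b < a). Proof. by rewrite gltNge negbK. Qed.
Lemma glt_addl c a b : (c + a < c + b) = (a < b).
Proof. by rewrite !gltNge gle_addl. Qed.
Lemma glt_addr c a b : (a + c < b + c) = (a < b).
Proof. by rewrite !gltNge gle_addr. Qed.

Lemma gleD a b c d : a <= b -> c <= d -> a + c <= b + d.
Proof. by move=> h1 h2; apply: (@le_trans _ _ (b + c)); rewrite ?gle_addl ?gle_addr. Qed.
Lemma gltD a b c d : a < b -> c <= d -> a + c < b + d.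
Proof. by move=> h1 h2; apply: (@lt_le_trans _ _ (b + c)); rewrite ?gle_addl ?glt_addr. Qed.
Lemma gleltD a b c d : a <= b -> c < d -> a + c < b + d.
Proof. by move=> h1 h2; apply: (@le_lt_trans _ _ (b + c)); rewrite ?glt_addl ?gle_addr. Qed.
(** The form in which linear arithmetic is done: known inequalities are added up, and [gring] checks
    that the differences of the two sides agree. *)
Lemma gle_of a b c d : c <= d -> b - a = d - c -> a <= b.
Proof. by move=> h e; rewrite -(gle_addr (- a)) subrr e -(subrr c) gle_addr. Qed.
Lemma glt_of a b c d : c < d -> b - a = d - c -> a < b.
Proof. by move=> h e; rewrite -(glt_addr (- a)) subrr e -(subrr c) glt_addr. Qed.
Lemma gleMn a b n : a <= b -> a *+ n <= b *+ n.
Proof. by move=> h; elim: n => // n IH; rewrite !mulrS gleD. Qed.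
Lemma gltMn a b n : (0 < n)%N -> a < b -> a *+ n < b *+ n.
Proof. by case: n => // n _ h; rewrite !mulrS gltD ?gleMn // ltW. Qed.
Lemma gleMn_inv a b n : (0 < n)%N -> a *+ n <= b *+ n -> a <= b.
Proof. by move=> n0; rewrite !gleNgt; apply: contra; exact: gltMn. Qed.
Lemma gtotal a b : (a <= b) || (b <= a). Proof. exact: oag_le_total. Qed.
End OrderedGroup.

(** * Values of polynomials *)


Section PolyValuation.
Variables (K : fieldType) (G : ordAbGroupType).
Variable v : valuation {fraction {poly K}} G.
Implicit Types (f g h : {poly K}) (a b c : G).

Definition vge a f : bool := top_le (Some a) (pval v f).
Definition vgt a f : bool := top_lt (Some a) (pval v f).
(* Junk value 0 at f = 0. *)
Definition vl f : G := odflt 0 (pval v f).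

Lemma pval0 : pval v 0 = None.
Proof. by rewrite /pval rmorph0 Defs.val0. Qed.
Lemma pval_eq0 f : pval v f = None -> f = 0.
Proof. by move/val_eq_top/eqP; rewrite tofrac_eq0 => /eqP. Qed.
Lemma pval_vl f : f != 0 -> pval v f = Some (vl f).
Proof. by rewrite /vl; case E: (pval v f) => [a|] //= /eqP[]; exact: pval_eq0. Qed.
Lemma pvalM f g : pval v (f * g) = top_add (pval v f) (pval v g).
Proof. by rewrite /pval rmorphM valuationM. Qed.
Lemma pvalP f a : pval v f = Some a <-> f != 0 /\ vl f = a.
Proof.
split=> [h|[h <-]]; last exact: pval_vl.
have f0 : f != 0 by apply/eqP => f0; move: h; rewrite f0 pval0.
by split=> //; move: h; rewrite pval_vl // => -[].
Qed.
Lemma vlM f g : f != 0 -> g != 0 -> vl (f * g) = vl f + vl g.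
Proof. by move=> f0 g0; rewrite /vl pvalM (pval_vl f0) (pval_vl g0). Qed.
Lemma pval1 : pval v 1 = Some 0.
Proof. by rewrite /pval rmorph1 Defs.val1. Qed.
Lemma vl1 : vl 1 = 0. Proof. by rewrite /vl pval1. Qed.
Lemma pvalN f : pval v (- f) = pval v f.
Proof. by rewrite /pval rmorphN val_opp. Qed.
Lemma vlX f n : f != 0 -> vl (f ^+ n) = vl f *+ n.
Proof.
move=> f0; elim: n => [|n IH]; first by rewrite expr0 vl1.
by rewrite exprS vlM ?expf_neq0 // IH mulrS.
Qed.

Lemma vge0 a : vge a 0. Proof. by rewrite /vge pval0. Qed.
Lemma vgt0 a : vgt a 0. Proof. by rewrite /vgt pval0. Qed.
Lemma vgeE a f : f != 0 -> vge a f = (a <= vl f).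
Proof. by move=> f0; rewrite /vge pval_vl. Qed.
Lemma vgtE a f : f != 0 -> vgt a f = (a < vl f).
Proof. by move=> f0; rewrite /vgt pval_vl // /top_lt /= gltNge. Qed.
Lemma vge_vl f : vge (vl f) f.
Proof. by have [->|f0] := eqVneq f 0; rewrite ?vge0 // vgeE. Qed.
Lemma vgtW a f : vgt a f -> vge a f.
Proof. by have [->|f0] := eqVneq f 0; rewrite ?vge0 // vgeE // vgtE // => /ltW. Qed.
Lemma vge_le a b f : a <= b -> vge b f -> vge a f.
Proof.
by have [->|f0] := eqVneq f 0; rewrite ?vge0 // !vgeE // => h1 h2; apply: le_trans h2.
Qed.
Lemma vge_lt a b f : a < b -> vge b f -> vgt a f.
Proof.
by have [->|f0] := eqVneq f 0; rewrite ?vgt0 // vgeE // vgtE // => h1 h2; apply: lt_le_trans h2.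
Qed.
Lemma vgeN a f : vge a (- f) = vge a f. Proof. by rewrite /vge pvalN. Qed.
Lemma vgtN a f : vgt a (- f) = vgt a f. Proof. by rewrite /vgt pvalN. Qed.
Lemma vgeD a f g : vge a f -> vge a g -> vge a (f + g).
Proof. by rewrite /vge /pval rmorphD; exact: val_leD. Qed.
Lemma vgtD a f g : vgt a f -> vgt a g -> vgt a (f + g).
Proof. by rewrite /vgt /pval rmorphD; exact: val_ltD. Qed.
Lemma vgeB a f g : vge a f -> vge a g -> vge a (f - g).
Proof. by move=> h1 h2; rewrite vgeD // vgeN. Qed.
Lemma vgtB a f g : vgt a f -> vgt a g -> vgt a (f - g).
Proof. by move=> h1 h2; rewrite vgtD // vgtN. Qed.
Lemma vge_sum a (I : eqType) (r : seq I) (P : pred I) (F : I -> {poly K}) :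
  (forall i, i \in r -> P i -> vge a (F i)) -> vge a (\sum_(i <- r | P i) F i).
Proof.
move=> h; rewrite big_seq_cond; elim/big_ind: _ => [|x y|i /andP[]]; first exact: vge0.
  exact: vgeD.
exact: h.
Qed.
Lemma vgt_sum a (I : eqType) (r : seq I) (P : pred I) (F : I -> {poly K}) :
  (forall i, i \in r -> P i -> vgt a (F i)) -> vgt a (\sum_(i <- r | P i) F i).
Proof.
move=> h; rewrite big_seq_cond; elim/big_ind: _ => [|x y|i /andP[]]; first exact: vgt0.
  exact: vgtD.
exact: h.
Qed.
Lemma vgeM a b f g : vge a f -> vge b g -> vge (a + b) (f * g).
Proof.
have [->|f0] := eqVneq f 0; first by rewrite mul0r !vge0.
have [->|g0] := eqVneq g 0; first by rewrite mulr0 !vge0.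
by rewrite !vgeE ?mulf_neq0 // vlM //; exact: gleD.
Qed.
Lemma vgtM a b f g : vge a f -> vgt b g -> vgt (a + b) (f * g).
Proof.
have [->|f0] := eqVneq f 0; first by rewrite mul0r !vgt0.
have [->|g0] := eqVneq g 0; first by rewrite mulr0 !vgt0.
by rewrite !vgtE ?vgeE ?mulf_neq0 // vlM //; exact: gleltD.
Qed.
Lemma vge_mulr a f g : g != 0 -> vge (a + vl g) (f * g) = vge a f.
Proof.
move=> g0; have [->|f0] := eqVneq f 0; first by rewrite mul0r !vge0.
by rewrite !vgeE ?mulf_neq0 // vlM // gle_addr.
Qed.
Lemma vgt_mulr a f g : g != 0 -> vgt (a + vl g) (f * g) = vgt a f.
Proof.
move=> g0; have [->|f0] := eqVneq f 0; first by rewrite mul0r !vgt0.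
by rewrite !vgtE ?mulf_neq0 // vlM // glt_addr.
Qed.
Lemma vge_mull a f g : g != 0 -> vge (vl g + a) (g * f) = vge a f.
Proof. by move=> g0; rewrite mulrC addrC vge_mulr. Qed.
Lemma vgt_mull a f g : g != 0 -> vgt (vl g + a) (g * f) = vgt a f.
Proof. by move=> g0; rewrite mulrC addrC vgt_mulr. Qed.
Lemma pval_eq_ge a f : vge a f -> ~~ vgt a f -> pval v f = Some a.
Proof.
have [->|f0] := eqVneq f 0; first by rewrite vgt0.
rewrite vgeE // vgtE // -gleNgt => h1 h2; apply/pvalP; split=> //.
by apply/le_anti; rewrite h1 h2.
Qed.
Lemma vgtNeq a f : pval v f = Some a -> vgt a f = false.
Proof. by case/pvalP => f0 <-; rewrite vgtE // ltxx. Qed.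
Lemma vge_eq a f : pval v f = Some a -> vge a f.
Proof. by case/pvalP => f0 <-; rewrite vge_vl. Qed.
Lemma pvalD_lt a f g : pval v f = Some a -> vgt a g -> pval v (f + g) = Some a.
Proof.
move=> hf hg; apply: pval_eq_ge; first by apply: vgeD; [exact: vge_eq|exact: vgtW].
by apply/negP => h; have := vgtB h hg; rewrite addrK (vgtNeq hf).
Qed.
Lemma pvalD_lt' a f g : vgt a f -> pval v g = Some a -> pval v (f + g) = Some a.
Proof. by rewrite addrC => *; exact: pvalD_lt. Qed.
Lemma vgt_oppP a f g : pval v f = Some a -> vgt a (f - g) -> pval v g = Some a.
Proof.
by move=> hf h; rewrite -[g](subKr f); apply: pvalD_lt; rewrite ?vgtN.
Qed.

Definition G0 a : Prop := base_group v a.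
Lemma G0P a : G0 a <-> exists2 c : K, c != 0 & vl c%:P = a.
Proof.
split=> [[x /= h]|[c c0 <-]].
  have /pvalP[h0 h1] : pval v x%:P = Some a by [].
  by exists x; rewrite // -polyC_eq0.
exists c; change (pval v c%:P = Some (vl c%:P)).
by rewrite pval_vl // polyC_eq0.
Qed.
Lemma G0_0 : G0 0.
Proof. by apply/G0P; exists 1; rewrite ?oner_neq0 ?vl1. Qed.
Lemma G0D a b : G0 a -> G0 b -> G0 (a + b).
Proof.
move=> /G0P[c c0 <-] /G0P[d d0 <-]; apply/G0P; exists (c * d); first by rewrite mulf_neq0.
by rewrite polyCM vlM ?polyC_eq0.
Qed.
Lemma G0N a : G0 a -> G0 (- a).
Proof.
move=> /G0P[c c0 <-]; apply/G0P; exists c^-1; first by rewrite invr_eq0.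
have /eqP := vl1; rewrite -polyC1 -(mulVf c0) polyCM vlM ?polyC_eq0 ?invr_eq0 //.
by rewrite addr_eq0 => /eqP.
Qed.
Lemma G0B a b : G0 a -> G0 b -> G0 (a - b).
Proof. by move=> h1 h2; apply: G0D => //; exact: G0N. Qed.
Lemma G0Mn a n : G0 a -> G0 (a *+ n).
Proof. by move=> h; elim: n => [|n IH]; [exact: G0_0|rewrite mulrS; exact: G0D]. Qed.

End PolyValuation.

(** * Adic expansions and truncations *)


Section Adic.
Variable K : fieldType.
Implicit Types (Q f g a : {poly K}).

Definition dg f : nat := (size f).-1.
Definition small Q a : bool := (size a < size Q)%N.
(** The coefficient of [Q ^+ k] in the [Q]-adic expansion of [f]. *)
Definition qc Q f k : {poly K} := (f %/ Q ^+ k) %% Q.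

Lemma qcD Q f g k : qc Q (f + g) k = qc Q f k + qc Q g k.
Proof. by rewrite /qc divpD modpD. Qed.
Lemma qcN Q f k : qc Q (- f) k = - qc Q f k.
Proof. by rewrite /qc divpN modpN. Qed.
Lemma qc0 Q k : qc Q 0 k = 0.
Proof. by rewrite /qc div0p mod0p. Qed.
Lemma qc_sum Q (I : Type) (r : seq I) (P : pred I) (F : I -> {poly K}) k :
  qc Q (\sum_(i <- r | P i) F i) k = \sum_(i <- r | P i) qc Q (F i) k.
Proof. exact: (big_morph (qc Q ^~ k) (fun x y => qcD Q x y k) (qc0 Q k)). Qed.

Section Fixed.
Variable Q : {poly K}.
Hypotheses (Qm : Q \is monic) (Q1 : (1 < size Q)%N).

Lemma monic_n0 : Q != 0. Proof. exact: monic_neq0. Qed.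
Lemma sizeQ : size Q = (dg Q).+1. Proof. by rewrite /dg prednK // ltnW. Qed.
Lemma dgQ_gt0 : (0 < dg Q)%N. Proof. by rewrite /dg -subn1 subn_gt0. Qed.
Lemma sizeQX k : size (Q ^+ k) = (dg Q * k).+1.
Proof.
by rewrite /dg -size_exp prednK // size_poly_gt0 expf_neq0 // monic_n0.
Qed.
Lemma small0 : small Q 0. Proof. by rewrite /small size_poly0 ltnW. Qed.
Lemma small1 : small Q 1. Proof. by rewrite /small size_poly1. Qed.
Lemma smallD a b : small Q a -> small Q b -> small Q (a + b).
Proof.
by move=> ha hb; apply: (leq_ltn_trans (size_polyD _ _)); rewrite gtn_max; apply/andP.
Qed.
Lemma smallN a : small Q (- a) = small Q a. Proof. by rewrite /small size_polyN. Qed.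
Lemma smallZ (c : K) a : small Q a -> small Q (c *: a).
Proof. exact/leq_ltn_trans/size_scale_leq. Qed.
Lemma small_sum (I : eqType) (r : seq I) (P : pred I) (F : I -> {poly K}) :
  (forall i, i \in r -> P i -> small Q (F i)) -> small Q (\sum_(i <- r | P i) F i).
Proof.
move=> h; rewrite big_seq_cond; elim/big_ind: _ => [|x y|i /andP[]]; first exact: small0.
  exact: smallD.
exact: h.
Qed.
Lemma small_qc f k : small Q (qc Q f k).
Proof. by rewrite /small ltn_modp monic_n0. Qed.
Lemma small_mod f : small Q (f %% Q).
Proof. by rewrite /small ltn_modp monic_n0. Qed.
Lemma small_div a b : small Q a -> small Q b -> small Q ((a * b) %/ Q).
Proof.
have [->|a0] := eqVneq a 0; first by rewrite mul0r div0p.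
have [->|b0] := eqVneq b 0; first by rewrite mulr0 div0p.
rewrite /small size_divp ?monic_n0 // size_mul // sizeQ /=.
have := dgQ_gt0; move: (dg Q) (size a) (size b) => n s t; lia.
Qed.

Lemma qc_expandN f N :
  f = \sum_(k < N) qc Q f k * Q ^+ k + (f %/ Q ^+ N) * Q ^+ N.
Proof.
elim: N => [|N IH]; first by rewrite big_ord0 add0r expr0 mulr1 divp1.
rewrite {1}IH big_ord_recr /= -addrA; congr (_ + _).
rewrite {1}(divp_eq (f %/ Q ^+ N) Q) divp_divl -exprSr mulrDl -mulrA -exprS addrC.
by rewrite /qc.
Qed.
Lemma divQX0 f N : (size f <= dg Q * N)%N -> f %/ Q ^+ N = 0.
Proof. by move=> h; rewrite divp_small // sizeQX. Qed.
Lemma qc_expand f N : (size f <= dg Q * N)%N -> f = \sum_(k < N) qc Q f k * Q ^+ k.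
Proof. by move=> h; rewrite {1}(qc_expandN f N) divQX0 // mul0r addr0. Qed.
Lemma qc_expand_size f : f = \sum_(k < size f) qc Q f k * Q ^+ k.
Proof. by apply: qc_expand; rewrite leq_pmull // dgQ_gt0. Qed.
Lemma qc_big f k : (size f <= dg Q * k)%N -> qc Q f k = 0.
Proof. by move=> h; rewrite /qc divQX0 // mod0p. Qed.
Lemma qcMX f j k : qc Q (f * Q ^+ j) k = if (k < j)%N then 0 else qc Q f (k - j).
Proof.
rewrite /qc; case: ltnP => h.
  rewrite -(subnK (ltnW h)) exprD mulrA mulpK ?expf_neq0 ?monic_n0 //.
  by rewrite -subn_gt0 in h; case: (j - k)%N h => // m _; rewrite exprSr mulrA modp_mull.
rewrite -[in Q ^+ k](subnK h) exprD.
by rewrite divp_pmul2r ?expf_neq0 ?monic_n0.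
Qed.
Lemma qc_small a k : small Q a -> qc Q a k = if k == 0%N then a else 0.
Proof.
move=> sa; case: k => [|k]; first by rewrite /qc expr0 divp1 modp_small.
by rewrite /qc divp_small ?mod0p // sizeQX; move: sa; rewrite /small sizeQ mulnS; move: (dg Q) (size a) => n s; lia.
Qed.
Lemma qc_smallX a j k : small Q a -> qc Q (a * Q ^+ j) k = if k == j then a else 0.
Proof.
move=> sa; rewrite qcMX; case: ltngtP => // h.
  by rewrite qc_small // subn_eq0 leqNgt h.
by rewrite h subnn qc_small.
Qed.
Lemma qc_eval (c : nat -> {poly K}) N k : (forall j, (j < N)%N -> small Q (c j)) ->
  qc Q (\sum_(j < N) c j * Q ^+ j) k = if (k < N)%N then c k else 0.
Proof.
move=> h; rewrite qc_sum.
case: ltnP => hk; last first.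
  by rewrite big1 // => j _; rewrite qc_smallX ?h // gtn_eqF // (leq_trans _ hk).
rewrite (bigD1 (Ordinal hk)) //= qc_smallX ?h // eqxx big1 ?addr0 // => j.
by rewrite -val_eqE /= => ne; rewrite qc_smallX ?h // eq_sym (negPf ne).
Qed.
Lemma size_smallX a k : small Q a -> (size (a * Q ^+ k)%R <= dg Q * k.+1)%N.
Proof.
move=> sa; have [->|a0] := eqVneq a 0; first by rewrite mul0r size_poly0.
rewrite size_mul ?expf_neq0 ?monic_n0 // sizeQX addnS /=.
by move: sa; rewrite /small sizeQ mulnS; move: (dg Q) (size a) => n s; lia.
Qed.
Lemma size_evalX (c : nat -> {poly K}) N : (forall j, (j < N)%N -> small Q (c j)) ->
  (size (\sum_(j < N) c j * Q ^+ j)%R <= dg Q * N)%N.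
Proof.
move=> h; apply: leq_trans (size_sum _ _ _) _; apply/bigmax_leqP => j _.
by apply: leq_trans (size_smallX _ (h _ _)) _ => //; rewrite leq_mul2l ltn_ord orbT.
Qed.
Lemma qc_inj f g : (forall k, qc Q f k = qc Q g k) -> f = g.
Proof.
move=> h; have hN (x : {poly K}) M : (size x <= M)%N -> (size x <= dg Q * M)%N.
  by move=> hx; apply: (leq_trans hx); rewrite leq_pmull // dgQ_gt0.
rewrite (qc_expand (hN f (size f + size g)%N (leq_addr _ _))).
rewrite [in RHS](qc_expand (hN g (size f + size g)%N (leq_addl _ _))).
by apply: eq_bigr => k _; rewrite h.
Qed.
End Fixed.

Lemma size_monicB f g : f \is monic -> g \is monic -> size f = size g ->
  (size (f - g)%R < size f)%N.
Proof.
move=> fm gm e; have f0 : (0 < size f)%N by rewrite size_poly_gt0 monic_neq0.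
rewrite -(prednK f0) ltnS; apply/leq_sizeP => j; rewrite leq_eqVlt => /orP[/eqP <-|hj].
  by rewrite coefB {2}e -!lead_coefE (monicP fm) (monicP gm) subrr.
by rewrite coefB !nth_default ?subrr -?e //; move: hj f0; case: (size f).
Qed.
End Adic.

Section Trunc.
Variables (K : fieldType) (G : ordAbGroupType).
Variable v : valuation {fraction {poly K}} G.
Implicit Types (Q f h a b : {poly K}) (g : G).

(** An intrinsic notion of key polynomial: reducing such a product modulo [Q] discards a multiple of
    [Q] of strictly larger value, so the remainder keeps the value of the product. *)
Definition keyprop Q := forall a b g, small Q a -> small Q b -> vge v g (a * b) ->
  vge v g ((a * b) %% Q) /\ vgt v g ((a * b) %/ Q * Q).

(* The truncation of [v] at [Q] takes at [f] a value at least [g]. *)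
Definition tge Q g f := forall k, vge v g (qc Q f k * Q ^+ k).
(* The truncation of [v] at [Q] agrees with [v] at [f]. *)
Definition exact_at Q f := forall g, vge v g f -> tge Q g f.

Section Fixed.
Variable Q : {poly K}.
Hypotheses (Qm : Q \is monic) (Q1 : (1 < size Q)%N).
Let Q0 : Q != 0 := monic_n0 Qm.

Lemma tge_le g g' f : g <= g' -> tge Q g' f -> tge Q g f.
Proof. by move=> h t k; exact: vge_le h (t k). Qed.
Lemma tge0 g : tge Q g 0.
Proof. by move=> k; rewrite qc0 mul0r vge0. Qed.
Lemma tgeD g f h : tge Q g f -> tge Q g h -> tge Q g (f + h).
Proof. by move=> tf th k; rewrite qcD mulrDl vgeD. Qed.
Lemma tgeN g f : tge Q g f -> tge Q g (- f).
Proof. by move=> tf k; rewrite qcN mulNr vgeN. Qed.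
Lemma tgeB g f h : tge Q g f -> tge Q g h -> tge Q g (f - h).
Proof. by move=> tf th; apply: tgeD => //; exact: tgeN. Qed.
Lemma tge_sum g (I : eqType) (r : seq I) (P : pred I) (F : I -> {poly K}) :
  (forall i, i \in r -> P i -> tge Q g (F i)) -> tge Q g (\sum_(i <- r | P i) F i).
Proof.
move=> h; rewrite big_seq_cond; elim/big_ind: _ => [|x y|i /andP[]]; first exact: tge0.
  exact: tgeD.
exact: h.
Qed.
Lemma tge_vge g f : tge Q g f -> vge v g f.
Proof. by move=> t; rewrite (qc_expand_size Qm Q1 f); apply: vge_sum => k _ _; exact: t. Qed.
Lemma tge_smallX g a k : small Q a -> vge v g (a * Q ^+ k) -> tge Q g (a * Q ^+ k).
Proof.
move=> sa h j; rewrite qc_smallX //; case: eqP => [->//|_]; first by rewrite mul0r vge0.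
Qed.
Lemma tge_small g a : small Q a -> vge v g a -> tge Q g a.
Proof. by move=> sa h; have := @tge_smallX g a 0; rewrite expr0 mulr1; apply. Qed.
Lemma exact_small a : small Q a -> exact_at Q a.
Proof. by move=> sa g; exact: tge_small. Qed.
Lemma tge_X k : tge Q (vl v Q *+ k) (Q ^+ k).
Proof.
rewrite -[Q ^+ k]mul1r; apply: tge_smallX; rewrite ?small1 // mul1r vgeE ?expf_neq0 //.
by rewrite vlX.
Qed.
Lemma tge_mulX g f k : tge Q (g + vl v Q *+ k) (f * Q ^+ k) <-> tge Q g f.
Proof.
have e a : vge v (g + vl v Q *+ k) (a * Q ^+ k) = vge v g a.
  by rewrite -vlX // vge_mulr // expf_neq0.
split=> t j.
  have := t (j + k)%N; rewrite qcMX // ltnNge leq_addl /= addnK exprD mulrA.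
  by rewrite e.
rewrite qcMX //; case: ltnP => h; first by rewrite mul0r vge0.
by rewrite -[in Q ^+ j](subnK h) exprD mulrA e.
Qed.
Lemma exact_pval f : exact_at Q f -> f != 0 -> exists2 k, qc Q f k != 0 &
   vl v f = vl v (qc Q f k * Q ^+ k).
Proof.
move=> ef f0; have t := ef _ (vge_vl v f).
have [h|h] := boolP [forall k : 'I_(size f), vgt v (vl v f) (qc Q f k * Q ^+ k)].
  have : vgt v (vl v f) f.
    by rewrite {2}(qc_expand_size Qm Q1 f); apply: vgt_sum => k _ _; exact: (forallP h).
  by rewrite vgtE // ltxx.
case/forallPn: h => k hk; have := pval_eq_ge (t k) hk => /pvalP[h1 h2].
by exists k => //; apply: contraNneq h1 => ->; rewrite mul0r.
Qed.

Hypothesis keyQ : keyprop Q.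

(** A product of two coefficients is a remainder plus a quotient times [Q], and [keyprop] bounds
    both parts. *)
Lemma tgeM g g' f h : tge Q g f -> tge Q g' h -> tge Q (g + g') (f * h).
Proof.
move=> tf th; rewrite (qc_expand_size Qm Q1 f) (qc_expand_size Qm Q1 h).
rewrite mulr_suml; apply: tge_sum => i _ _; rewrite mulr_sumr; apply: tge_sum => j _ _.
set a := qc Q f i; set b := qc Q h j.
have sa : small Q a by exact: small_qc. have sb : small Q b by exact: small_qc.
have hv : vge v (g + g') (a * b * Q ^+ (i + j)).
  by rewrite exprD mulrACA; apply: vgeM; [exact: tf|exact: th].
rewrite mulrACA -exprD.
pose e := g + g' - vl v Q *+ (i + j).
have ee : g + g' = e + vl v Q *+ (i + j) by rewrite subrK.
have hab : vge v e (a * b) by move: hv; rewrite ee -vlX // vge_mulr // expf_neq0.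
case: (keyQ sa sb hab) => h1 h2; rewrite ee; apply/tge_mulX.
rewrite (divp_eq (a * b) Q); apply: tgeD; last by apply: tge_small => //; exact: small_mod.
have := @tge_smallX e (a * b %/ Q) 1; rewrite expr1; apply; first exact: small_div.
exact: vgtW.
Qed.

Lemma tgeX g f n : tge Q g f -> tge Q (g *+ n) (f ^+ n).
Proof.
move=> t; elim: n => [|n IH]; last by rewrite exprS mulrS; exact: tgeM.
by have := tge_X 0; rewrite mulr0n !expr0 mulr0n.
Qed.

(** The power [Q ^+ al] is a dominant term of [F], so trading [Q ^+ al] for [F] does not lower the
    truncation. The division is carried out by induction on the degree: with [u] the quotient of [h]
    by [Q ^+ al], subtracting [u * F] lowers the degree of [h]. *)
Lemma tge_div F al g h : F \is monic -> dg F = (dg Q * al)%N ->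
  tge Q (vl v Q *+ al) F -> tge Q g h ->
  tge Q g (h %% F) /\ tge Q g (h %/ F * Q ^+ al).
Proof.
move=> Fm sF tF; have [n] := ubnP (size h); elim: n h => // n IH h hn th.
have sF1 : size F = (dg Q * al).+1 by rewrite -sF /dg prednK // size_poly_gt0 monic_neq0.
have [hs|hs] := ltnP (size h) (size F).
  by rewrite modp_small // divp_small // mul0r; split=> //; exact: tge0.
pose u := h %/ Q ^+ al; pose F0 := F - Q ^+ al.
have tu : tge Q g (u * Q ^+ al).
  move=> k; rewrite qcMX //; case: ltnP => hk; first by rewrite mul0r vge0.
  by rewrite /qc /u divp_divl -exprD subnKC //; exact: th.
pose h' := h %% Q ^+ al - u * F0.
have eh : h = u * F + h' by rewrite /h' /F0 mulrBr {1}(divp_eq h (Q ^+ al)) -/u; ring.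
have u0 : u != 0.
  by rewrite -size_poly_gt0 size_divp ?expf_neq0 // sizeQX //= subn_gt0 -sF1.
have sh : size h = (size u + dg Q * al)%N.
  have := size_divp h (expf_neq0 al Q0); rewrite -/u sizeQX //= => ->.
  by rewrite subnK // (leq_trans _ hs) // sF1.
have sF0 : (size F0 <= dg Q * al)%N.
  by rewrite -ltnS -sF1 size_monicB ?monic_exp // sF1 sizeQX.
have h's : (size h' < size h)%N.
  apply: (leq_ltn_trans (size_polyD _ _)); rewrite gtn_max size_polyN; apply/andP; split.
    have : (size (h %% Q ^+ al)%R < size (Q ^+ al)%R)%N by rewrite ltn_modp expf_neq0.
    by rewrite sizeQX // => /leq_trans; apply; rewrite -sF1.
  have [->|F00] := eqVneq F0 0; first by rewrite mulr0 size_poly0 (leq_trans _ hs) // sF1.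
  rewrite size_mul // sh; have : (0 < size u)%N by rewrite size_poly_gt0.
  move: sF0; move: (size u) (size F0) (dg Q * al)%N; lia.
have tF0 : tge Q (vl v Q *+ al) F0 by apply: tgeB => //; exact: tge_X.
have th' : tge Q g h'.
  apply: tgeB.
    have -> : h %% Q ^+ al = h - u * Q ^+ al by rewrite {2}(divp_eq h (Q ^+ al)) addrC addKr.
    exact: tgeB.
  have -> : g = g - vl v Q *+ al + vl v Q *+ al by rewrite subrK.
  by apply: tgeM => //; apply/(tge_mulX _ _ al); rewrite subrK.
have [t1 t2] := IH h' (leq_trans h's (ltnSE hn)) th'.
rewrite eh modpD modp_mull add0r divp_addl_mul ?monic_neq0 //; split=> //.
by rewrite mulrDl; exact: tgeD.
Qed.
End Fixed.
End Trunc.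

(** * Key polynomials and their successors *)


Notation tms K := (seq (K * {poly K})).

Section Terms.
Variables (K : fieldType) (G : ordAbGroupType).
Variable v : valuation {fraction {poly K}} G.
Implicit Types (Q f h a b M N : {poly K}) (g : G) (S : set {poly K}).

Definition trm (p : K * {poly K}) : {poly K} := p.1 *: p.2.
Definition ev (l : tms K) : {poly K} := \sum_(p <- l) trm p.
Definition expansion S (l : tms K) : Prop :=
  uniq [seq p.2 | p <- l] /\ forall p, p \in l -> p.1 != 0 /\ S p.2.
Definition adapted f (l : tms K) : Prop :=
  f = ev l /\ forall p, p \in l -> vge v (vl v f) (trm p).
(* The initial forms of the terms of [l] are linearly independent. *)
Definition strongl (l : tms K) : Prop :=
  forall (P : pred (K * {poly K})) g, vge v g (\sum_(p <- l | P p) trm p) ->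
    forall p, p \in l -> P p -> vge v g (trm p).

Definition mulX_terms Q al (L : nat -> tms K) : tms K :=
  [seq (p.1, p.2 * Q ^+ k) | k <- iota 0 al, p <- L k].

(* [S] consists of the monomials in the previous key polynomials that may occur in
   expansions of degree smaller than that of [Q]. The uniform bounds on the
   denominators and on the number of terms and of classes of values make the
   constructions with pending terms finite. *)
Record key_pair Q S : Prop := KeyPair {
  kp_monic : Q \is monic;
  kp_size : (1 < size Q)%N;
  kp_key : keyprop v Q;
  kp_mon : forall M, S M -> M != 0 /\ small Q M;
  kp_exp : exists2 e : nat, (0 < e)%N &
    forall f, f != 0 -> small Q f -> G0 v (vl v f *+ e);
  kp_se : exists N : nat, forall f, f != 0 -> small Q f ->
    exists l, [/\ expansion S l, adapted f l & (size l <= N)%N];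
  kp_reps : exists2 R : seq {poly K}, (forall M, M \in R -> S M) &
    forall f, f != 0 -> small Q f ->
      exists2 M, M \in R & exists2 c : K, c != 0 & vl v f = vl v (c *: M) }.

Definition strong_pair Q S : Prop := forall f, f != 0 -> small Q f ->
  exists l, [/\ expansion S l, f = ev l & strongl l].

Definition next_mon S Q al : set {poly K} :=
  [set N | exists M k, [/\ S M, (k < al)%N & N = M * Q ^+ k]].

Definition key_step Q S al Q' : Prop :=
  [/\ (0 < al)%N,
   exists L : nat -> tms K,
   [/\ forall j, (j < al)%N -> expansion S (L j),
       forall j p, (j < al)%N -> p \in L j ->
         pval v (trm p * Q ^+ j) = pval v (Q ^+ al),
       forall j, (j < al)%N -> L j != [::] ->
         pval v (ev (L j) * Q ^+ j) = pval v (Q ^+ al) &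
       Q' = Q ^+ al + \sum_(j < al) ev (L j) * Q ^+ j],
   vgt v (vl v Q *+ al) Q' &
   forall f, (size f <= dg Q * al)%N -> exact_at v Q f].

Lemma ev_nil : ev [::] = 0. Proof. by rewrite /ev big_nil. Qed.
Lemma ev_small Q S l : (1 < size Q)%N -> (forall M, S M -> M != 0 /\ small Q M) ->
  expansion S l -> small Q (ev l).
Proof.
move=> Q1 hS [_ hl]; apply: small_sum => // p pl _.
by case: (hl p pl) => _ /hS[_]; exact: smallZ.
Qed.
Lemma trm_neq0 Q S l p : (forall M, S M -> M != 0 /\ small Q M) ->
  expansion S l -> p \in l -> trm p != 0.
Proof. by move=> hS [_ hl] /hl[p0 /hS[M0 _]]; rewrite scaler_eq0 negb_or p0. Qed.
Lemma trm_small Q S l p : (forall M, S M -> M != 0 /\ small Q M) ->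
  expansion S l -> p \in l -> small Q (trm p).
Proof. by move=> hS [_ hl] /hl[_ /hS[_]]; exact: smallZ. Qed.

Lemma strongl_adapted f l : f = ev l -> strongl l -> adapted f l.
Proof.
by move=> fl sl; split=> // p pl; apply: (sl predT) => //; rewrite -/(ev l) -fl vge_vl.
Qed.

Section Fixed.
Variables (Q : {poly K}) (S : set {poly K}).
Hypotheses (Qm : Q \is monic) (Q1 : (1 < size Q)%N).
Hypothesis hS : forall M, S M -> M != 0 /\ small Q M.
Let Q0 : Q != 0 := monic_n0 Qm.

Lemma trmX p k : trm (p.1, p.2 * Q ^+ k) = trm p * Q ^+ k.
Proof. by rewrite /trm /= scalerAl. Qed.

Lemma sum_mulX al L (P : pred (K * {poly K})) :
  \sum_(p <- mulX_terms Q al L | P p) trm p =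
  \sum_(k < al) (\sum_(p <- L k | P (p.1, p.2 * Q ^+ k)) trm p) * Q ^+ k.
Proof.
rewrite big_mkcond big_allpairs_dep /=; have -> : iota 0 al = index_iota 0 al by rewrite /index_iota subn0.
rewrite -(big_mkord predT (fun k => (\sum_(p <- L k | P (p.1, p.2 * Q ^+ k)) trm p) * Q ^+ k)).
apply: eq_bigr => k _; rewrite mulr_suml [RHS]big_mkcond /=.
by apply: eq_bigr => p _; case: ifP => // _; rewrite trmX.
Qed.

Lemma ev_mulX al L : ev (mulX_terms Q al L) = \sum_(k < al) ev (L k) * Q ^+ k.
Proof. exact: (sum_mulX al L predT). Qed.

Lemma mem_mulX al L p : p \in mulX_terms Q al L ->
  exists k q, [/\ (k < al)%N, q \in L k & p = (q.1, q.2 * Q ^+ k)].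
Proof.
by case/allpairsPdep => k [q [hk hq ->]]; exists k, q; split=> //; rewrite mem_iota in hk.
Qed.

Lemma mulX_inj M M' k k' : M != 0 -> small Q M -> small Q M' ->
  M * Q ^+ k = M' * Q ^+ k' -> k = k' /\ M = M'.
Proof.
move=> M0 sM sM' e; have := congr1 (fun f => qc Q f k) e.
rewrite /= !qc_smallX // eqxx; case: (k =P k') => [kk MM|_ MM]; first by split.
by rewrite MM eqxx in M0.
Qed.

Lemma expansion_mulX al L : (forall j, (j < al)%N -> expansion S (L j)) ->
  expansion (next_mon S Q al) (mulX_terms Q al L).
Proof.
move=> hL; split; last first.
  move=> p /mem_mulX[k [q [hk hq ->]]] /=; have [_ /(_ q hq)[q0 Sq]] := hL k hk.
  by split=> //; exists q.2, k; split.
have -> : [seq p.2 | p <- mulX_terms Q al L] =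
    [seq M * Q ^+ k | k <- iota 0 al, M <- [seq p.2 | p <- L k]].
  rewrite /mulX_terms map_flatten -map_comp; congr flatten; apply: eq_map => k /=.
  by rewrite -!map_comp.
apply: allpairs_uniq_dep; first exact: iota_uniq.
  by move=> k; rewrite mem_iota => /hL[].
move=> x y /allpairsPdep[k [M [hk hM ->]]] /allpairsPdep[k' [M' [hk' hM' ->]]] /= e.
move: hk hk'; rewrite !mem_iota /= => hk hk'.
have hmon j N : (j < al)%N -> N \in [seq p.2 | p <- L j] -> N != 0 /\ small Q N.
  by move=> hj /mapP[p pl ->]; apply: hS; case: (hL j hj) => _ /(_ p pl)[].
have [M0 sM] := hmon k M hk hM; have [_ sM'] := hmon k' M' hk' hM'.
by have [-> ->] := mulX_inj M0 sM sM' e.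
Qed.

Lemma size_mulX_terms al L (B : nat) : (forall j, (size (L j) <= B)%N) ->
  (size (mulX_terms Q al L) <= al * B)%N.
Proof.
move=> h; rewrite size_allpairs_dep -[al in (al * B)%N](size_iota 0).
by elim: (iota 0 al) => //= k s IH; rewrite mulSn leq_add.
Qed.
End Fixed.
End Terms.

Section Step.
Variables (K : fieldType) (G : ordAbGroupType).
Variable v : valuation {fraction {poly K}} G.
Implicit Types (Q f h a b M N : {poly K}) (g : G) (S : set {poly K}).

Lemma pval_X Q n : Q != 0 -> pval v (Q ^+ n) = Some (vl v Q *+ n).
Proof. by move=> Q0; apply/pvalP; rewrite expf_neq0 // vlX. Qed.


Lemma monic_addX Q (W : {poly K}) al : Q \is monic -> (1 < size Q)%N -> (size W <= dg Q * al)%N ->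
  Q ^+ al + W \is monic /\ dg (Q ^+ al + W) = (dg Q * al)%N.
Proof.
move=> Qm Q1 sW; have lt : (size W < size (Q ^+ al)%R)%N by rewrite sizeQX.
split; first by rewrite monicE lead_coefDl // -monicE monic_exp.
by rewrite /dg size_polyDl // sizeQX.
Qed.

Section Fixed.
Variables (Q : {poly K}) (S : set {poly K}).
Hypothesis kQ : key_pair v Q S.
Let Qm := kp_monic kQ. Let Q1 := kp_size kQ. Let hS := kp_mon kQ. Let hk := kp_key kQ.
Let Q0 : Q != 0 := monic_n0 Qm.

Lemma key_step_shape al Q' : key_step v Q S al Q' ->
  [/\ Q' \is monic, dg Q' = (dg Q * al)%N & tge v Q (vl v Q *+ al) Q'].
Proof.
case=> al0 [L [hL hv hev ->]] _ _.
have sL j : (j < al)%N -> small Q (ev (L j)) by move=> /hL; exact: ev_small.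
have [m d] := monic_addX Qm Q1 (size_evalX Qm Q1 sL); split=> //.
apply: tgeD; first exact: tge_X.
apply: tge_sum => j _ _; apply: tge_smallX => //; first exact: sL.
have [->|ne] := eqVneq (L j) [::]; first by rewrite ev_nil mul0r vge0.
by apply: vge_eq; rewrite hev // pval_X.
Qed.

(** Without lower terms, [Q'] would be [Q ^+ al], which does not exceed its own value. A term at
    [Q ^+ j] has the value of [Q ^+ al], so [al - j] times the value of [Q] is the value of a small
    polynomial; this bounds the new denominators. *)
Lemma key_step_root al Q' : key_step v Q S al Q' ->
  exists f k, [/\ f != 0, small Q f, (0 < k)%N & vl v f = vl v Q *+ k].
Proof.
case=> al0 [L [hL hv hev eQ]] hlt _.
case: (pselect (exists j p, (j < al)%N /\ p \in L j)) => [[j [p [ja pL]]]|no].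
  have p0 := trm_neq0 hS (hL j ja) pL.
  exists (trm p), (al - j)%N; split=> //; first exact: trm_small (hL j ja) pL.
    by rewrite subn_gt0.
  have := hv j p ja pL; rewrite pval_X // => /pvalP[_].
  rewrite vlM ?expf_neq0 // vlX // => e; apply: (addIr (vl v Q *+ j)).
  by rewrite e -mulrnDr subnK // ltnW.
have eQ' : Q' = Q ^+ al.
  rewrite eQ big1 ?addr0 // => j _; suff -> : L j = [::] by rewrite ev_nil mul0r.
  by case E: (L j) => [|p l] //; case: no; exists j, p; rewrite E mem_head.
by move: hlt; rewrite eQ' (vgtNeq (pval_X al Q0)).
Qed.

Lemma key_step_hull al Q' : key_step v Q S al Q' ->
  exists2 n : nat, (0 < n)%N & G0 v (vl v Q *+ n).
Proof.
move=> /key_step_root[f [k [f0 sf k0 e]]]; case: (kp_exp kQ) => n n0 /(_ f f0 sf).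
by rewrite e -mulrnA => h; exists (k * n)%N; rewrite // muln_gt0 k0.
Qed.

(** Polynomials small for [Q'] are exact at [Q], so their product can be divided by [Q'] with
    [tge_div]. The estimate of the quotient uses [Q ^+ al], whose value is less than that of [Q']:
    this is the strict inequality. *)
Lemma key_step_prop al Q' : key_step v Q S al Q' -> keyprop v Q'.
Proof.
move=> st; have [Q'm dQ' tQ'] := key_step_shape st; case: st => al0 _ hlt hex.
have Q'0 : Q' != 0 by exact: monic_neq0.
have hsm x : small Q' x -> exact_at v Q x.
  move=> sx; apply: hex; rewrite -ltnS; apply: leq_trans sx _.
  by rewrite -dQ' /dg prednK // size_poly_gt0.
move=> a b g sa sb hab.
have [a0|a0] := eqVneq a 0; first by rewrite a0 mul0r mod0p div0p mul0r vge0 vgt0.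
have [b0|b0] := eqVneq b 0; first by rewrite b0 mulr0 mod0p div0p mul0r vge0 vgt0.
have ta := hsm a sa _ (vge_vl v a); have tb := hsm b sb _ (vge_vl v b).
have tab := tgeM Qm Q1 hk ta tb.
have hg : g <= vl v a + vl v b by move: hab; rewrite vgeE ?mulf_neq0 // vlM.
have [t1 t2] := tge_div Qm Q1 hk Q'm dQ' tQ' (tge_le hg tab).
split; first exact: tge_vge t1.
have := tge_vge Qm Q1 t2; rewrite -[g](subrK (vl v Q *+ al)) -vlX // vge_mulr ?expf_neq0 //.
by move=> h3; apply: vgtM => //; rewrite vlX.
Qed.

Lemma key_step_expand al f : (size f <= dg Q * al)%N -> exact_at v Q f -> f != 0 ->
  forall P : {poly K} -> tms K -> Prop,
  (forall h, h != 0 -> small Q h -> exists l, [/\ expansion S l, h = ev l & P h l]) ->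
  exists L : nat -> tms K,
   [/\ forall j, expansion S (L j), f = ev (mulX_terms Q al L),
       forall j, ev (L j) = qc Q f j &
       forall j, L j <> [::] -> ev (L j) != 0 /\ P (ev (L j)) (L j)].
Proof.
move=> sf ef f0 P hP.
have : forall j, exists l, [/\ expansion S l, ev l = qc Q f j & l <> [::] -> ev l != 0 /\ P (ev l) l].
  move=> j; have [->|q0] := eqVneq (qc Q f j) 0.
    by exists [::]; rewrite ev_nil.
  have [l [h1 h2 h3]] := hP _ q0 (small_qc Qm f j).
  by exists l; rewrite -h2.
case/choice => L hL; exists L; split=> [j||j|j]; try by case: (hL j).
rewrite ev_mulX {1}(qc_expand Qm sf); apply: eq_bigr => j _.
by case: (hL j) => _ ->.
Qed.

(** The [Q]-adic coefficients of a partial sum are partial sums of the old expansions, and exactness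
    at [Q] bounds them one by one. *)
Lemma key_step_strong al Q' : strong_pair v Q S -> key_step v Q S al Q' ->
  strong_pair v Q' (next_mon S Q al).
Proof.
move=> sp st; have [Q'm dQ' tQ'] := key_step_shape st; case: st => al0 _ hlt hex f f0 sf.
have sf' : (size f <= dg Q * al)%N.
  by rewrite -ltnS -dQ' /dg prednK // size_poly_gt0 monic_neq0.
have [L [hL fL eL sL]] := key_step_expand sf' (hex f sf') f0 (P := fun _ l => strongl v l) sp.
exists (mulX_terms Q al L); split=> //; first exact: expansion_mulX.
move=> P g; rewrite sum_mulX => hg p /mem_mulX[k [q [ka qL ->]]] Pp; rewrite trmX.
pose c j := \sum_(p <- L j | P (p.1, p.2 * Q ^+ j)) trm p.
have sc j : small Q (c j).
  by apply: small_sum => // x xL _; exact: trm_small (hL j) xL.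
have /hex/(_ _ hg k) : (size (\sum_(j < al) c j * Q ^+ j)%R <= dg Q * al)%N.
  exact: size_evalX.
rewrite (qc_eval Qm Q1) // ka -[g](subrK (vl v Q *+ k)) -vlX // !vge_mulr ?expf_neq0 // => hc.
have ne : L k <> [::] by move=> e; rewrite e in qL.
have [_ sLk] := sL k ne; exact: (sLk (fun p => P (p.1, p.2 * Q ^+ k)) _ hc).
Qed.

(** The value of a polynomial small for [Q'] is attained by one term of its [Q]-adic expansion.
    Hence denominators are multiplied by the [kr] of [key_step_root], numbers of terms by [al], and
    the representatives are the old ones times powers of [Q]. *)
Theorem key_step_key al Q' : key_step v Q S al Q' -> key_pair v Q' (next_mon S Q al).
Proof.
move=> st; have [Q'm dQ' tQ'] := key_step_shape st; have hkey := key_step_prop st.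
have [fr [kr [fr0 sfr kr0 er]]] := key_step_root st.
case: st => al0 _ hlt hex.
have sz f : small Q' f -> (size f <= dg Q * al)%N.
  by move=> sf; rewrite -ltnS -dQ' /dg prednK // size_poly_gt0 monic_neq0.
have dg0 := dgQ_gt0 Q1.
split=> //.
- by move: dg0 dQ'; rewrite /dg => h1 h2; rewrite -(ltn_predK (n := size Q') (m := 0)) ?size_poly_gt0 ?monic_neq0 // ltnS h2 muln_gt0 h1.
- move=> N [M [k [SM ka ->]]]; have [M0 sM] := hS SM; rewrite mulf_neq0 ?expf_neq0 //.
  split=> //; rewrite /small -[size Q']prednK ?size_poly_gt0 ?monic_neq0 // ltnS -/(dg Q') dQ'.
  by apply: leq_trans (size_smallX Qm Q1 k sM) _; rewrite leq_mul2l ka orbT.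
- case: (kp_exp kQ) => e e0 he; exists (kr * e)%N; first by rewrite muln_gt0 kr0.
  move=> f f0 /sz sf; have [k q0 ->] := exact_pval Qm Q1 (hex f sf) f0.
  rewrite vlM ?expf_neq0 // mulrnDl vlX //; apply: G0D.
    by rewrite mulnC mulrnA; apply: G0Mn; apply: he => //; exact: small_qc.
  have -> : vl v Q *+ k *+ (kr * e) = vl v fr *+ e *+ k by rewrite er -!mulrnA; congr (_ *+ _); lia.
  by apply: G0Mn; exact: he.
- case: (kp_se kQ) => N hN; exists (al * N)%N => f f0 /sz sf.
  have := key_step_expand sf (hex f sf) f0 (P := fun h l => adapted v h l /\ (size l <= N)%N).
  case=> [h h0 sh|L [hL fL eL sL]].
    by have [l [h1 h2 h3]] := hN h h0 sh; exists l; split=> //; case: h2.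
  exists (mulX_terms Q al L); split; first exact: expansion_mulX.
    split=> // p /mem_mulX[k [q [ka qL ->]]]; rewrite trmX.
    have ne : L k <> [::] by move=> e; rewrite e in qL.
    have [ev0 [[_ /(_ q qL) h1] _]] := sL k ne.
    have := hex f sf _ (vge_vl v f) k; rewrite -eL.
    rewrite -[vl v f](subrK (vl v Q *+ k)) -vlX // !vge_mulr ?expf_neq0 // vgeE // => h2.
    exact: vge_le h2 h1.
  apply: size_mulX_terms => k; have [->//|/eqP ne] := eqVneq (L k) [::].
  by have [_ []] := sL k ne.
- case: (kp_reps kQ) => R hR hrep; exists [seq M * Q ^+ k | k <- iota 0 al, M <- R].
    move=> N /allpairsP[[k M] /= [hk' hM ->]]; exists M, k; split=> //; first exact: hR.
    by rewrite mem_iota in hk'.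
  move=> f f0 /sz sf; have [k q0 ->] := exact_pval Qm Q1 (hex f sf) f0.
  have [M MR [c c0 e]] := hrep _ q0 (small_qc Qm f k).
  have M0 : M != 0 by case: (hS (hR M MR)).
  have ka : (k < al)%N.
    by rewrite ltnNge; apply: contra q0 => ak; rewrite qc_big // (leq_trans sf) // leq_mul2l ak orbT.
  exists (M * Q ^+ k); first by apply/allpairsP; exists (k, M); rewrite mem_iota.
  exists c => //; rewrite scalerAl !vlM ?expf_neq0 ?scaler_eq0 ?negb_or ?c0 // e //.
Qed.
End Fixed.
End Step.

Lemma seq_min (G : ordAbGroupType) (T : eqType) (s : seq T) (w : T -> G) x0 :
  x0 \in s -> exists2 x, x \in s & forall y, y \in s -> w x <= w y.
Proof.
elim: s x0 => // a [|b s] IH x0 _.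
  by exists a; rewrite ?mem_head // => y; rewrite inE => /eqP ->.
have [x xs hx] := IH b (mem_head b s).
have /orP[h|h] := gtotal (w a) (w x).
  exists a; rewrite ?mem_head // => y; rewrite in_cons => /orP[/eqP ->//|/hx].
  exact: le_trans.
exists x; first by rewrite in_cons xs orbT.
by move=> y; rewrite in_cons => /orP[/eqP ->//|/hx].
Qed.

(** * Existence of a successor *)

Section StepExists.
Variables (K : fieldType) (G : ordAbGroupType).
Variable v : valuation {fraction {poly K}} G.
Implicit Types (Q f h a b M N : {poly K}) (g : G) (S : set {poly K}).

Lemma expansion_filter S (P : pred (K * {poly K})) (l : tms K) :
  expansion S l -> expansion S (filter P l).
Proof.
case=> u h; split; first by apply: subseq_uniq u; apply: map_subseq; exact: filter_subseq.
by move=> p; rewrite mem_filter => /andP[_]; exact: h.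
Qed.
Lemma ev_filter (P : pred (K * {poly K})) (l : tms K) :
  ev (filter P l) = \sum_(p <- l | P p) trm p.
Proof. by rewrite /ev big_filter. Qed.
Lemma ev_split (P : pred (K * {poly K})) (l : tms K) :
  ev l = ev (filter P l) + ev (filter (predC P) l).
Proof. by rewrite /ev !big_filter (bigID P). Qed.

Section Fixed.
Variables (Q : {poly K}) (S : set {poly K}).
Hypotheses (Qm : Q \is monic) (Q1 : (1 < size Q)%N) (hk : keyprop v Q).
Let Q0 : Q != 0 := monic_n0 Qm.

Lemma key_mod a b : a != 0 -> b != 0 -> small Q a -> small Q b ->
  [/\ (a * b) %% Q != 0, vl v ((a * b) %% Q) = vl v a + vl v b &
      vgt v (vl v a + vl v b) ((a * b) %/ Q * Q)].
Proof.
move=> a0 b0 sa sb; have [h1 h2] := hk sa sb (vge_vl v (a * b)).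
rewrite vlM // in h2 *.
have /pvalP[] : pval v ((a * b) %% Q) = Some (vl v a + vl v b) => //.
have -> : (a * b) %% Q = a * b - (a * b) %/ Q * Q by rewrite {2}(divp_eq (a * b) Q) addrC addKr.
by apply: pvalD_lt; rewrite ?vgtN // pval_vl ?mulf_neq0 // vlM.
Qed.

(** A common factor [d] of [a] and [Q] of positive degree would make [a * (Q %/ d)] a multiple of
    [Q], although [key_mod] says that its remainder is nonzero. Bezout then gives the inverse. *)
Lemma key_inv a : a != 0 -> small Q a ->
  exists b, [/\ b != 0, small Q b, (b * a) %% Q = 1 & vl v b + vl v a = 0].
Proof.
move=> a0 sa.
have cop : coprimep a Q.
  rewrite coprimep_def; apply: contraT => hd.
  set d := gcdp a Q in hd.
  have d0 : d != 0 by rewrite gcdp_eq0 negb_and a0.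
  have ea : a = a %/ d * d by rewrite divpK ?dvdp_gcdl.
  have eQ : Q = Q %/ d * d by rewrite divpK ?dvdp_gcdr.
  have e0 : Q %/ d != 0 by apply: contraNneq Q0 => h; rewrite eQ h mul0r.
  have se : small Q (Q %/ d).
    rewrite /small size_divp //; move: hd d0; rewrite -size_poly_gt0.
    by move: Q1; move: (size Q) (size d) => s t; lia.
  have [] := key_mod a0 e0 sa se; rewrite {1}ea -mulrA [d * _]mulrC -eQ modp_mull eqxx //.
have /Bezout_eq1_coprimepP[[u w] /= e] := cop.
have eb : ((u %% Q) * a) %% Q = 1.
  by rewrite mulrC modp_mul mulrC -[u * a](addrK (w * Q)) e modpD modpN modp_mull subr0 modp_small // size_poly1.
have b0 : u %% Q != 0.
  by apply/eqP => h; move: eb; rewrite h mul0r mod0p => /eqP; rewrite eq_sym oner_eq0.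
exists (u %% Q); split=> //; first exact: small_mod.
have [_ <- _] := key_mod b0 a0 (small_mod Qm u) sa; by rewrite eb vl1.
Qed.
End Fixed.

(* The minimal polynomial on which the truncation is not exact, normalized by the
   inverse of its leading coefficient modulo [Q]. *)
Lemma key_min_relation Q : Q \is monic -> (1 < size Q)%N -> keyprop v Q ->
  ~ (forall f, exact_at v Q f) ->
  exists (s : nat) (c : nat -> {poly K}),
  [/\ (0 < s)%N, forall j, small Q (c j),
      forall j, c j != 0 -> pval v (c j * Q ^+ j) = Some (vl v Q *+ s),
      vgt v (vl v Q *+ s) (Q ^+ s + \sum_(j < s) c j * Q ^+ j) &
      forall f, (size f <= dg Q * s)%N -> exact_at v Q f].
Proof.
move=> Qm Q1 hk nex; have Q0 := monic_n0 Qm.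
have exn : exists n, `[< exists2 F : {poly K}, size F = n & ~ exact_at v Q F >].
  have [F nF] : exists F, ~ exact_at v Q F by apply/existsNP.
  by exists (size F); apply/asboolP; exists F.
case: (ex_minnP exn) => n /asboolP[F sF nF] hmin.
have hF f : (size f < size F)%N -> exact_at v Q f.
  move=> sf; apply: contrapT => nf; have := hmin (size f).
  by rewrite leqNgt -sF sf => /(_ _)/negP; apply=> //; apply/asboolP; exists f.
have F0 : F != 0 by apply: contra_notN nF => /eqP -> g _; exact: tge0.
pose t := [seq k <- iota 0 (size F) | qc Q F k != 0].
have tP k : qc Q F k != 0 -> k \in t.
  move=> q0; rewrite mem_filter q0 mem_iota /= ltnNge; apply: contra q0 => hk'.
  by rewrite qc_big // (leq_trans hk') // leq_pmull // dgQ_gt0.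
pose wt k := vl v (qc Q F k * Q ^+ k).
have [g /not_implyP[hg /existsNP[k1 /negP hk1]]] : exists g, ~ (vge v g F -> tge v Q g F).
  by apply/existsNP.
have q1 : qc Q F k1 != 0 by apply: contraNneq hk1 => ->; rewrite mul0r vge0.
have [k2 k2t hk2] := seq_min wt (tP k1 q1).
pose w := wt k2.
have wF : w < vl v F.
  apply: le_lt_trans (hk2 _ (tP _ q1)) _; move: hk1 hg; rewrite !vgeE ?mulf_neq0 ?expf_neq0 //.
  by rewrite -gltNge => h1 h2; apply: lt_le_trans h2.
(* The dominant indices. The relation keeps only these, and [s] is the largest of them, so that its
   coefficient becomes the leading one. *)
pose B j := (qc Q F j != 0) && (wt j == w).
have exB : exists j, B j by exists k2; rewrite /B eqxx andbT; move: k2t; rewrite mem_filter => /andP[].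
have bB j : B j -> (j <= size F)%N.
  by case/andP => /tP; rewrite mem_filter mem_iota => /andP[_ /ltnW].
case: (ex_maxnP exB bB) => s /andP[qs /eqP ws] maxs.
have [b [b0 sb eb vb]] := key_inv Qm Q1 hk qs (small_qc Qm F s).
pose c j := if B j then (b * qc Q F j) %% Q else 0.
have cs : c s = 1 by rewrite /c /B qs ws eqxx.
have sc j : small Q (c j) by rewrite /c; case: ifP => _; rewrite ?small0 ?small_mod.
have ew : vl v b + w = vl v Q *+ s.
  by rewrite -ws /wt vlM ?expf_neq0 // addrA vb add0r vlX.
have hc j : c j != 0 -> pval v (c j * Q ^+ j) = Some (vl v Q *+ s).
  rewrite /c; case: ifP => [/andP[qj /eqP wj] c0|]; last by rewrite eqxx.
  apply/pvalP; rewrite mulf_neq0 ?expf_neq0 //; split=> //.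
  rewrite vlM ?expf_neq0 //; have [_ -> _] := key_mod hk b0 qj sb (small_qc Qm F j).
  by rewrite -addrA -vlM ?expf_neq0 // -ew -wj.
have sN : (s < size F)%N by move: (tP _ qs); rewrite mem_filter mem_iota => /andP[_].
(* The sum differs from [b * F] by multiples of [Q] made large by [keyprop] and by terms that are
   not dominant, while [b * F] is large because [F] is inexact. *)
have hG : vgt v (vl v Q *+ s) (\sum_(j < size F) c j * Q ^+ j).
  rewrite -ew -[X in vgt _ _ X](subKr (b * F)); apply: vgtB.
    by rewrite vgt_mull // vgtE.
  rewrite {1}(qc_expand_size Qm Q1 F) mulr_sumr -sumrB; apply: vgt_sum => j _ _.
  rewrite mulrA -mulrBl /c; case: ifP => [/andP[qj /eqP wj]|nB].
    have [_ _ h] := key_mod hk b0 qj sb (small_qc Qm F j).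
    have -> : b * qc Q F j - (b * qc Q F j) %% Q = (b * qc Q F j) %/ Q * Q.
      by rewrite {1}(divp_eq (b * qc Q F j) Q) addrK.
    by rewrite -wj /wt vlM ?expf_neq0 // addrA vgt_mulr // expf_neq0.
  rewrite subr0 -mulrA vgt_mull //; have [->|qj] := eqVneq (qc Q F j) 0.
    by rewrite mul0r vgt0.
  rewrite vgtE ?mulf_neq0 ?expf_neq0 // lt_neqAle (hk2 _ (tP _ qj)) andbT.
  by move: nB; rewrite /B qj /= eq_sym => ->.
have eG : \sum_(j < size F) c j * Q ^+ j = Q ^+ s + \sum_(j < s) c j * Q ^+ j.
  rewrite -!(big_mkord predT (fun j => c j * Q ^+ j)) (big_cat_nat (n := s.+1)) //=.
  rewrite [X in _ + X]big_nat_cond [X in _ + X]big1 ?addr0; last first.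
    move=> j /andP[/andP[sj _] _]; rewrite /c; case: ifP => [/maxs|]; last by rewrite mul0r.
    by rewrite leqNgt sj.
  by rewrite big_nat_recr //= cs mul1r addrC.
exists s, c; split=> //; last 1 first.
- move=> f sf; apply: hF; apply: leq_ltn_trans sf _; rewrite ltnNge.
  by apply: contra qs => h; rewrite qc_big.
(* For [s = 0] the polynomial would be 1, whose value is not positive. *)
- case: s {maxs sN eb vb} qs ws cs ew hc hG eG => // qs ws cs ew hc hG eG.
  by move: hG; rewrite eG big_ord0 addr0 expr0 mulr0n (vgtNeq (pval1 v)).
- by rewrite -eG.
Qed.

(** Each coefficient of the minimal relation is replaced by the terms of least value in an adapted
    expansion. What is dropped has larger value, so the strict inequality for the relation and the
    values of the coefficients survive. *)
Theorem key_step_exists Q S : key_pair v Q S -> ~ (forall f, exact_at v Q f) ->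
  exists al Q', key_step v Q S al Q'.
Proof.
move=> kQ nex; have Qm := kp_monic kQ; have Q1 := kp_size kQ; have Q0 := monic_n0 Qm.
have [s [c [s0 sc hc hG hex]]] := key_min_relation Qm Q1 (kp_key kQ) nex.
have [n hN] := kp_se kQ.
have : forall j, exists l, [/\ expansion S l, c j != 0 -> adapted v (c j) l & c j = 0 -> l = [::]].
  move=> j; have [->|c0] := eqVneq (c j) 0; first by exists [::].
  by have [l [h1 h2 _]] := hN _ c0 (sc j); exists l; split=> // /eqP; rewrite (negPf c0).
case/choice => l hl; set w := vl v Q *+ s in hc hG.
pose P j (p : K * {poly K}) := pval v (trm p * Q ^+ j) == Some w.
pose L j := filter (P j) (l j).
have hd j : vgt v w ((c j - ev (L j)) * Q ^+ j).
  have [h1 h2 h3] := hl j; have [c0|c0] := eqVneq (c j) 0.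
    by rewrite /L h3 // c0 ev_nil subr0 mul0r vgt0.
  have [e ha] := h2 c0.
  have -> : c j - ev (L j) = ev (filter (predC (P j)) (l j)).
    by rewrite {1}e (ev_split (P j)) addrAC subrr add0r.
  rewrite ev_filter mulr_suml.
  apply: vgt_sum => p pl /= nP.
  apply: contraNT nP => nv; apply/eqP/pval_eq_ge => //.
  have /pvalP[_ <-] := hc j c0; rewrite vlM ?expf_neq0 // vge_mulr ?expf_neq0 //.
  exact: ha.
exists s, (Q ^+ s + \sum_(j < s) ev (L j) * Q ^+ j); split=> //.
  exists L; split=> //.
  - by move=> j _; apply: expansion_filter; case: (hl j).
  - by move=> j p _; rewrite mem_filter => /andP[/eqP -> _]; rewrite pval_X.
  - move=> j _ ne; rewrite pval_X //.
    have c0 : c j != 0 by apply: contraNneq ne => c0; case: (hl j) => _ _ h; rewrite /L h.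
    by apply: (vgt_oppP (hc j c0)); rewrite -mulrBl.
rewrite -[X in vgt _ _ X](subKr (Q ^+ s + \sum_(j < s) c j * Q ^+ j)); apply: vgtB => //.
rewrite opprD addrACA subrr add0r -sumrB; apply: vgt_sum => j _ _.
by rewrite -mulrBl; exact: hd.
Qed.

End StepExists.

(** * Changing the center of a truncation *)


Section Near.
Variables (K : fieldType) (G : ordAbGroupType).
Variable v : valuation {fraction {poly K}} G.
Implicit Types (Q F f h a b M N : {poly K}) (g : G) (S : set {poly K}).

Lemma same_size_small Q F : Q \is monic -> F \is monic -> size F = size Q -> small Q (F - Q).
Proof. by move=> Qm Fm e; rewrite /small -e size_monicB. Qed.

Lemma exactN Q f : Q \is monic -> (1 < size Q)%N ->
  ~ exact_at v Q f <-> f != 0 /\ forall g, tge v Q g f -> g < vl v f.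
Proof.
move=> Qm Q1; split=> [ne|[f0 h] ef].
  have f0 : f != 0 by apply: contra_notN ne => /eqP -> g _; exact: tge0.
  split=> // g t; have := tge_vge Qm Q1 t; rewrite vgeE // le_eqVlt => /orP[/eqP e|//].
  by case: ne => g'; rewrite vgeE // => h; apply: tge_le t; rewrite e.
by have := h _ (ef _ (vge_vl v f)); rewrite ltxx.
Qed.

Lemma trunc_valE Q f : Q \is monic -> (1 < size Q)%N -> f != 0 ->
  exists k, [/\ qc Q f k != 0, tge v Q (vl v (qc Q f k * Q ^+ k)) f &
    forall g, tge v Q g f -> g <= vl v (qc Q f k * Q ^+ k)].
Proof.
move=> Qm Q1 f0; pose t := [seq k <- iota 0 (size f) | qc Q f k != 0].
have tP k : qc Q f k != 0 -> k \in t.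
  move=> q0; rewrite mem_filter q0 mem_iota /= ltnNge; apply: contra q0 => hk'.
  by rewrite qc_big // (leq_trans hk') // leq_pmull // dgQ_gt0.
have [k0 q0] : exists k, qc Q f k != 0.
  apply: contrapT => /forallNP h; move/negP: f0; apply; apply/eqP.
  by apply: (qc_inj Qm Q1) => k; rewrite qc0; apply/eqP; move: (h k) => /negP; rewrite negbK.
have [k kt hk] := seq_min (fun k => vl v (qc Q f k * Q ^+ k)) (tP _ q0).
have Q0 := monic_n0 Qm.
have qk : qc Q f k != 0 by move: kt; rewrite mem_filter => /andP[].
exists k; split=> // [j|g /(_ k)].
  have [->|qj] := eqVneq (qc Q f j) 0; first by rewrite mul0r vge0.
  by rewrite vgeE ?mulf_neq0 ?expf_neq0 // hk // tP.
by rewrite vgeE // mulf_neq0 ?expf_neq0.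
Qed.
Lemma trunc_val Q f : Q \is monic -> (1 < size Q)%N -> f != 0 ->
  exists2 w, tge v Q w f & forall g, tge v Q g f -> g <= w.
Proof. by move=> Qm Q1 f0; case: (trunc_valE Qm Q1 f0) => k []; exists (vl v (qc Q f k * Q ^+ k)). Qed.

Lemma tge_near Q F : Q \is monic -> (1 < size Q)%N -> F \is monic -> size F = size Q ->
  vge v (vl v Q) (F - Q) -> tge v Q (vl v Q) F.
Proof.
move=> Qm Q1 Fm e h; rewrite -[F](subrK Q); apply: tgeD.
  by apply: tge_small => //; exact: same_size_small.
by have := tge_X v Qm Q1 1; rewrite mulr1n expr1.
Qed.

(** When [F]-adic coefficients are weighted with the value of [Q], both centers give the same
    truncation; [tge_rebase] is the converse. Each division by [F] is [tge_div] with exponent 1 and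
    costs the value of [Q]. *)
Lemma rebase Q F g f k : Q \is monic -> (1 < size Q)%N -> keyprop v Q ->
  F \is monic -> size F = size Q -> vge v (vl v Q) (F - Q) ->
  tge v Q g f -> vge v g (qc F f k * Q ^+ k).
Proof.
move=> Qm Q1 hk Fm e h; have Q0 := monic_n0 Qm.
have tF : tge v Q (vl v Q *+ 1) F by rewrite mulr1n; exact: tge_near.
have dF : dg F = (dg Q * 1)%N by rewrite muln1 /dg e.
elim: k f g => [|k IH] f g tf; have [t1 t2] := tge_div Qm Q1 hk Fm dF tF tf.
  by rewrite expr0 mulr1 /qc expr0 divp1; exact: tge_vge t1.
have -> : qc F f k.+1 = qc F (f %/ F) k by rewrite /qc divp_divl exprS.
have t3 : tge v Q (g - vl v Q) (f %/ F).
  by apply/(tge_mulX _ _ _ _ 1) => //; rewrite mulr1n subrK.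
have := IH _ _ t3; rewrite exprSr mulrA -[in X in _ -> X](subrK (vl v Q) g).
by rewrite vge_mulr.
Qed.

Lemma tge_rebase Q F f w :  Q \is monic -> (1 < size Q)%N -> keyprop v Q ->
  F \is monic -> size F = size Q -> vge v (vl v Q) (F - Q) ->
  (forall k, vge v w (qc F f k * Q ^+ k)) -> tge v Q w f.
Proof.
move=> Qm Q1 hk Fm e h hw; have F1 : (1 < size F)%N by rewrite e.
have Q0 := monic_n0 Qm.
rewrite (qc_expand_size Fm F1 f); apply: tge_sum => k _ _.
have tF := tgeX Qm Q1 hk k (tge_near Qm Q1 Fm e h).
rewrite -(subrK (vl v Q *+ k) w); apply: tgeM => //.
apply: tge_small => //; first by rewrite /small -e; exact: small_qc.
by have := hw k; rewrite -{1}(subrK (vl v Q *+ k) w) -vlX // vge_mulr // expf_neq0.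
Qed.

(** The truncation at [F] gives [Q] its own value, because [Q] is [F] minus a small polynomial of
    value at least that of [Q]; the [Q]-adic terms of [f] can then be estimated at [F]. *)
Lemma tge_mono Q F f w :  Q \is monic -> (1 < size Q)%N -> keyprop v F ->
  F \is monic -> size F = size Q -> vl v Q <= vl v F ->
  tge v Q w f -> tge v F w f.
Proof.
move=> Qm Q1 hk Fm e le tf; have F1 : (1 < size F)%N by rewrite e.
have Q0 := monic_n0 Qm.
have tQ : tge v F (vl v Q) Q.
  rewrite -[X in tge _ _ _ X](subKr F); apply: tgeB.
    by apply: (tge_le le); have := tge_X v Fm F1 1; rewrite mulr1n expr1.
  apply: tge_small => //; first by rewrite -opprB smallN; exact: same_size_small.
  by apply: vgeB; [exact: vge_le le (vge_vl v F)|exact: vge_vl].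
rewrite (qc_expand_size Qm Q1 f); apply: tge_sum => k _ _.
rewrite -(subrK (vl v Q *+ k) w); apply: tgeM => //; last exact: tgeX.
apply: tge_small => //; first by rewrite /small e; exact: small_qc.
by have := tf k; rewrite -{1}(subrK (vl v Q *+ k) w) -vlX // vge_mulr // expf_neq0.
Qed.

Lemma mod_exp Q a n : Q \is monic -> (1 < size Q)%N -> keyprop v Q -> a != 0 -> small Q a ->
  (a ^+ n) %% Q != 0 /\ vl v ((a ^+ n) %% Q) = vl v a *+ n.
Proof.
move=> Qm Q1 hk a0 sa; elim: n => [|n [IH1 IH2]].
  have -> : a ^+ 0 %% Q = 1 by rewrite expr0 modp_small //; exact: small1.
  by rewrite vl1 mulr0n oner_eq0.
rewrite exprS -modp_mul; have [h1 h2 _] := key_mod hk a0 IH1 sa (small_mod Qm _).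
by rewrite h1 h2 IH2 mulrS.
Qed.
End Near.

(** * Divisible hull and the Archimedean property *)

Section Archimedean.
Variables (K : fieldType) (G : ordAbGroupType).
Variable v : valuation {fraction {poly K}} G.

Definition hull (g : G) : Prop := exists2 n : nat, (0 < n)%N & G0 v (g *+ n).

Lemma hullG0 g : G0 v g -> hull g. Proof. by exists 1%N. Qed.
Lemma hullD x y : hull x -> hull y -> hull (x + y).
Proof.
move=> [n n0 hn] [m m0 hm]; exists (n * m)%N; first by rewrite muln_gt0 n0.
by rewrite mulrnDl {2}mulnC !mulrnA; apply: G0D; exact: G0Mn.
Qed.
Lemma hullN x : hull x -> hull (- x).
Proof. by move=> [n n0 hn]; exists n; rewrite // mulNrn; exact: G0N. Qed.
Lemma hullB x y : hull x -> hull y -> hull (x - y).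
Proof. by move=> hx hy; apply: hullD => //; exact: hullN. Qed.
Lemma hullMn x n : hull x -> hull (x *+ n).
Proof.
move=> hx; elim: n => [|n IH]; first by rewrite mulr0n; apply/hullG0/G0_0.
by rewrite mulrS; exact: hullD.
Qed.
Lemma hull_div x n : (0 < n)%N -> hull (x *+ n) -> hull x.
Proof. by move=> n0 [m m0 h]; exists (n * m)%N; rewrite ?muln_gt0 ?n0 // mulrnA. Qed.

Definition archi : Prop := forall x y, hull x -> hull y -> 0 < x -> exists n, y <= x *+ n.

(** The values of constants bounded in absolute value by a multiple of [x] form a convex subgroup
    containing [x], hence everything. Elements of the hull are treated by clearing denominators. *)
Lemma rank_one_archi : rank_one (base_group v) -> archi.
Proof.
case=> nt hc.
have aG0 x y : G0 v x -> G0 v y -> 0 < x -> exists n, y <= x *+ n.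
  move=> hx hy x0; pose H := [set h | G0 v h /\ exists n, - (x *+ n) <= h /\ h <= x *+ n].
  have cH : convex_subgroup (base_group v) H.
    split.
    - by move=> h [].
    - by split; [exact: G0_0|exists 0%N; rewrite mulr0n oppr0 lexx].
    - move=> h1 h2 [h1G [n [n1 n2]]] [h2G [m [m1 m2]]]; split; first exact: G0B.
      exists (n + m)%N; split.
        apply: (gle_of (gleD n1 m2)); gring.
      apply: (gle_of (gleD n2 m1)); gring.
    - move=> h1 h2 h1G [h2G [n [n1 n2]]] h0 le; split=> //; exists n; split; last exact: le_trans n2.
      apply: le_trans h0; have := gleMn n (ltW x0); rewrite mul0rn => h.
      by apply: (gle_of h); gring.
  have Hx : H x by split=> //; exists 1%N; rewrite mulr1n lexx; split=> //;
    apply: (gle_of (gleD (ltW x0) (ltW x0))); gring.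
  case: (hc H cH) => eH.
    by move: Hx; rewrite eH => /= x00; rewrite x00 ltxx in x0.
  by have : H y by [rewrite eH]; case=> _ [n [_ h]]; exists n.
move=> x y [n n0 hx] [m m0 hy] x0.
have [y0|y0] := boolP (y <= 0); first by exists 0%N.
have [k hk] := aG0 _ _ hx hy (eq_ind _ (fun z => z < x *+ n) (gltMn n0 x0) _ (mul0rn _ n)).
exists (n * k)%N; rewrite mulrnA; apply: le_trans hk.
have := gltNge 0 y; rewrite y0 => /esym y1.
by case: m m0 {hy} => // m _; rewrite mulrS -[X in X <= _]addr0 gle_addl -(mul0rn _ m) gleMn // ltW // gltNge.
Qed.
End Archimedean.

(** * Limits of chains of key polynomials *)


Section Chain.
Variables (K : fieldType) (G : ordAbGroupType).
Variable v : valuation {fraction {poly K}} G.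
Implicit Types (Q F f h a b M N : {poly K}) (g : G) (S : set {poly K}).

Definition chain (c : nat -> {poly K}) S : Prop :=
  forall t, [/\ key_pair v (c t) S, size (c t) = size (c 0%N) & vl v (c t) < vl v (c t.+1)].
Definition exceeds (c : nat -> {poly K}) f : Prop := forall t, ~ exact_at v (c t) f.
Definition min_exceeds c F : Prop :=
  exceeds c F /\ forall f, exceeds c f -> (size F <= size f)%N.
Definition bounded_chain (c : nat -> {poly K}) : Prop :=
  exists2 b, G0 v b & forall t, vl v (c t) <= b.
Definition lim_mon (c : nat -> {poly K}) S al : set {poly K} :=
  [set N | exists t M k, [/\ S M, (k < al)%N & N = M * c t ^+ k]].

Hypothesis arch : archi v.

Section Fixed.
Variables (c : nat -> {poly K}) (S : set {poly K}).
Hypothesis hc : chain c S.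

Lemma chain_pair t : key_pair v (c t) S. Proof. by case: (hc t). Qed.
Lemma chain_monic t : c t \is monic. Proof. exact: kp_monic (chain_pair t). Qed.
Lemma chain_size_gt1 t : (1 < size (c t))%N. Proof. exact: kp_size (chain_pair t). Qed.
Lemma chain_keyprop t : keyprop v (c t). Proof. exact: kp_key (chain_pair t). Qed.
Lemma chain_neq0 t : c t != 0. Proof. exact: monic_n0 (chain_monic t). Qed.
Lemma chain_size t t' : size (c t) = size (c t').
Proof. by case: (hc t) => _ -> _; case: (hc t') => _ -> _. Qed.
Lemma chain_dg t t' : dg (c t) = dg (c t').
Proof. by rewrite /dg (chain_size t t'). Qed.
Lemma chain_lt t t' : (t < t')%N -> vl v (c t) < vl v (c t').
Proof.
move=> lt; have h u : vl v (c u) < vl v (c u.+1) by case: (hc u).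
elim: t' lt => // t' IH; rewrite ltnS leq_eqVlt => /orP[/eqP ->//|/IH l].
exact: lt_trans l (h t').
Qed.
Lemma chain_le t t' : (t <= t')%N -> vl v (c t) <= vl v (c t').
Proof. by rewrite leq_eqVlt => /orP[/eqP ->//|/chain_lt/ltW]. Qed.
Lemma chain_small t t' a : small (c t) a -> small (c t') a.
Proof. by rewrite /small (chain_size t t'). Qed.
Lemma chain_diff_small t t' u : small (c u) (c t' - c t).
Proof. by apply: (@chain_small t); apply: same_size_small; rewrite ?chain_monic // (chain_size t' t). Qed.
Lemma chain_diff_vge t t' : (t <= t')%N -> vge v (vl v (c t)) (c t' - c t).
Proof.
by move=> le; apply: vgeB; [apply: vge_le (chain_le le) (vge_vl v _)|exact: vge_vl].
Qed.
Lemma chain_diff_pval t t' : (t < t')%N -> pval v (c t' - c t) = Some (vl v (c t)).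
Proof.
move=> lt; apply: pvalD_lt'; first by rewrite vgtE ?chain_neq0 // chain_lt.
by rewrite pvalN pval_vl ?chain_neq0.
Qed.
(** The value is also that of [c t.+1 - c t], which has smaller degree. *)
Lemma chain_hull t : hull v (vl v (c t)).
Proof.
have /pvalP[d0 <-] := chain_diff_pval (ltnSn t); case: (kp_exp (chain_pair t)) => e e0 he.
by exists e => //; apply: he => //; exact: chain_diff_small.
Qed.
Lemma small_hull t f : f != 0 -> small (c t) f -> hull v (vl v f).
Proof. by case: (kp_exp (chain_pair t)) => e e0 he f0 sf; exists e => //; exact: he. Qed.

Lemma chain_tge_mono t t' g f : (t <= t')%N -> tge v (c t) g f -> tge v (c t') g f.
Proof.
move=> le; apply: tge_mono; rewrite ?chain_monic ?chain_size_gt1 //; [exact: chain_keyprop|exact: chain_size|exact: chain_le].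
Qed.
Lemma chain_exact_mono t t' f : (t <= t')%N -> exact_at v (c t) f -> exact_at v (c t') f.
Proof. by move=> le ef g hg; exact: chain_tge_mono le (ef g hg). Qed.
Lemma exceeds_from f n : (forall t, (n <= t)%N -> ~ exact_at v (c t) f) -> exceeds c f.
Proof.
move=> h t ef; apply: (h (maxn t n)); first exact: leq_maxr.
by apply: chain_exact_mono ef; exact: leq_maxl.
Qed.
Lemma chain_tge_back t t' : (t <= t')%N -> tge v (c t') (vl v (c t)) (c t).
Proof.
move=> le; rewrite -[X in tge _ _ _ X](subKr (c t')); apply: tgeB.
  by apply: (tge_le (chain_le le)); have := tge_X v (chain_monic t') (chain_size_gt1 t') 1; rewrite mulr1n expr1.
by apply: tge_small; [exact: chain_monic|exact: chain_size_gt1|exact: chain_diff_small|exact: chain_diff_vge].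
Qed.
Lemma chain_rebase t t' g f k : (t <= t')%N -> tge v (c t) g f ->
  vge v g (qc (c t') f k * c t ^+ k).
Proof.
move=> le; apply: rebase; rewrite ?chain_monic ?chain_size_gt1 //; [exact: chain_keyprop|exact: chain_size|exact: chain_diff_vge].
Qed.

(** Only powers up to [s] occur in the expansion of [f], and the weight of each power of the center
    changes by at most [s] times the increment. *)
Lemma chain_lipschitz t t' s g f : (t <= t')%N -> (size f <= dg (c 0%N) * s.+1)%N ->
  tge v (c t') g f -> tge v (c t) (g - (vl v (c t') - vl v (c t)) *+ s) f.
Proof.
move=> le sf tf; apply: (tge_rebase (F := c t')); rewrite ?chain_monic ?chain_size_gt1 //.
- exact: chain_keyprop.
- exact: chain_size.
- exact: chain_diff_vge.
move=> k; have [ks|ks] := ltnP s k.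
  by rewrite qc_big ?chain_monic // ?mul0r ?vge0 // (chain_dg t' 0) (leq_trans sf) // leq_mul2l ks orbT.
have := tf k; have [->|q0] := eqVneq (qc (c t') f k) 0; first by rewrite !mul0r !vge0.
rewrite !vgeE ?mulf_neq0 ?expf_neq0 ?chain_neq0 // !vlM ?expf_neq0 ?chain_neq0 // !vlX ?chain_neq0 // => h.
have d0 : 0 <= vl v (c t') - vl v (c t).
  by apply: (gle_of (chain_le le)); gring.
have h2 := gleMn (s - k) d0.
have e : (vl v (c t') - vl v (c t)) *+ s =
  (vl v (c t') - vl v (c t)) *+ k + (vl v (c t') - vl v (c t)) *+ (s - k).
  by rewrite -mulrnDr subnKC.
rewrite e; apply: (gle_of (gleD h h2)); gring.
Qed.

Lemma exceeds_size f : exceeds c f -> (dg (c 0%N) < size f)%N.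
Proof.
move=> ex; rewrite ltnNge; apply/negP => h; apply: (ex 0%N); apply: exact_small => //.
- exact: chain_monic.
- exact: chain_size_gt1.
by rewrite /small (sizeQ (chain_size_gt1 0)) ltnS.
Qed.

(** Otherwise infinitely many disjoint stretches of the chain would each contribute an increment
    with [n] times it at least [d], and by the Archimedean property the total would pass the
    bound. *)
Lemma chain_small_increments n (d : G) : bounded_chain c -> hull v d -> 0 < d ->
  exists t0, forall t1 t2, (t0 <= t1)%N -> (t1 <= t2)%N ->
    (vl v (c t2) - vl v (c t1)) *+ n < d.
Proof.
move=> [b bG hb] hd d0; apply: contrapT => /forallNP nt.
have : forall t, exists t', (t <= t')%N /\ d <= (vl v (c t') - vl v (c t)) *+ n.
  move=> t; have /existsNP[t1 /existsNP[t2 /not_implyP[le1 /not_implyP[le2 /negP]]]] := nt t.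
  rewrite -gleNgt => h; exists t2; split; first exact: leq_trans le2.
  apply: le_trans h _; apply: gleMn.
  by apply: (gle_of (chain_le le1)); gring.
case/choice => f hf; pose u k := iter k f 0%N.
have hu k : d *+ k <= (vl v (c (u k)) - vl v (c 0%N)) *+ n.
  elim: k => [|k IH]; first by rewrite mulr0n subrr mul0rn.
  rewrite mulrS; case: (hf (u k)) => _ h; apply: (gle_of (gleD h IH)).
  by rewrite /u /=; gring.
have [|k hk] := arch hd (_ : hull v ((b - vl v (c 0%N)) *+ n)) d0.
  by apply/hullMn/hullB; [exact: hullG0|exact: chain_hull].
have h1 : d *+ k.+1 <= d *+ k.
  apply: le_trans hk; apply: le_trans (hu k.+1) _; apply: gleMn.
  by apply: (gle_of (hb (u k.+1))); gring.
by move: h1; rewrite mulrS -[X in _ <= X]add0r gle_addr gleNgt d0.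
Qed.

Lemma exceeds_gap F t w : exceeds c F -> tge v (c t) w F -> w < vl v F.
Proof. by move=> ex; have /exactN[] := ex t; rewrite ?chain_monic ?chain_size_gt1 // => _ h /h. Qed.

Section Bounded.
Hypothesis bc : bounded_chain c.

(** The leading coefficient of [F0] at a late member [c J] is inverted modulo [c J], and all
    coefficients are reduced. The reduction changes [b * F0] only by something too large to restore
    exactness at any later member. The degree of the result is at most that of [F0], so minimality
    makes them equal. *)
Theorem limit_monic F0 : min_exceeds c F0 -> exists (s : nat) F,
  [/\ (0 < s)%N, F \is monic, dg F = (dg (c 0%N) * s)%N, size F = size F0 & exceeds c F].
Proof.
case=> exF minF; set n := dg (c 0%N).
have n0 : (0 < n)%N by exact: dgQ_gt0 (chain_size_gt1 0).
have F00 : F0 != 0 by have /exactN[] := exF 0%N; rewrite ?chain_monic ?chain_size_gt1.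
(* The first increment is the margin gained by reducing modulo [c J]. The index [J] is so late that
   the truncated value of [F0] rises by less than this margin afterwards. *)
pose d := vl v (c 1%N) - vl v (c 0%N).
have d0 : 0 < d by apply: (glt_of (chain_lt (ltnSn 0))); gring.
have hd : hull v d by apply: hullB; exact: chain_hull.
have [t0 ht0] := chain_small_increments (size F0) bc hd d0.
pose J := t0.+1.
have cJm := chain_monic J; have cJ1 := chain_size_gt1 J; have cJ0 := chain_neq0 J.
have dJ : dg (c J) = n by exact: chain_dg.
have exk : exists k, qc (c J) F0 k != 0.
  apply: contrapT => /forallNP h; move/negP: F00; apply; apply/eqP.
  by apply: (qc_inj cJm cJ1) => k; rewrite qc0; apply/eqP; move: (h k) => /negP; rewrite negbK.
have bk k : qc (c J) F0 k != 0 -> (n * k < size F0)%N.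
  by move=> q; rewrite ltnNge; apply: contra q => h; rewrite qc_big // dJ.
have [|s qs smax] := ex_maxnP exk (m := size F0).
  by move=> k /bk /ltnW; apply: leq_trans; rewrite leq_pmull.
have sF : (size F0 <= n * s.+1)%N.
  rewrite {1}(qc_expand_size cJm cJ1 F0).
  apply: leq_trans (size_sum _ _ _) _; apply/bigmax_leqP => k _.
  have [->|qk] := eqVneq (qc (c J) F0 k) 0; first by rewrite mul0r size_poly0.
  apply: leq_trans (size_smallX cJm cJ1 k (small_qc cJm _ _)) _.
  by rewrite dJ leq_mul2l ltnS smax ?orbT.
have [w tw wmax] := trunc_val v cJm cJ1 F00.
have hw t g : (J <= t)%N -> tge v (c t) g F0 -> g < w + d.
  move=> le /(chain_lipschitz le sF)/wmax h.
  have ss : (s <= size F0)%N by apply: leq_trans (ltnW (bk _ qs)); rewrite leq_pmull.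
  have h1 : (vl v (c t) - vl v (c J)) *+ s < d.
    apply: le_lt_trans (ht0 J t (leqnSn _) le); rewrite -(subnKC ss) mulrnDr.
    rewrite -[X in X <= _]addr0 gle_addl; have := gleMn (size F0 - s) (chain_le le).
    by move=> hh; apply: (gle_of hh); gring.
  by apply: (glt_of (gltD h1 h)); gring.
have [b [b0 sb eb vb]] := key_inv cJm cJ1 (@chain_keyprop J) qs (small_qc cJm F0 s).
pose e k := (b * qc (c J) F0 k) %% c J.
have se k : small (c J) (e k) by exact: small_mod.
pose W := \sum_(k < s) e k * c J ^+ k.
have [Fm dF] := monic_addX cJm cJ1 (size_evalX cJm cJ1 (N := s) (c := e) (fun k _ => se k)).
pose F := c J ^+ s + W; rewrite -/W -/F in Fm dF.
have eF : F = \sum_(k < s.+1) e k * c J ^+ k.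
  by rewrite big_ord_recr /= /e eb mul1r addrC.
pose q k := (b * qc (c J) F0 k) %/ c J.
have sq k : small (c J) (q k) by apply: small_div => //; exact: small_qc.
have eD : b * F0 - F = \sum_(k < s.+1) q k * c J ^+ k.+1.
  rewrite eF {1}(qc_expand cJm (f := F0) (N := s.+1)) ?dJ // mulr_sumr -sumrB.
  apply: eq_bigr => k _; rewrite mulrA -mulrBl /e {1}(divp_eq (b * qc (c J) F0 k) (c J)).
  by rewrite addrK -mulrA -exprS.
have tD t : (J <= t)%N -> tge v (c t) (vl v b + w + d) (b * F0 - F).
  move=> le; rewrite eD; apply: tge_sum => k _ _.
  have [->|qk0] := eqVneq (q k) 0; first by rewrite mul0r; exact: tge0.
  have a0 : qc (c J) F0 k != 0 by apply: contraNneq qk0 => h; rewrite /q h mulr0 div0p.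
  have h1 : tge v (c 0%N) (vl v b + vl v (qc (c J) F0 k)) (b * qc (c J) F0 k).
    apply: (tgeM (chain_monic 0) (chain_size_gt1 0) (@chain_keyprop 0)); apply: (exact_small (chain_monic 0) (chain_size_gt1 0)); rewrite ?vge_vl //.
      exact: chain_small sb.
    by apply: (@chain_small J); exact: small_qc.
  (* The quotient by [c J] is estimated with the weight of [c 0]; multiplying it back by [c J]
     therefore gains at least [d]. *)
  have := chain_rebase 1 (leq0n J) h1.
  rewrite /qc !expr1 -/(q k) (modp_small (sq k : (size (q k) < size (c J))%N)).
  rewrite vgeE ?mulf_neq0 ?chain_neq0 // vlM ?chain_neq0 // => h2.
  have h3 := tw k; rewrite vgeE ?mulf_neq0 ?expf_neq0 // vlM ?expf_neq0 // vlX // in h3.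
  have h4 : vl v (c 1%N) <= vl v (c J) by exact: chain_le.
  apply: (@tge_le _ _ _ _ _ (vl v (q k) + vl v (c J) *+ k.+1)).
    rewrite /d mulrS; apply: (gle_of (gleD h2 (gleD h3 h4))); gring.
  apply: (tgeM (chain_monic t) (chain_size_gt1 t) (@chain_keyprop t)).
    by apply: (exact_small (chain_monic t) (chain_size_gt1 t)); [exact: chain_small (sq k)|exact: vge_vl].
  apply: (tgeX (chain_monic t) (chain_size_gt1 t) (@chain_keyprop t)).
  exact: chain_tge_back.
have exFF : exceeds c F.
  apply: (@exceeds_from _ J) => t le ef.
  have ctm := chain_monic t; have ct1 := chain_size_gt1 t; have ct0 := chain_neq0 t; have ctk := @chain_keyprop t.
  have sbt : small (c t) b by exact: chain_small sb.
  have [w' tw' wmax'] := trunc_val v ctm ct1 F00.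
  have hw' := hw t w' le tw'; have hF' := exceeds_gap exF tw'.
  (* If [F] were exact at [c t], the truncation of [b * F0] would reach [vl v b + g]. Multiplying by
     an inverse of [b] modulo [c t] would then lift that of [F0] above its maximum [w']. *)
  have [g [g1 g2 g3]] : exists g, [/\ w' < g, g <= vl v F0 & g <= w + d].
    by have /orP[h|h] := gtotal (vl v F0) (w + d); [exists (vl v F0)|exists (w + d)].
  have tbF : tge v (c t) (vl v b + g) (b * F0).
    rewrite -[X in tge _ _ _ X](subrK F); apply: tgeD.
      by apply: (tge_le _ (tD t le)); rewrite -addrA gle_addl.
    apply: ef; rewrite -[X in vge _ _ X](subKr (b * F0)); apply: vgeB.
      by rewrite vge_mull // vgeE.
    by apply: (tge_vge ctm ct1); apply: (tge_le _ (tD t le)); rewrite -addrA gle_addl.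
  have [a [a0 sa ea va]] := key_inv ctm ct1 ctk b0 sbt.
  have [_ _ hq] := key_mod ctk a0 b0 sa sbt; rewrite va in hq.
  set r := (a * b) %/ c t * c t in hq.
  have tabF : tge v (c t) g (a * (b * F0)).
    have -> : g = vl v a + (vl v b + g) by rewrite addrA va add0r.
    by apply: tgeM => //; apply: exact_small => //; exact: vge_vl.
  have eabF : F0 = a * (b * F0) - r * F0.
    by rewrite mulrA {1}(divp_eq (a * b) (c t)) ea -/r mulrDl mul1r addrAC subrr add0r.
  have tr : tge v (c t) (vl v r) r.
    have := @tge_smallX _ _ v _ ctm ct1 (vl v r) ((a * b) %/ c t) 1.
    rewrite expr1; apply; last exact: vge_vl.
    exact: small_div.
  have [r0|r0] := eqVneq r 0.
    by move: eabF; rewrite r0 mul0r subr0 => e1; have := wmax' g; rewrite {1}e1 => /(_ tabF); rewrite gleNgt g1.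
  rewrite vgtE // in hq.
  have [g' [g1' g2' g3']] : exists g', [/\ w' < g', g' <= g & g' <= vl v r + w'].
    have lt : w' < vl v r + w' by rewrite -{1}[w']add0r glt_addr.
    by have /orP[h|h] := gtotal g (vl v r + w'); [exists g|exists (vl v r + w')].
  have : tge v (c t) g' F0.
    rewrite eabF; apply: tgeB; first exact: (tge_le g2' tabF).
    by apply: (tge_le g3'); apply: tgeM.
  by move/wmax'; rewrite gleNgt g1'.
have sFF : size F = size F0.
  apply/eqP; rewrite eqn_leq minF // andbT.
  by rewrite -[size F]prednK ?size_poly_gt0 ?monic_neq0 // -/(dg F) dF dJ bk.
have s0 : (0 < s)%N.
  rewrite lt0n; apply/eqP => s0; have := exceeds_size exFF.
  rewrite -[size F]prednK ?size_poly_gt0 ?monic_neq0 // -/(dg F) dF s0 muln0 ltnS leqn0 -/n.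
  by move/eqP => h; rewrite h in n0.
by exists s, F; split=> //; rewrite dF dJ.
Qed.
End Bounded.
End Fixed.
End Chain.

(** * Bounded limits *)

Section Limit.
Variables (K : fieldType) (G : ordAbGroupType).
Variable v : valuation {fraction {poly K}} G.
Implicit Types (Q F f h a b M N : {poly K}) (g : G) (S : set {poly K}).
Hypothesis arch : archi v.

Lemma monic_top Q F s : Q \is monic -> (1 < size Q)%N -> F \is monic ->
  dg F = (dg Q * s)%N -> (size (F - Q ^+ s)%R <= dg Q * s)%N /\ qc Q F s = 1.
Proof.
move=> Qm Q1 Fm dF; have sF : size F = (dg Q * s).+1.
  by rewrite -dF /dg prednK // size_poly_gt0 monic_neq0.
have sB : (size (F - Q ^+ s)%R <= dg Q * s)%N.
  by rewrite -ltnS -sF size_monicB ?monic_exp // sF sizeQX.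
split=> //; rewrite -[F](subrK (Q ^+ s)) qcD qc_big // add0r.
by have := qc_smallX Qm Q1 s s (small1 Q1); rewrite mul1r eqxx.
Qed.

Section Fixed.
Variables (c : nat -> {poly K}) (S : set {poly K}).
Hypothesis hc : chain v c S.
Let n := dg (c 0%N).
Let cm := chain_monic hc. Let c1 := chain_size_gt1 hc. Let cp := chain_keyprop hc. Let c0 := chain_neq0 hc.

Section Bounded.
Hypothesis bc : bounded_chain v c.

Variables (F : {poly K}) (s : nat).
Hypotheses (Fm : F \is monic) (dF : dg F = (n * s)%N) (mF : min_exceeds v c F).
Let dct t : dg (c t) = n := chain_dg hc t 0.
Let F0 : F != 0 := monic_n0 Fm.
Let sF : size F = (n * s).+1.
Proof. by rewrite -dF /dg prednK // size_poly_gt0. Qed.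

(** Suppose the truncation at [c t] falls short of the leading term by [e]. By [chain_lipschitz] it
    falls short by at least [e] at all later members. For [u] so late that the increments times [s]
    stay below [e], subtracting [c u ^+ s] does not disturb the inexactness, and it lowers the
    degree: this contradicts minimality. *)
Lemma limit_tge t : tge v (c t) (vl v (c t) *+ s) F.
Proof.
have [exF minF] := mF.
have n0 : (0 < n)%N by exact: dgQ_gt0 (c1 0).
have [k [q0 tw wmax]] := trunc_valE v (cm t) (c1 t) F0; set w := vl v _ in tw wmax.
have sS : (size F <= n * s.+1)%N by rewrite sF mulnS -[X in (X < _)%N]add0n ltn_add2r.
have [h|h] := boolP (vl v (c t) *+ s <= w); first exact: (tge_le h tw).
exfalso; rewrite -gltNge in h; pose e := vl v (c t) *+ s - w.
have e0 : 0 < e by apply: (glt_of h); rewrite /e; gring.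
have top u : qc (c u) F s = 1 by apply: (proj2 (monic_top (cm u) (c1 u) Fm _)); rewrite dct.
have hw u x : (t <= u)%N -> tge v (c u) x F -> x + e <= vl v (c u) *+ s.
  move=> le tx; have h1 := wmax _ (chain_lipschitz hc le sS tx).
  by apply: (gle_of h1); rewrite /e; gring.
have he : hull v e.
  apply: hullB; first by apply: hullMn; exact: (chain_hull hc).
  rewrite /w vlM ?expf_neq0 ?c0 // vlX ?c0 //; apply: hullD.
    by apply: (small_hull hc (t := t)) => //; apply: small_qc; exact: cm.
  by apply: hullMn; exact: (chain_hull hc).
have [t0 ht0] := chain_small_increments arch hc s bc he e0.
pose u := maxn t t0.
have tu : (t <= u)%N by exact: leq_maxl.
have /minF : exceeds v c (F - c u ^+ s).
  apply: (exceeds_from hc (n := u)) => t2 le ef.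
  have tt2 := leq_trans tu le.
  have [w2 tw2 wmax2] := trunc_val v (cm t2) (c1 t2) F0.
  have hF := exceeds_gap hc exF tw2; have h2 := hw t2 w2 tt2 tw2.
  have h3 := ht0 u t2 (leq_maxr _ _) le.
  have h4 : w2 < vl v (c u) *+ s by apply: (glt_of (gltD h3 h2)); gring.
  have [x [x1 x2 x3]] : exists x, [/\ w2 < x, x <= vl v F & x <= vl v (c u) *+ s].
    by have /orP[hh|hh] := gtotal (vl v F) (vl v (c u) *+ s); [exists (vl v F)|exists (vl v (c u) *+ s)].
  have : tge v (c t2) x F.
    rewrite -[F](subrK (c u ^+ s)); apply: tgeD.
      by apply: ef; apply: vgeB; rewrite vgeE ?expf_neq0 ?c0 // vlX.
    apply: (tge_le x3); apply: tgeX; [exact: cm|exact: c1|exact: cp|exact: (chain_tge_back hc)].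
  by move/wmax2; rewrite gleNgt x1.
rewrite leqNgt sF ltnS -(dct u).
by have [-> _] := monic_top (cm u) (c1 u) Fm (etrans dF (congr1 (muln^~ s) (esym (dct u)))).
Qed.

Lemma limit_vgt t : vgt v (vl v (c t) *+ s) F.
Proof. by rewrite vgtE //; apply: (exceeds_gap hc _ (limit_tge t)); case: mF. Qed.

(** In the expansion at [c t.+1], reduction modulo [c t] replaces [c t.+1] by [a], of value that of
    [c t]. The leading term gives [a ^+ s]; the others are strictly larger because their
    coefficients are bounded with the larger value of [c t.+1]. *)
Lemma limit_const t : pval v (F %% c t) = Some (vl v (c t) *+ s).
Proof.
pose a := c t.+1 - c t.
have /pvalP[a0 va] : pval v a = Some (vl v (c t)) by exact: (chain_diff_pval hc).
have sa : small (c t) a by exact: (chain_diff_small hc).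
have dt' : dg F = (dg (c t.+1) * s)%N by rewrite dct.
have [sB top] := monic_top (cm t.+1) (c1 t.+1) Fm dt'.
have [m0 vm] := mod_exp s (cm t) (c1 t) (@cp t) a0 sa.
have eC : c t.+1 = a + c t by rewrite subrK.
have modX k : (c t.+1 ^+ k) %% c t = (a ^+ k) %% c t.
  apply/eqP; rewrite -subr_eq0 -modpN -modpD eC; apply/modp_eq0P.
  by rewrite subrXX addrAC subrr add0r modp_mulr.
have eF : F %% c t = \sum_(k < s.+1) (qc (c t.+1) F k * a ^+ k) %% c t.
  rewrite {1}(qc_expand (cm t.+1) (f := F) (N := s.+1)); last first.
    by rewrite sF dct mulnS -[X in (X < _)%N]add0n ltn_add2r; exact: dgQ_gt0 (c1 0).
  rewrite (big_morph (fun x => x %% c t) (fun x y => modpD (c t) x y) (mod0p _)).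
  by apply: eq_bigr => k _; rewrite -modp_mul modX modp_mul.
rewrite eF big_ord_recr /= top mul1r; apply: pvalD_lt'; last first.
  by rewrite pval_vl // vm va.
apply: vgt_sum => k _ _; have [->|q0] := eqVneq (qc (c t.+1) F k) 0.
  by rewrite mul0r mod0p vgt0.
have tq : tge v (c t) (vl v (qc (c t.+1) F k) + vl v (c t) *+ k) (qc (c t.+1) F k * a ^+ k).
  apply: (tgeM (cm t) (c1 t) (@cp t)).
    apply: tge_small; [exact: cm|exact: c1| |exact: vge_vl].
    by apply: (chain_small hc (t := t.+1)); apply: small_qc; exact: cm.
  rewrite -va; apply: (tgeX (cm t) (c1 t) (@cp t)).
  by apply: tge_small; [exact: cm|exact: c1| |exact: vge_vl].
have := tq 0%N; rewrite /qc expr0 mulr1 divp1; apply: vge_lt.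
have := limit_tge t.+1 k; rewrite vgeE ?mulf_neq0 ?expf_neq0 ?c0 // vlM ?expf_neq0 ?c0 // vlX ?c0 // => h1.
have ks : (0 < s - k)%N by rewrite subn_gt0.
have d0 : 0 < vl v (c t.+1) - vl v (c t).
  by apply: (glt_of (chain_lt hc (ltnSn t))); gring.
have h2 : 0 < (vl v (c t.+1) - vl v (c t)) *+ (s - k).
  by have := gltMn ks d0; rewrite mul0rn.
have e x : x *+ s = x *+ k + x *+ (s - k) :> G by rewrite -mulrnDr subnKC // ltnW.
rewrite !e in h1 *; apply: (glt_of (gleltD h1 h2)); rewrite /qc; gring.
Qed.

Lemma limit_s_gt0 : (0 < s)%N.
Proof.
have := exceeds_size hc mF.1; rewrite sF ltnS -/n => h; rewrite lt0n; apply/eqP => s0.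
by have := dgQ_gt0 (c1 0); rewrite -/n ltnNge (leq_trans h) // s0 muln0.
Qed.

Lemma limit_exact f : small F f -> exists t, exact_at v (c t) f.
Proof.
move=> sf; apply: contrapT => /forallNP ne.
by have := mF.2 f ne; rewrite leqNgt => /negP.
Qed.

(** Powers of [c t] may be replaced by powers of [c t.+1 - c t], which has the same value. A bounded
    limit thus brings no new values in smaller degree: the denominators and the representatives stay
    the same. *)
Lemma limit_hull t f : f != 0 -> small F f -> exact_at v (c t) f ->
  exists a, [/\ a != 0, small (c t) a & vl v f = vl v a].
Proof.
move=> f0 sf ef; have [k q0 ->] := exact_pval (cm t) (c1 t) ef f0.
have /pvalP[a0 va] : pval v (c t.+1 - c t) = Some (vl v (c t)) by exact: (chain_diff_pval hc).
have sa : small (c t) (c t.+1 - c t) by exact: (chain_diff_small hc).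
have [m0 vm] := mod_exp k (cm t) (c1 t) (@cp t) a0 sa.
have [h1 h2 _] := key_mod (@cp t) q0 m0 (small_qc (cm t) _ _) (small_mod (cm t) _).
exists ((qc (c t) f k * (((c t.+1 - c t) ^+ k) %% c t)) %% c t); split=> //.
  by apply: small_mod; exact: cm.
by rewrite h2 vm va vlM ?expf_neq0 ?c0 // vlX ?c0.
Qed.

Lemma limit_keyprop : keyprop v F.
Proof.
move=> a b g sa sb hab.
have [a0|a0] := eqVneq a 0; first by rewrite a0 mul0r mod0p div0p mul0r vge0 vgt0.
have [b0|b0] := eqVneq b 0; first by rewrite b0 mulr0 mod0p div0p mul0r vge0 vgt0.
have [t1 e1] := limit_exact sa; have [t2 e2] := limit_exact sb; pose t := maxn t1 t2.
have ea : exact_at v (c t) a by apply: (chain_exact_mono hc _ e1); exact: leq_maxl.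
have eb : exact_at v (c t) b by apply: (chain_exact_mono hc _ e2); exact: leq_maxr.
have tab := tgeM (cm t) (c1 t) (@cp t) (ea _ (vge_vl v a)) (eb _ (vge_vl v b)).
have hg : g <= vl v a + vl v b by move: hab; rewrite vgeE ?mulf_neq0 // vlM.
have dFt : dg F = (dg (c t) * s)%N by rewrite dct.
have [h1 h2] := tge_div (cm t) (c1 t) (@cp t) Fm dFt (limit_tge t) (tge_le hg tab).
split; first exact: tge_vge h1.
have := tge_vge (cm t) (c1 t) h2; rewrite -[g](subrK (vl v (c t) *+ s)).
rewrite -vlX ?c0 // vge_mulr ?expf_neq0 ?c0 // => h3.
by apply: vgtM => //; rewrite vlX ?c0 //; exact: limit_vgt.
Qed.

Theorem limit_key_pair : key_pair v F (lim_mon c S s).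
Proof.
have s0 := limit_s_gt0; have hS := kp_mon (chain_pair hc 0).
have sFt f t : small F f -> (size f <= dg (c t) * s)%N.
  by rewrite /small sF ltnS dct.
split=> //.
- by have := exceeds_size hc mF.1; apply: leq_ltn_trans; exact: dgQ_gt0 (c1 0).
- exact: limit_keyprop.
- move=> N [t [M [k [SM ka ->]]]]; have [M0 sM] := hS M SM; rewrite mulf_neq0 ?expf_neq0 ?c0 //.
  split=> //; rewrite /small sF ltnS -(dct t).
  apply: leq_trans (size_smallX (cm t) (c1 t) k _) _; first exact: (chain_small hc (t := 0%N)).
  by rewrite leq_mul2l ka orbT.
- case: (kp_exp (chain_pair hc 0)) => e e0 he; exists e => // f f0 sf.
  have [t et] := limit_exact sf; have [a [a0 sa ->]] := limit_hull f0 sf et.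
  by apply: he => //; exact: (chain_small hc 0%N sa).
- case: (kp_se (chain_pair hc 0)) => N hN; exists (s * N)%N => f f0 sf.
  have [t et] := limit_exact sf.
  have := key_step_expand (chain_pair hc t) (sFt f t sf) et f0 (P := fun h l => adapted v h l /\ (size l <= N)%N).
  case=> [h h0 sh|L [hL fL eL sL]].
    by have [l [h1 h2 h3]] := hN h h0 (chain_small hc 0%N sh); exists l; split=> //; case: h2.
  exists (mulX_terms (c t) s L); split.
  + have [u h] := expansion_mulX (cm t) (c1 t) (kp_mon (chain_pair hc t)) (al := s) (fun j _ => hL j).
    split=> // p /h[p0 [M [k [SM ka e]]]]; split=> //.
    by exists t, M, k.
  + split=> // p /mem_mulX[k [q [ka qL ->]]]; rewrite trmX.
    have ne : L k <> [::] by move=> e; rewrite e in qL.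
    have [ev0 [[_ /(_ q qL) h1] _]] := sL k ne.
    have := et _ (vge_vl v f) k; rewrite -eL.
    rewrite -[vl v f](subrK (vl v (c t) *+ k)) -vlX ?c0 // !vge_mulr ?expf_neq0 ?c0 // vgeE // => h2.
    exact: vge_le h2 h1.
  apply: size_mulX_terms => k; have [->//|/eqP ne] := eqVneq (L k) [::].
  by have [_ []] := sL k ne.
- case: (kp_reps (chain_pair hc 0)) => R hR hrep; exists R.
    by move=> M MR; exists 0%N, M, 0%N; rewrite expr0 mulr1; split=> //; exact: hR.
  move=> f f0 sf; have [t et] := limit_exact sf; have [a [a0 sa ->]] := limit_hull f0 sf et.
  by apply: hrep => //; exact: (chain_small hc 0%N sa).
Qed.

(** This leaves the start of the next row free to be chosen. The difference [F' - F] has smaller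
    degree, hence is exact at late members; if [F'] were exact there too, so would be [F]. *)
Lemma limit_same_size F' : F' \is monic -> size F' = size F -> vge v (vl v F) F' ->
  min_exceeds v c F'.
Proof.
move=> Fm' sF' hF'; split; last by move=> f; rewrite sF'; exact: mF.2.
move=> t ef; have [u eu] := limit_exact (same_size_small Fm Fm' sF').
pose w := maxn t u.
have ew : exact_at v (c w) F' by apply: (chain_exact_mono hc _ ef); exact: leq_maxl.
have ew' : exact_at v (c w) (F' - F) by apply: (chain_exact_mono hc _ eu); exact: leq_maxr.
have : tge v (c w) (vl v F) F.
  rewrite -[X in tge _ _ _ X](subKr F'); apply: tgeB; first exact: ew.
  by apply: ew'; apply: vgeB => //; exact: vge_vl.
by move/(exceeds_gap hc mF.1); rewrite ltxx.
Qed.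

End Bounded.
End Fixed.
End Limit.

(** * Unbounded limits *)

Section Unbounded.
Variables (K : fieldType) (G : ordAbGroupType).
Variable v : valuation {fraction {poly K}} G.
Implicit Types (Q F f h a b M N : {poly K}) (g : G) (S : set {poly K}).

Lemma geq_of (a b x y : G) : a = b -> y - x = b - a -> x = y.
Proof. by move=> ->; rewrite subrr => /eqP; rewrite subr_eq0 => /eqP. Qed.

(** Two terms of equal value in a [Q]-adic expansion would put a positive multiple of the value of
    [Q] in the hull. So exactly one term is dominant and it gives the value. *)
Lemma exact_large Q : Q \is monic -> (1 < size Q)%N ->
  (forall f, f != 0 -> small Q f -> hull v (vl v f)) -> ~ hull v (vl v Q) ->
  forall f, exact_at v Q f.
Proof.
move=> Qm Q1 hs nQ f; have Q0 := monic_n0 Qm.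
have [->|f0] := eqVneq f 0; first by move=> g _; exact: tge0.
have [k [q0 tk kmax]] := trunc_valE v Qm Q1 f0; set w := vl v _ in tk kmax.
have hq j : qc Q f j != 0 -> j != k -> vgt v w (qc Q f j * Q ^+ j).
  move=> qj jk; have := tk j; rewrite vgeE ?mulf_neq0 ?expf_neq0 // le_eqVlt => /orP[/eqP e|]; last first.
    by rewrite vgtE ?mulf_neq0 ?expf_neq0.
  case: nQ; move: e; rewrite /w !vlM ?expf_neq0 // !vlX // => e.
  have hd : hull v (vl v (qc Q f k) - vl v (qc Q f j)).
    by apply: hullB; apply: hs => //; apply: small_qc.
  have [lt|lt|e1] := ltngtP j k; last by rewrite e1 eqxx in jk.
    apply: (@hull_div _ _ _ _ (k - j)); first by rewrite subn_gt0.
    rewrite -(opprK (vl v Q *+ _)); apply: hullN.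
    suff -> : - (vl v Q *+ (k - j)) = vl v (qc Q f k) - vl v (qc Q f j) by [].
    have e2 : vl v Q *+ k = vl v Q *+ j + vl v Q *+ (k - j) by rewrite -mulrnDr subnKC // ltnW.
    by rewrite e2 in e; apply: (geq_of (esym e)); gring.
  apply: (@hull_div _ _ _ _ (j - k)); first by rewrite subn_gt0.
  suff -> : vl v Q *+ (j - k) = vl v (qc Q f k) - vl v (qc Q f j) by [].
  have e2 : vl v Q *+ j = vl v Q *+ k + vl v Q *+ (j - k) by rewrite -mulrnDr subnKC // ltnW.
  by rewrite e2 in e; apply: (geq_of (esym e)); gring.
have kf : (k < size f)%N.
  rewrite ltnNge; apply: contra q0 => h; rewrite qc_big // (leq_trans h) //.
  by rewrite leq_pmull // dgQ_gt0.
have /pvalP[_ e] : pval v f = Some w.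
  rewrite (qc_expand_size Qm Q1 f) (bigD1 (Ordinal kf)) //=; apply: pvalD_lt.
    by rewrite pval_vl // mulf_neq0 ?expf_neq0.
  apply: vgt_sum => j _ jk; have [->|qj] := eqVneq (qc Q f j) 0; first by rewrite mul0r vgt0.
  by apply: hq.
by move=> g; rewrite vgeE // e => h; exact: tge_le tk.
Qed.

Hypothesis arch : archi v.
Section Fixed.
Variables (c : nat -> {poly K}) (S : set {poly K}).
Hypothesis hc : chain v c S.
Let cm := chain_monic hc. Let c1 := chain_size_gt1 hc. Let cp := chain_keyprop hc. Let c0 := chain_neq0 hc.

(* Otherwise the constant coefficient of [F] at [c t'] would be the only dominant
   one, and [F] would be exact at [c t']. *)
Lemma exceeds_step F t t' w : exceeds v c F -> (t < t')%N -> tge v (c t) w F ->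
  tge v (c t') (w + (vl v (c t') - vl v (c t))) F.
Proof.
move=> ex lt tw; pose d := vl v (c t') - vl v (c t).
have d0 : 0 < d by apply: (glt_of (chain_lt hc lt)); rewrite /d; gring.
have hk k : vge v (w + d *+ k) (qc (c t') F k * c t' ^+ k).
  have := chain_rebase hc k (ltnW lt) tw; have [->|q0] := eqVneq (qc (c t') F k) 0.
    by rewrite !mul0r !vge0.
  rewrite !vgeE ?mulf_neq0 ?expf_neq0 ?c0 // !vlM ?expf_neq0 ?c0 // !vlX ?c0 // => h.
  by apply: (gle_of h); rewrite /d; gring.
have hk1 k : (0 < k)%N -> vge v (w + d) (qc (c t') F k * c t' ^+ k).
  move=> k0; apply: vge_le (hk k); rewrite gle_addl; case: k k0 {hk} => // k _.
  by rewrite mulrS -[X in X <= _]addr0 gle_addl; have := gleMn k (ltW d0); rewrite mul0rn.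
have [h|h] := boolP (vge v (w + d) (qc (c t') F 0)).
  by case=> [|k]; [rewrite expr0 mulr1|exact: hk1].
case: (ex t') => g hg.
have q0 : qc (c t') F 0 != 0 by apply: contraNneq h => ->; rewrite vge0.
have lt0 : vl v (qc (c t') F 0) < w + d by rewrite gltNge -vgeE.
have e : pval v F = Some (vl v (qc (c t') F 0)).
  have sF : (0 < size F)%N.
    by rewrite size_poly_gt0; apply: contraNneq q0 => ->; rewrite qc0.
  rewrite {1}(qc_expand_size (cm t') (c1 t') F) -(prednK sF) big_ord_recl /= expr0 mulr1.
  apply: pvalD_lt; first exact: pval_vl.
  by apply: vgt_sum => i _ _; apply: vge_lt lt0 _; exact: hk1.
have /pvalP[F0 e1] := e; rewrite vgeE // e1 in hg.
case=> [|k]; first by rewrite expr0 mulr1 vgeE.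
by apply: vge_le (hk1 k.+1 isT); apply: le_trans hg (ltW lt0).
Qed.

(** By [exceeds_step] the truncated value of [F] rises at least as much as the values of the chain,
    starting from an element of the hull. *)
Lemma unbounded_value F : exceeds v c F -> ~ bounded_chain v c ->
  forall x, hull v x -> x < vl v F.
Proof.
move=> ex nb x hx.
have F0 : F != 0 by have /exactN[] := ex 0%N; rewrite ?cm ?c1.
have [k [q0 tk _]] := trunc_valE v (cm 0) (c1 0) F0; set w := vl v _ in tk.
have hw : hull v w.
  rewrite /w vlM ?expf_neq0 ?c0 // vlX ?c0 //; apply: hullD; last by apply: hullMn; exact: chain_hull hc 0%N.
  by apply: (small_hull hc (t := 0)) => //; apply: small_qc; exact: cm.
have [b bG hb] : exists2 b, G0 v b & x + vl v (c 0%N) - w <= b.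
  have [n n0 hn] : hull v (x + vl v (c 0%N) - w).
    by apply: hullB => //; apply: hullD => //; exact: chain_hull hc 0%N.
  have /orP[h|h] := gtotal (x + vl v (c 0%N) - w) 0; first by exists 0 => //; exact: G0_0.
  exists ((x + vl v (c 0%N) - w) *+ n) => //; case: n n0 {hn} => // n _.
  by rewrite mulrS -[X in X <= _]addr0 gle_addl; have := gleMn n h; rewrite mul0rn.
have [t ht] : exists t, b < vl v (c t).
  apply: contrapT => /forallNP h; case: nb; exists b => // t.
  by rewrite gleNgt; apply/negP; exact: h.
have ht1 : b < vl v (c t.+1) by apply: lt_trans ht _; exact: (chain_lt hc).
have := exceeds_gap hc ex (exceeds_step ex (ltn0Sn t) tk); apply: le_lt_trans.
by apply: (gle_of (le_trans hb (ltW ht1))); gring.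
Qed.

Lemma unbounded_hull F f : min_exceeds v c F -> f != 0 -> small F f -> hull v (vl v f).
Proof.
move=> mF f0 sf; have [t et] : exists t, exact_at v (c t) f.
  apply: contrapT => /forallNP ne.
  by have := mF.2 f ne; rewrite leqNgt => /negP.
have [k q0 ->] := exact_pval (cm t) (c1 t) et f0.
rewrite vlM ?expf_neq0 ?c0 // vlX ?c0 //; apply: hullD; last by apply: hullMn; exact: chain_hull hc t.
by apply: (small_hull hc (t := t)) => //; apply: small_qc; exact: cm.
Qed.

Theorem unbounded_exact F : F \is monic -> min_exceeds v c F -> ~ bounded_chain v c ->
  forall f, exact_at v F f.
Proof.
move=> Fm mF nb; apply: exact_large => //.
- by apply: leq_ltn_trans (exceeds_size hc mF.1); exact: dgQ_gt0 (c1 0).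
- by move=> f; exact: unbounded_hull.
by move=> /(unbounded_value mF.1 nb); rewrite ltxx.
Qed.
End Fixed.

(** Otherwise the convex subgroup generated by the values of constants would be neither trivial nor
    the whole value group. *)
Lemma rank_one_values F : rank_one (base_group v) -> rank_one (value_group v) -> F != 0 ->
  ~ (forall x, G0 v x -> x < vl v F).
Proof.
move=> [nt _] [_ hr] F0 hF.
pose H := [set h | value_group v h /\ exists x, [/\ G0 v x, h <= x & - x <= h]].
have G0V x : G0 v x -> value_group v x.
  by case=> y hy; exists (FracField.tofrac y%:P).
have cH : convex_subgroup (value_group v) H.
  split.
  - by move=> h [].
  - by split; [exact/G0V/G0_0|exists 0; rewrite oppr0 lexx; split=> //; exact: G0_0].
  - move=> h1 h2 [[y1 e1] [x1 [g1 l1 m1]]] [[y2 e2] [x2 [g2 l2 m2]]]; split.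
      exists (y1 / y2); rewrite valuationM e1.
      have y20 : y2 != 0 by apply/eqP => y0; move: e2; rewrite y0 Defs.val0.
      have := valuationM v y2 y2^-1; rewrite mulfV // Defs.val1 e2.
      case: (v y2^-1) => [z|] //= [e]; congr Some; congr (_ + _).
      by apply: (addrI h2); rewrite subrr -e.
    exists (x1 + x2); split; first exact: G0D.
      by apply: (gle_of (gleD l1 m2)); gring.
    by apply: (gle_of (gleD m1 l2)); gring.
  - move=> h1 h2 h1V [_ [x [gx l m]]] p0 p1; split=> //; exists x; split=> //.
      exact: le_trans p1 l.
    have q := le_trans p0 (le_trans p1 l); apply: le_trans p0.
    by apply: (gle_of q); gring.
have VF : value_group v (vl v F) by exists (FracField.tofrac F); exact: pval_vl.
case: (hr H cH) => eH.
  apply: nt; apply/seteqP; split=> x /=; last by move=> ->; exact: G0_0.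
  move=> gx; have : H x -> x = 0 by rewrite eH.
  apply; split; first exact: G0V.
  have /orP[h|h] := gtotal x 0; last first.
    by exists x; rewrite lexx; split=> //; apply: le_trans (h); apply: (gle_of h); gring.
  exists (- x); split; [exact: G0N| |by rewrite opprK lexx].
  by apply: le_trans (h) _; apply: (gle_of h); gring.
have : H (vl v F) by rewrite eH.
by case=> _ [x [gx h _]]; have := hF x gx; rewrite gltNge h.
Qed.
End Unbounded.

(** * Residue characteristic 0 *)

Section CharZero.
Variables (K : fieldType) (G : ordAbGroupType).
Variable v : valuation {fraction {poly K}} G.
Implicit Types (Q F f h a b M N : {poly K}) (g : G) (S : set {poly K}).

Lemma monic_small Q a : Q \is monic -> (1 < size Q)%N -> small Q a ->
  Q + a \is monic /\ size (Q + a)%R = size Q.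
Proof.
move=> Qm Q1 sa; rewrite size_polyDl //; split=> //.
by rewrite monicE lead_coefDl // -monicE.
Qed.

Definition units_nat : Prop := forall n, (0 < n)%N -> pval v (n%:R : K)%:P = Some 0.

Lemma vgeMn g f n : vge v g f -> vge v g (f *+ n).
Proof.
by move=> h; elim: n => [|n IH]; rewrite ?mulr0n ?vge0 // mulrS vgeD.
Qed.

Hypothesis un : units_nat.
Lemma vgeMn_inv g f n : (0 < n)%N -> vge v g (f *+ n) -> vge v g f.
Proof.
move=> n0; have /pvalP[h0 h1] := un n0.
have -> : f *+ n = (n%:R : K)%:P * f.
  by rewrite mul_polyC scaler_nat.
by rewrite -[g in vge v g (_ * _)]add0r -h1 vge_mull.
Qed.

Hypothesis arch : archi v.
Section Fixed.
Variables (c : nat -> {poly K}) (S : set {poly K}).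
Hypothesis hc : chain v c S.
Let n := dg (c 0%N).
Let cm := chain_monic hc. Let c1 := chain_size_gt1 hc. Let cp := chain_keyprop hc. Let c0 := chain_neq0 hc.
Hypothesis bc : bounded_chain v c.
Variables (F : {poly K}) (s : nat).
Hypotheses (Fm : F \is monic) (dF : dg F = (n * s)%N) (mF : min_exceeds v c F).
Let b t := vl v (c t).

(** Substituting [c j = c t - e] in the expansion of [F] at [c j], the leading term contributes
    [- e *+ s] to the subleading coefficient at [c t], and the subleading term contributes its own
    coefficient. Everything else reaches that coefficient through carries only. *)
Lemma limit_subleading j t : (j < t)%N -> (0 < s)%N ->
  vge v (b j *+ 2 - b 0%N)
    (qc (c t) F s.-1 - qc (c j) F s.-1 + (c t - c j) *+ s).
Proof.
move=> jt s0; pose e := c t - c j.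
have [e0 ve] : e != 0 /\ vl v e = b j by apply/pvalP; exact: (chain_diff_pval hc).
have se : small (c 0%N) e by exact: (chain_diff_small hc).
have dj : 0 <= b j - b 0%N by apply: (gle_of (chain_le hc (leq0n j))); rewrite /b; gring.
pose x := b j *+ 2 - b 0%N; pose q k := qc (c j) F k.
have sq k : small (c 0%N) (q k).
  by apply: (chain_small hc (t := j)); apply: small_qc; exact: cm.
(* With [m] carries, the product has value at least [b j *+ m.+1] and each carry costs at most
   [b 0]. Since [b 0 <= b j], the case [m = 1] is the worst, whence the bound [b j *+ 2 - b 0]. *)
have H k i : (k <= s)%N -> (i <= k)%N -> (s.-1 - (k - i) != 0)%N -> (k - i <= s.-1)%N ->
  vge v x (qc (c t) (q k * c t ^+ (k - i) * (- e) ^+ i) s.-1).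
  move=> ks ik m0 kis; rewrite mulrAC qcMX ?cm //.
  rewrite ltnNge kis /=; set m := (s.-1 - (k - i))%N in m0 *.
  have em : (s - k + i)%N = m.+1 by rewrite /m; lia.
  have tq : tge v (c 0%N) (b j *+ m.+1) (q k * (- e) ^+ i).
    have := limit_tge arch hc bc Fm dF mF j k; rewrite -/(q k) => h.
    have h1 : vge v (b j *+ (s - k)) (q k).
      rewrite -(vge_mulr v _ _ (expf_neq0 k (c0 j))) vlX ?c0 //.
      by rewrite -/(b j) -mulrnDr subnK.
    rewrite -em mulrnDr; apply: (tgeM (cm 0) (c1 0) (@cp 0)).
      by apply: tge_small; [exact: cm|exact: c1| |].
    apply: (tgeX (cm 0) (c1 0) (@cp 0)); apply: tgeN.
    by apply: tge_small; [exact: cm|exact: c1| |rewrite -ve vge_vl].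
  have := chain_rebase hc m (leq0n t) tq.
  rewrite -[X in vge v X _](subrK (vl v (c 0%N) *+ m)) -vlX ?c0 // vge_mulr ?expf_neq0 ?c0 //.
  apply: vge_le; rewrite vlX ?c0 // /x -/(b 0%N); case: m m0 {em tq} => // m _.
  by have := gleMn m dj; rewrite mul0rn => h; apply: (gle_of h); rewrite !mulrS; gring.
have eF : F = \sum_(k < s.+1) q k * (c t - e) ^+ k.
  have -> : c t - e = c j by rewrite /e subKr.
  apply: (qc_expand (cm j)); rewrite (chain_dg hc j 0) -/n.
  have -> : size F = (n * s).+1 by rewrite -dF /dg prednK // size_poly_gt0 monic_neq0.
  by rewrite mulnS -[X in (X < _)%N]add0n ltn_add2r; exact: dgQ_gt0 (c1 0).
have top u : qc (c u) F s = 1.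
  by apply: (proj2 (monic_top (cm u) (c1 u) Fm _)); rewrite (chain_dg hc u 0).
have exq k : q k * (c t - e) ^+ k =
    \sum_(i < k.+1) (q k * c t ^+ (k - i) * (- e) ^+ i) *+ 'C(k, i).
  by rewrite exprDn mulr_sumr; apply: eq_bigr => i _; rewrite mulrnAr mulrA.
have qcMn f m k : qc (c t) (f *+ m) k = qc (c t) f k *+ m.
  by elim: m => [|m IH]; rewrite ?mulr0n ?qc0 // !mulrS qcD IH.
have small_t f : small (c 0%N) f -> small (c t) f by exact: (chain_small hc).
have Hs k i0 : (k <= s)%N -> (forall i, (i0 <= i <= k)%N -> (s.-1 - (k - i) != 0)%N && (k - i <= s.-1)%N) ->
  forall i : 'I_k.+1, (i0 <= i)%N -> vge v x (qc (c t) ((q k * c t ^+ (k - i) * (- e) ^+ i) *+ 'C(k, i)) s.-1).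
  move=> ks hi i ii; rewrite qcMn; apply: vgeMn; have ik : (i <= k)%N by rewrite -ltnS.
  by have /andP[] := hi i (introT andP (conj ii ik)); exact: H.
have lead : vge v x (qc (c t) (q s * (c t - e) ^+ s) s.-1 + e *+ s).
  rewrite exq (bigD1 ord0) //= (bigD1 (inord 1)) //=; last by rewrite -val_eqE /= inordK.
  set R := \sum_(i < _ | _) _; have hR : vge v x (qc (c t) R s.-1).
    rewrite /R qc_sum; apply: vge_sum => i _ /andP[i0 i1]; apply: (Hs s 2%N) => //.
      by move=> k hk; apply/andP; split; lia.
    by move: i0 i1; rewrite -!val_eqE /= inordK //; lia.
  rewrite !qcD !qcMn inordK // bin0 bin1 mulr1n subn0 expr0 mulr1 /q top mul1r subn1 expr1 mul1r.
  have -> : qc (c t) (c t ^+ s) s.-1 = 0.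
    have := qc_smallX (cm t) (c1 t) s s.-1 (small1 (c1 t)); rewrite mul1r => ->.
    by case: eqP => // h; move: s0; rewrite -h; case: (s) h => //= m /eqP; rewrite ltn_eqF.
  rewrite mulrC qc_smallX ?cm ?c1 //; last by rewrite smallN; exact: small_t.
  by rewrite eqxx add0r mulNrn addrAC addNr add0r.
have nextl : vge v x (qc (c t) (q s.-1 * (c t - e) ^+ s.-1) s.-1 - q s.-1).
  rewrite exq (bigD1 ord0) //= qcD qcMn bin0 mulr1n subn0 expr0 mulr1.
  rewrite qc_smallX ?cm ?c1 //; last exact: small_t.
  rewrite eqxx addrAC subrr add0r qc_sum.
  apply: vge_sum => i _ i0; apply: (Hs s.-1 1%N); first exact: leq_pred.
    by move=> k hk; apply/andP; split; lia.
  by move: i0; rewrite -val_eqE /=; lia.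
have -> : qc (c t) F s.-1 - qc (c j) F s.-1 + (c t - c j) *+ s =
    (\sum_(k < s.-1) qc (c t) (q k * (c t - e) ^+ k) s.-1) +
    ((qc (c t) (q s.-1 * (c t - e) ^+ s.-1) s.-1 - q s.-1) +
    (qc (c t) (q s * (c t - e) ^+ s) s.-1 + e *+ s)).
  have -> : qc (c t) F s.-1 = \sum_(k < s.+1) qc (c t) (q k * (c t - e) ^+ k) s.-1.
    by rewrite {1}eF qc_sum.
  have split2 (X : nat -> {poly K}) : \sum_(k < s.+1) X k = \sum_(k < s.-1) X k + X s.-1 + X s.
    by rewrite big_ord_recr /=; case: (s) s0 => // m _; rewrite big_ord_recr.
  rewrite (split2 (fun k => qc (c t) (q k * (c t - e) ^+ k) s.-1)) -/(q _) -/e; ring.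
apply: vgeD; last exact: vgeD.
apply: vge_sum => k _ _; rewrite exq qc_sum; apply: vge_sum => i _ _.
apply: (Hs k 0%N) => //; first by have := ltn_ord k; lia.
by move=> i' hi; have := ltn_ord k; move=> ?; apply/andP; split; lia.
Qed.

Hypothesis cof : forall f, f \is monic -> size f = size (c 0%N) -> exists t, vl v f <= b t.

(* With [q] the subleading coefficient of [F] at [c j], the polynomial [c j + q / s]
   has value at least [2 b j - b 0]; by cofinality the increments of [b] would double. *)
Theorem char0_no_bounded_limit : False.
Proof.
have s0 := limit_s_gt0 hc Fm dF mF.
have key j : exists2 t, (j < t)%N & b j *+ 2 - b 0%N <= b t.
  pose a := (s%:R^-1 : K) *: qc (c j) F s.-1.
  have /pvalP[s1 _] := un s0.
  have as_ : a *+ s = qc (c j) F s.-1.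
    rewrite /a -scaler_nat scalerA mulfV ?scale1r //.
    by move: s1; rewrite polyC_eq0.
  have sa : small (c j) (c j + a - c j).
    by rewrite addrAC subrr add0r; apply: smallZ; apply: small_qc; exact: cm.
  have [Qm sQ'] := monic_small (cm j) (c1 j) (smallZ s%:R^-1 (small_qc (cm j) F s.-1)).
  rewrite -/a in Qm sQ'; have sQ : size (c j + a) = size (c 0%N) by rewrite sQ' (chain_size hc j 0).
  have [t0 ht0] := cof Qm sQ; pose t := (maxn t0 j).+1.
  have jt : (j < t)%N by rewrite ltnS leq_maxr.
  have ht : vl v (c j + a) < b t.
    by apply: le_lt_trans ht0 _; apply: (chain_lt hc); rewrite ltnS leq_maxl.
  exists t => //; have [//|h] := boolP (_ <= _).
  rewrite -gltNge in h.
  have : vge v (b t) (c j + a).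
    apply: (vgeMn_inv s0).
    have -> : (c j + a) *+ s = c t *+ s + qc (c t) F s.-1 -
      (qc (c t) F s.-1 - qc (c j) F s.-1 + (c t - c j) *+ s).
      by rewrite mulrnDl as_ mulrnBl; ring.
    apply: vgeB; last by apply: vge_le (limit_subleading jt s0); exact: ltW.
    apply: vgeD; first by apply: vgeMn; exact: vge_vl.
    rewrite -(vge_mulr v _ _ (expf_neq0 s.-1 (c0 t))) vlX ?c0 // -/(b t) -mulrS prednK //.
    exact: (limit_tge arch hc bc Fm dF mF).
  by rewrite vgeE ?monic_neq0 // gleNgt ht.
(* Late increments are smaller than [b 1 - b 0], whereas [key] provides, after any [j], an increment
   of at least [b j - b 0]. *)
have hd : hull v (b 1%N - b 0%N) by apply: hullB; [exact: chain_hull hc 1%N|exact: chain_hull hc 0%N].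
have d0 : 0 < b 1%N - b 0%N by apply: (glt_of (chain_lt hc (ltnSn 0))); rewrite /b; gring.
have [t0 ht0] := chain_small_increments arch hc 1 bc hd d0.
have [t jt ht] := key t0.+1.
have h1 := ht0 t0.+1 t (leqnSn _) (ltnW jt); rewrite mulr1n in h1.
have h2 := chain_le hc (ltn0Sn t0).
have := gleltD (gleD ht h2) h1.
rewrite -/(b t) -/(b t0.+1) -/(b 1%N) => h3.
have : (0 : G) < 0 by apply: (glt_of h3); gring.
by rewrite ltxx.
Qed.
End Fixed.
End CharZero.

(** * Paths in a fixed degree *)


Section Reach.
Variables (T : Type) (R : T -> T -> Prop).

Fixpoint reachn m (s s' : T) : Prop :=
  if m is m'.+1 then exists2 s1, R s s1 & reachn m' s1 s' else s = s'.

Lemma reachn_cat m m' s s1 s' : reachn m s s1 -> reachn m' s1 s' -> reachn (m + m') s s'.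
Proof.
elim: m s => [|m IH] s /=; first by move=> ->.
by case=> s2 h1 h2 h3; exists s2 => //; exact: IH.
Qed.

Lemma reachn_fun m s s' : reachn m s s' ->
  exists p : nat -> T, [/\ p 0%N = s, p m = s' & forall i, (i < m)%N -> R (p i) (p i.+1)].
Proof.
elim: m s => [|m IH] s /= h; first by exists (fun _ => s).
case: h => s1 h1 /IH[p [p0 pm hp]].
exists (fun i => if i is i'.+1 then p i' else s); split=> // -[_|i /hp //] /=.
by rewrite p0.
Qed.

(** Here [l] lists, in any order and with repetitions, the values at which a step takes place, and
    [f x] is the state before the step at [x]. The induction is on the number of values still
    ahead. *)
Lemma sorted_reach (G : ordAbGroupType) (f : G -> T) (l : seq G) y :
  (forall x, x \in l -> x < y) ->
  (forall x x', x \in l -> x' = y \/ x' \in l -> x < x' ->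
     (forall z, z \in l -> x < z -> x' <= z) -> R (f x) (f x')) ->
  forall x, x \in l -> exists m, reachn m.+1 (f x) (f y).
Proof.
move=> ly hR x; have [n] := ubnP (count (fun z => x < z) l).
elim: n x => // n IH x; rewrite ltnS => hn xl.
case: (pselect (exists2 z, z \in l & x < z)) => [[z0 z0l xz0]|no]; last first.
  exists 0%N, (f y) => //; apply: hR => //; [by left|exact: ly|move=> z zl xz].
  by case: no; exists z.
have [|z] := seq_min (s := [seq z <- l | x < z]) (fun z => z) (x0 := z0).
  by rewrite mem_filter xz0.
rewrite mem_filter => /andP[xz zl] zmin.
have hz w : w \in l -> x < w -> z <= w.
  by move=> wl xw; apply: zmin; rewrite mem_filter xw.
have [|m hm] := IH z _ zl.
  apply: leq_trans hn; rewrite -!size_filter.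
  have -> : [seq w <- l | z < w] = [seq w <- [seq w <- l | x < w] | z < w].
    rewrite -filter_predI; apply: eq_filter => w /=.
    by apply/idP/andP => [h|[]//]; split=> //; apply: lt_trans h.
  rewrite size_filter -[X in (_ < X)%N](count_predC (fun w => z < w)) -[X in (X < _)%N]addn0 ltn_add2l.
  by rewrite -has_count; apply/hasP; exists z; rewrite ?mem_filter ?xz //= ltxx.
by exists m.+1, (f z) => //; apply: hR => //; right.
Qed.
End Reach.

Section Paths.
Variables (K : fieldType) (G : ordAbGroupType).
Variable v : valuation {fraction {poly K}} G.
Implicit Types (Q F f h a b M N : {poly K}) (g : G) (S : set {poly K}).

Definition degree_step S Q Q' : Prop := key_step v Q S 1 Q'.

Lemma key_step1 S Q Q' (l : tms K) : Q \is monic -> (1 < size Q)%N ->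
  expansion S l -> (forall p, p \in l -> pval v (trm p) = Some (vl v Q)) ->
  Q' = Q + ev l -> vgt v (vl v Q) Q' -> degree_step S Q Q'.
Proof.
move=> Qm Q1 hl hv eQ hQ'; have Q0 := monic_n0 Qm; split=> //.
- exists (fun _ => l); split=> //.
  + by move=> j p; rewrite ltnS leqn0 => /eqP -> /hv h; rewrite expr0 mulr1 expr1 h pval_vl.
  + move=> j; rewrite ltnS leqn0 => /eqP -> _; rewrite expr0 mulr1 expr1 [in RHS]pval_vl //.
    have -> : ev l = Q' - Q by rewrite eQ addrAC subrr add0r.
    by apply: pvalD_lt' => //; rewrite pvalN pval_vl.
  by rewrite big_ord_recl big_ord0 addr0 expr1 expr0 mulr1.
move=> f; rewrite muln1 => sf; apply: exact_small => //.
by rewrite /small (sizeQ Q1) ltnS.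
Qed.

Lemma next_mon1 S Q : next_mon S Q 1 = S.
Proof.
apply/seteqP; split=> N /=; first by case=> M [k [SM]]; rewrite ltnS leqn0 => /eqP -> ->; rewrite expr0 mulr1.
by move=> SN; exists N, 0%N; rewrite expr0 mulr1.
Qed.

Lemma same_monic Q a : Q \is monic -> (1 < size Q)%N -> small Q a ->
  [/\ Q + a \is monic, size (Q + a)%R = size Q & (1 < size (Q + a)%R)%N].
Proof. by move=> Qm Q1 sa; have [? e] := monic_small Qm Q1 sa; rewrite e. Qed.

Definition time (p : K * {poly K}) : G := vl v (trm p).

(** The terms of [f - Q] are added by increasing value. Independence excludes cancellation, so the
    polynomial that awaits the terms of value [y] has value exactly [y], as a step requires. *)
Lemma strong_reach Q S f : key_pair v Q S -> strong_pair v Q S ->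
  f \is monic -> size f = size Q -> vgt v (vl v Q) f ->
  exists m Q', [/\ reachn (degree_step S) m.+1 Q Q', vl v f <= vl v Q' & size Q' = size Q].
Proof.
move=> kQ sQ fm sf hf; have Qm := kp_monic kQ; have Q1 := kp_size kQ; have hS := kp_mon kQ.
have Q0 := monic_n0 Qm; have f0 := monic_n0 fm.
have hlt : vl v Q < vl v f by rewrite -vgtE.
have sh : small Q (f - Q) by exact: same_size_small.
have /pvalP[h0 vh] : pval v (f - Q) = Some (vl v Q).
  by apply: pvalD_lt'; rewrite ?pvalN ?pval_vl.
have [l [el hl sl]] := sQ _ h0 sh; have [_ ad] := strongl_adapted hl sl.
have smt P : small Q (ev (filter P l)).
  by apply: (ev_small Q1 hS); exact: expansion_filter.
(* The terms of larger value are never added: the path ends at a polynomial that differs from [f] by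
   them, which is enough for the value. *)
pose l' := [seq p <- l | time p < vl v f].
pose st y := Q + ev [seq p <- l' | time p < y].
have stE y : y <= vl v f -> st y = f - ev [seq p <- l | ~~ (time p < y)].
  move=> yf; rewrite /st /l' -filter_predI.
  rewrite (eq_filter (a2 := fun p => time p < y)); last first.
    by move=> p /=; apply/andP/idP => [[]//|h]; split=> //; apply: lt_le_trans yf.
  have e : f - Q = ev [seq p <- l | time p < y] + ev [seq p <- l | ~~ (time p < y)].
    by rewrite {1}hl; exact: ev_split.
  by rewrite -[f in RHS](subrK Q) e [in RHS]addrAC addrK addrC.
have vst y : y <= vl v f -> vge v y (st y).
  move=> yf; rewrite stE //; apply: vgeB; first by rewrite vgeE.
  rewrite ev_filter; apply: vge_sum => p pl; rewrite -gleNgt /time => h.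
  by rewrite vgeE // (trm_neq0 hS el pl).
have tl p : p \in l -> trm p != 0 by exact: (trm_neq0 hS el).
have stv y : y \in [seq time p | p <- l'] -> pval v (st y) = Some y.
  case/mapP => p; rewrite mem_filter => /andP[pf pl] ->.
  apply: pval_eq_ge; first exact: vst (ltW pf).
  apply/negP; rewrite stE ?(ltW pf) // => h.
  have h2 : vgt v (time p) (ev [seq q <- l | ~~ (time q < time p)]).
    by rewrite -[X in vgt _ _ X](subKr f); apply: vgtB => //; rewrite vgtE.
  have [z [z1 z2]] : exists z, time p < z /\ vge v z (ev [seq q <- l | ~~ (time q < time p)]).
    have [->|e0] := eqVneq (ev [seq q <- l | ~~ (time q < time p)]) 0.
      by exists (vl v f); rewrite vge0.
    by exists (vl v (ev [seq q <- l | ~~ (time q < time p)])); rewrite -vgtE // vge_vl.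
  rewrite ev_filter in z2.
  by have := sl _ _ z2 p pl; rewrite ltxx /= vgeE ?tl // => /(_ isT); rewrite gleNgt z1.
have mst y : [/\ st y \is monic, size (st y) = size Q & (1 < size (st y))%N].
  by apply: same_monic => //; rewrite /l' -filter_predI; exact: smt.
have hst : st (vl v Q) = Q.
  rewrite /st; set l2 := filter _ _; have -> : l2 = [::]; last by rewrite ev_nil addr0.
  apply/eqP; rewrite -(negbK (_ == _)) -has_filter; apply/hasPn => p.
  rewrite mem_filter => /andP[_ pl]; rewrite -gleNgt /time.
  by have := ad p pl; rewrite vh vgeE ?tl.
have tQ : vl v Q \in [seq time p | p <- l'].
  apply: contrapT => /negP no.
  have : vgt v (vl v Q) (ev l).
    apply: vgt_sum => p pl _; rewrite vgtE ?tl // gltNge; apply: contra no => hp.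
    have ep : time p = vl v Q.
      by apply/eqP; rewrite eq_le hp /=; have := ad p pl; rewrite vh vgeE ?tl.
    by rewrite -ep; apply: map_f; rewrite mem_filter ep hlt.
  by rewrite -hl vgtE // vh ltxx.
have [|x x' xl x'l xx' hx'|m hm] := sorted_reach (R := degree_step S) (f := st) (l := [seq time p | p <- l']) (y := vl v f) _ _ tQ.
- by move=> x /mapP[p]; rewrite mem_filter => /andP[h _] ->.
- have [sm ss s1] := mst x; have vx := stv x xl; have /pvalP[_ ex] := vx.
  have x'f : x' <= vl v f.
    by case: x'l => [->|/mapP[p]]; rewrite ?lexx // mem_filter => /andP[/ltW h _] ->.
  apply: (key_step1 (l := [seq p <- l' | time p == x])) => //.
  + by apply: expansion_filter; apply: expansion_filter.
  + by move=> p; rewrite !mem_filter => /andP[/eqP ep /andP[_ pl]]; rewrite ex -ep pval_vl ?tl.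
  + rewrite /st -addrA; congr (_ + _).
    have -> : [seq p <- l' | time p < x] = filter (fun p => time p < x) [seq p <- l' | time p < x'].
      rewrite -filter_predI; apply: eq_filter => p /=.
      by apply/idP/andP => [h|[]//]; split=> //; apply: lt_trans xx'.
    rewrite (ev_split (fun p => time p < x)); congr (_ + ev _).
    rewrite -filter_predI; apply: eq_in_filter => p pl /=; rewrite -gleNgt.
    apply/andP/eqP => [[h1 h2]|->]; last by rewrite lexx xx'.
    apply/eqP; rewrite eq_le h1 andbT gleNgt; apply/negP => h3.
    have := hx' (time p) (map_f _ pl); rewrite h3 gleNgt h2 => /(_ isT) //.
  rewrite ex; case: x'l => [e|x'l]; last by rewrite vgtE ?monic_neq0 //; [have /pvalP[_ ->] := stv x' x'l|case: (mst x')].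
  by apply: vge_lt (vst x' x'f).
exists m, (st (vl v f)); rewrite -{1}hst; have [sm ss s1] := mst (vl v f); split=> //.
by rewrite -vgeE ?monic_neq0 // vst.
Qed.
End Paths.

(** * Paths with pending terms *)


Section Alarm.
Variables (K : fieldType) (G : ordAbGroupType).
Variable v : valuation {fraction {poly K}} G.
Implicit Types (Q F f h a b B M N : {poly K}) (g : G) (S : set {poly K}).

Lemma vlZ (c : K) M : c != 0 -> M != 0 -> vl v (c *: M) = vl v c%:P + vl v M.
Proof. by move=> c0 M0; rewrite -mul_polyC vlM ?polyC_eq0. Qed.

Section Run.
Variables (F : {poly K}) (S : set {poly K}).
Hypothesis kF : key_pair v F S.
Let Fm := kp_monic kF. Let F1 := kp_size kF. Let hS := kp_mon kF.

(* [R] contains exactly one monomial for each class modulo [G0] of the values of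
   the polynomials of degree smaller than that of [F]. *)
Record classes (R : seq {poly K}) : Prop := Classes {
  cl_uniq : uniq R;
  cl_mon : forall M, M \in R -> S M;
  cl_cov : forall f, f != 0 -> small F f ->
    exists2 M, M \in R & exists2 c : K, c != 0 & vl v f = vl v (c *: M);
  cl_dist : forall M M' (c c' : K), M \in R -> M' \in R -> c != 0 -> c' != 0 ->
    vl v (c *: M) = vl v (c' *: M') -> M = M' }.

Lemma classes_exist : exists R, classes R.
Proof.
case: (kp_reps kF) => R0 hR0 cov.
have R00 M : M \in R0 -> M != 0 by move/hR0/hS => [].
have [R [uR sR cR dR]] : exists R, [/\ uniq R, {subset R <= R0},
   forall M, M \in R0 -> exists2 M', M' \in R & exists2 c : K, c != 0 & vl v M = vl v (c *: M') &
   forall M M' (c c' : K), M \in R -> M' \in R -> c != 0 -> c' != 0 ->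
    vl v (c *: M) = vl v (c' *: M') -> M = M'].
  elim: R0 R00 {hR0 cov} => [|M R0 IH] R00; first by exists [::].
  have [|R [uR sR cR dR]] := IH; first by move=> N hN; apply: R00; rewrite inE hN orbT.
  have M0 : M != 0 by apply: R00; rewrite mem_head.
  case: (pselect (exists2 M', M' \in R & exists2 c : K, c != 0 & vl v M = vl v (c *: M'))) => [h|no].
    exists R; split=> //; first by move=> N /sR h1; rewrite inE h1 orbT.
    by move=> N; rewrite inE => /orP[/eqP ->|/cR].
  have no' M' (c c' : K) : M' \in R -> c != 0 -> c' != 0 -> vl v (c *: M) = vl v (c' *: M') -> False.
    move=> M'R c0 c'0 e; apply: no; exists M' => //; exists (c^-1 * c'); first by rewrite mulf_neq0 ?invr_eq0.
    have M'0 : M' != 0 by apply: R00; rewrite inE sR ?orbT.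
    have eM : M = c^-1 *: (c *: M) by rewrite scalerA mulVf ?scale1r.
    rewrite [in LHS]eM -scalerA !(vlZ (c := c^-1)) ?invr_eq0 ?scaler_eq0 ?negb_or ?c0 ?c'0 //.
    by rewrite e.
  exists (M :: R); split=> //=.
  - rewrite uR andbT; apply/negP => MR.
    by apply: (no' M 1 1 MR); rewrite ?oner_eq0.
  - by move=> N; rewrite !inE => /orP[->//|/sR ->]; rewrite orbT.
  - move=> N; rewrite inE => /orP[/eqP ->|/cR[M' hM' h]].
      by exists M; rewrite ?mem_head //; exists 1; rewrite ?oner_eq0 ?scale1r.
    by exists M' => //; rewrite inE hM' orbT.
  move=> N N' c c'; rewrite !inE => /orP[/eqP ->|hN] /orP[/eqP ->|hN'] c0 c'0 e //.
  - by case: (no' N' c c').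
  - by case: (no' N c' c).
  - exact: (dR N N' c c').
exists R; split=> //; first by move=> M /sR; exact: hR0.
move=> f f0 sf; have [M MR0 [c c0 e]] := cov f f0 sf; have [M' M'R [c' c'0 e']] := cR M MR0.
have M0 := R00 M MR0; have M'0 := R00 M' (sR _ M'R).
exists M' => //; exists (c * c'); first by rewrite mulf_neq0.
by rewrite e -scalerA !(vlZ (c := c)) ?scaler_eq0 ?negb_or ?c'0 // e'.
Qed.

Variable R : seq {poly K}.
Hypothesis hR : classes R.
Let R0 M : M \in R -> M != 0. Proof. by move/(cl_mon hR)/hS => []. Qed.
Let Rs M : M \in R -> small F M. Proof. by move/(cl_mon hR)/hS => []. Qed.

Definition lincomb (c : {poly K} -> K) : {poly K} := \sum_(M <- R) c M *: M.

Lemma small_lincomb c : small F (lincomb c).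
Proof. by apply: small_sum => // M /Rs sM _; exact: smallZ. Qed.

Section Path.
Variables (B : {poly K}) (l : tms K) (c cf : {poly K} -> K) (y : G).
Hypotheses (Bm : B \is monic) (sB : size B = size F).
Hypothesis el : expansion S l.
Hypothesis lR : forall p, p \in l -> p.2 \notin R.
Hypothesis ly : forall p, p \in l -> time v p < y.
Hypothesis c0 : forall M, M \in R -> c M != 0.
Hypothesis cf0 : forall M, M \in R -> cf M != 0.
Hypothesis cl : forall M p, M \in R -> p \in l -> vl v (c M *: M) < time v p.
Hypothesis cy : forall M, M \in R -> vl v (c M *: M) < y.
Hypothesis ycf : forall M, M \in R -> y <= vl v (cf M *: M).
Hypothesis By : y <= vl v B.
Hypothesis Rn : R != [::].

Let B0 : B != 0 := monic_n0 Bm.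
Let B1 : (1 < size B)%N. Proof. by rewrite sB. Qed.

Let tl p : p \in l -> trm p != 0.
Proof. exact: (trm_neq0 hS el). Qed.

(** A conflict: the terms due at value [x] cancel, so a pending term of value [x] is needed for the
    state to have that value. *)
Let conf x := vgt v x (ev [seq p <- l | time v p == x]).
(** The values that the pending term on [M] takes in the course of the path: the initial one, each
    conflict in the class of [M], the final one. *)
Let LM M := vl v (c M *: M) :: rcons [seq x <- [seq time v p | p <- l] |
   conf x && `[< exists2 k : K, k != 0 & vl v (k *: M) = x >]] (vl v (cf M *: M)).

Let ex_pos M x : exists z, M \in R -> x <= y ->
  [/\ z \in LM M, x <= z & forall w, w \in LM M -> x <= w -> z <= w].
Proof.
case: (pselect (M \in R /\ x <= y)) => [[MR xy]|no]; last by exists 0 => h1 h2; case: no.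
have [|z] := seq_min (s := [seq z <- LM M | x <= z]) (fun z => z) (x0 := vl v (cf M *: M)).
  by rewrite mem_filter (le_trans xy (ycf MR)) inE mem_rcons mem_head orbT.
rewrite mem_filter => /andP[xz zl] hz; exists z => _ _; split=> // w wl xw.
by apply: hz; rewrite mem_filter xw.
Qed.
Let pos M := projT1 (choice (ex_pos M)).
Let posP M x : M \in R -> x <= y ->
  [/\ pos M x \in LM M, x <= pos M x & forall w, w \in LM M -> x <= w -> pos M x <= w].
Proof. exact: (projT2 (choice (ex_pos M)) x). Qed.

Let ex_kap M x : exists k : K, [/\ x = vl v (c M *: M) -> k = c M,
  x <> vl v (c M *: M) -> y <= x -> k = cf M &
  M \in R -> x \in LM M -> k != 0 /\ vl v (k *: M) = x].
Proof.
have [e|ne] := eqVneq x (vl v (c M *: M)).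
  by exists (c M); split=> // MR _; rewrite c0.
case: (pselect (x = vl v (cf M *: M))) => [e|ne2].
  exists (cf M); split=> //; first by move/eqP; rewrite (negPf ne).
  by move=> MR _; rewrite cf0.
case: (pselect (y <= x)) => [yx|nyx].
  exists (cf M); split=> //; first by move/eqP; rewrite (negPf ne).
  move=> MR; rewrite inE (negPf ne) /= mem_rcons inE => /orP[/eqP//|].
  by rewrite mem_filter => /andP[_ /mapP[p pl e]]; have := ly pl; rewrite -e gltNge yx.
case: (pselect (M \in R /\ x \in LM M)) => [[MR xl]|no]; last first.
  by exists 0; split=> //; [move/eqP; rewrite (negPf ne)|move=> MR xl; case: no].
move: (xl); rewrite inE (negPf ne) /= mem_rcons inE => /orP[/eqP//|].
rewrite mem_filter => /andP[/andP[_ /asboolP[k k0 e]] _].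
by exists k; split=> //; move/eqP; rewrite (negPf ne).
Qed.
Let kap M := projT1 (choice (ex_kap M)).
Let kapP M x : [/\ x = vl v (c M *: M) -> kap M x = c M,
  x <> vl v (c M *: M) -> y <= x -> kap M x = cf M &
  M \in R -> x \in LM M -> kap M x != 0 /\ vl v (kap M x *: M) = x].
Proof. exact: (projT2 (choice (ex_kap M)) x). Qed.

(** The coefficient depends on [x] only through the next position, so a pending term changes only at
    a step whose value is its own. *)
Let C M x := kap M (pos M x).
Let CP M x : M \in R -> x <= y -> C M x != 0 /\ vl v (C M x *: M) = pos M x.
Proof. by move=> MR xy; have [h _ _] := posP MR xy; have [_ _] := kapP M (pos M x); apply. Qed.

(** The state before the step at [x]: what is still due has value at least [x], and each pending
    term waits at its first position from [x] on. *)
Let st x := B - ev [seq p <- l | ~~ (time v p < x)] + lincomb (C^~ x).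

Let vst x : x <= y -> vge v x (st x).
Proof.
move=> xy; apply: vgeD; first apply: vgeB.
- by rewrite vgeE // (le_trans xy).
- rewrite ev_filter; apply: vge_sum => p pl; rewrite -gleNgt /time => h.
  by rewrite vgeE // tl.
apply: vge_sum => M MR _; have [k0 e] := CP MR xy; have [_ h _] := posP MR xy.
by rewrite vgeE ?e // scaler_eq0 negb_or k0 R0.
Qed.

Let mst x : [/\ st x \is monic, size (st x) = size F & (1 < size (st x))%N].
Proof.
rewrite /st -addrA -sB; apply: same_monic => //; rewrite /small sB -/(small F _).
apply: smallD; last exact: small_lincomb.
by rewrite smallN; apply: (ev_small F1 hS); exact: expansion_filter.
Qed.

Let T := [seq vl v (c M *: M) | M <- R] ++ [seq time v p | p <- l].
Let Ty x : x \in T -> x < y.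
Proof. by rewrite mem_cat => /orP[] /mapP[z zR ->]; [exact: cy|exact: ly]. Qed.
Let LMT M x : M \in R -> x \in LM M -> x \in T \/ y <= x.
Proof.
move=> MR; rewrite inE => /orP[/eqP ->|].
  by left; rewrite mem_cat (map_f (fun M => vl v (c M *: M))).
rewrite mem_rcons inE => /orP[/eqP ->|]; first by right; exact: ycf.
by rewrite mem_filter => /andP[_ h]; left; rewrite mem_cat h orbT.
Qed.

(** If a pending term sits at [x], it is the only one, the classes being distinct, and the terms of
    [l] due at [x] are absent or cancel. If none does, the terms due at [x] do not cancel, since a
    conflict would be a position of the pending term of its class. *)
Let stv x : x \in T -> pval v (st x) = Some x.
Proof.
move=> xT; have xy := Ty xT; have xyW := ltW xy.
have hB : vgt v x B by rewrite vgtE // (lt_le_trans xy).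
have eE : ev [seq p <- l | ~~ (time v p < x)] =
    ev [seq p <- l | time v p == x] + ev [seq p <- l | x < time v p].
  rewrite (ev_split (fun p => time v p == x)) -!filter_predI; congr (ev _ + ev _).
    by apply: eq_filter => p /=; case: eqP => //= ->; rewrite ltxx.
  by apply: eq_filter => p /=; rewrite -gleNgt lt_neqAle eq_sym.
have hgt : vgt v x (ev [seq p <- l | x < time v p]).
  by rewrite ev_filter; apply: vgt_sum => p pl h; rewrite vgtE ?tl.
have hst : st x = (B - ev [seq p <- l | x < time v p]) + (lincomb (C^~ x) - ev [seq p <- l | time v p == x]).
  by rewrite /st eE; ring.
rewrite hst; apply: pvalD_lt'; first exact: vgtB.
case: (pselect (exists2 M, M \in R & pos M x = x)) => [[M MR e]|no].
  have [k0 vk] := CP MR xyW; rewrite e in vk.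
  apply: pvalD_lt.
    rewrite /lincomb (bigD1_seq M) ?(cl_uniq hR) //=; apply: pvalD_lt.
      by rewrite pval_vl ?vk // scaler_eq0 negb_or k0 R0.
    rewrite big_seq_cond; apply: vgt_sum => M' _ /andP[M'R ne].
    have [k0' vk'] := CP M'R xyW; have [_ h _] := posP M'R xyW.
    rewrite vgtE ?scaler_eq0 ?negb_or ?k0' ?R0 // vk' lt_neqAle h andbT.
    apply: contraNneq ne => e'; apply/eqP; apply: (cl_dist hR M'R MR k0' k0).
    by rewrite vk vk'.
  rewrite vgtN; have [h _ _] := posP MR xyW; move: h; rewrite e inE => /orP[/eqP ex|].
    set l2 := filter _ _; have -> : l2 = [::]; last by rewrite ev_nil vgt0.
    apply/eqP; rewrite -(negbK (_ == _)) -has_filter; apply/hasPn => p pl.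
    by apply/eqP => ep; have := cl MR pl; rewrite ep -ex ltxx.
  rewrite mem_rcons inE => /orP[/eqP ex|]; first by have := ycf MR; rewrite -ex gleNgt xy.
  by rewrite mem_filter => /andP[/andP[]].
have hA : vgt v x (lincomb (C^~ x)).
  apply: vgt_sum => M MR _; have [k0 vk] := CP MR xyW; have [_ h _] := posP MR xyW.
  rewrite vgtE ?scaler_eq0 ?negb_or ?k0 ?R0 // vk lt_neqAle h andbT.
  by apply/eqP => e; apply: no; exists M.
apply: pvalD_lt' => //; rewrite pvalN; apply: pval_eq_ge.
  by rewrite ev_filter; apply: vge_sum => p pl /eqP <-; rewrite vgeE ?tl.
apply/negP => hc; apply: no; move: xT; rewrite mem_cat => /orP[/mapP[M MR ex]|/mapP[p pl ex]].
  exists M => //; have [_ h1 /(_ x)] := posP MR xyW.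
  rewrite {1}ex mem_head lexx => /(_ isT isT) h2; apply/eqP.
  by rewrite eq_le h1 h2.
have [M MR [k k0 ek]] := cl_cov hR (tl pl) (trm_small hS el pl).
exists M => //; have [_ h1 /(_ x)] := posP MR xyW.
rewrite lexx => h2; apply/eqP; rewrite eq_le h1 h2 //.
have xt : x \in [seq time v p | p <- l] by rewrite ex; exact: map_f.
rewrite inE mem_rcons inE mem_filter xt andbT (_ : conf x = true) /=; last exact: hc.
by apply/orP; right; apply/orP; right; apply/asboolP; exists k; rewrite // ex /time.
Qed.

Let st_start : exists2 x, x \in T & st x = B - ev l + lincomb c.
Proof.
have [M0 M0R] : exists M, M \in R by case: (R) Rn => // M r _; exists M; rewrite mem_head.
have [M MR Mmin] := seq_min (fun M => vl v (c M *: M)) M0R.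
exists (vl v (c M *: M)); first by rewrite mem_cat (map_f (fun M => vl v (c M *: M))).
rewrite /st; congr (_ - ev _ + _).
  rewrite -[RHS]filter_predT; apply: eq_in_filter => p pl /=.
  by rewrite -gleNgt ltW ?cl.
rewrite /lincomb; apply: eq_big_seq => M' M'R; congr (_ *: _).
have xy := ltW (cy MR); have [h1 h2 h3] := posP M'R xy.
have [h _ _] := kapP M' (pos M' (vl v (c M *: M))); apply: h.
apply/eqP; rewrite eq_le h3 ?mem_head ?Mmin //=.
move: h1; rewrite inE => /orP[/eqP <-|]; first exact: lexx.
rewrite mem_rcons inE => /orP[/eqP ->|].
  exact: le_trans (ltW (cy M'R)) (ycf M'R).
by rewrite mem_filter => /andP[_ /mapP[p pl ->]]; rewrite ltW ?cl.
Qed.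

Let st_end : st y = B + lincomb cf.
Proof.
rewrite /st; congr (_ + _).
  set l2 := filter _ _; have -> : l2 = [::]; last by rewrite ev_nil subr0.
  apply/eqP; rewrite -(negbK (_ == _)) -has_filter; apply/hasPn => p pl.
  by rewrite ly.
rewrite /lincomb; apply: eq_big_seq => M MR; congr (_ *: _).
have [h1 h2 h3] := posP MR (lexx y).
have [_ h _] := kapP M (pos M y); apply: h => //.
by move=> e; move: h2; rewrite e gleNgt cy.
Qed.

(** The step adds the terms of [l] of value [x] and replaces the pending term at [x] by its
    successor, through the difference of the two coefficients. The monomials added are distinct
    because [lR] keeps representatives out of [l]. *)
Let st_step x x' : x \in T -> x' = y \/ x' \in T -> x < x' ->
  (forall z, z \in T -> x < z -> x' <= z) -> degree_step v S (st x) (st x').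
Proof.
move=> xT x'T xx' hx'; have xyW := ltW (Ty xT).
have x'y : x' <= y by case: x'T => [->//|/Ty/ltW].
have /pvalP[sx0 ex] := stv xT; have [sm ss s1] := mst x.
have hC M : M \in R -> pos M x != x -> C M x' = C M x.
  move=> MR ne; have [h1 h2 h3] := posP MR xyW; have [h1' h2' h3'] := posP MR x'y.
  have xp : x < pos M x by rewrite lt_neqAle eq_sym ne.
  have x'p : x' <= pos M x.
    by case: (LMT MR h1) => [/hx'/(_ xp)//|]; exact: le_trans.
  rewrite /C; congr (kap M _); apply/eqP; rewrite eq_le h3' //= h3 //.
  exact: le_trans (ltW xx') h2'.
pose la := [seq (C M x' - C M x, M) | M <- [seq M <- R | pos M x == x]].
pose l0 := [seq p <- l | time v p == x].
have hla p : p \in la -> [/\ p.1 != 0, p.2 \in R & pval v (trm p) = Some x].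
  case/mapP => M; rewrite mem_filter => /andP[/eqP e MR] -> /=.
  have [k0 vk] := CP MR xyW; have [k0' vk'] := CP MR x'y; have [_ h _] := posP MR x'y.
  have hv : pval v ((C M x' - C M x) *: M) = Some x.
    rewrite scalerBl; apply: pvalD_lt'.
      by rewrite vgtE ?scaler_eq0 ?negb_or ?k0' ?R0 // vk' (lt_le_trans xx').
    by rewrite pvalN pval_vl ?vk ?e // scaler_eq0 negb_or k0 R0.
  split=> //; apply/eqP => h0; have /pvalP[/eqP] := hv.
  by rewrite h0 scale0r.
apply: (key_step1 (l := l0 ++ la)) => //.
- case: el => ul hl; split.
    rewrite map_cat cat_uniq; apply/and3P; split.
    + by apply: subseq_uniq ul; apply: map_subseq; exact: filter_subseq.
    + apply/hasPn => N /mapP[p /hla[_ h _] ->]; apply/mapP => -[q].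
      by rewrite mem_filter => /andP[_ /lR h2] e; rewrite -e h in h2.
    + by rewrite /la -map_comp map_id_in // filter_uniq // (cl_uniq hR).
  move=> p; rewrite mem_cat => /orP[|/hla[h1 h2 _]]; first by rewrite mem_filter => /andP[_ /hl].
  by split=> //; exact: (cl_mon hR).
- move=> p; rewrite ex mem_cat => /orP[|/hla[]//].
  by rewrite mem_filter => /andP[/eqP <- pl]; rewrite pval_vl ?tl.
- have -> : ev (l0 ++ la) = ev l0 + ev la by rewrite /ev big_cat.
  have e1 : ev [seq p <- l | ~~ (time v p < x)] = ev l0 + ev [seq p <- l | ~~ (time v p < x')].
    rewrite (ev_split (fun p => time v p == x)) -!filter_predI; congr (ev _ + ev _).
      by apply: eq_filter => p /=; case: eqP => //= ->; rewrite ltxx.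
    apply: eq_in_filter => p pl /=; rewrite -!gleNgt.
    have pT : time v p \in T by rewrite mem_cat map_f ?orbT.
    apply/andP/idP => [[h1 h2]|h]; first by apply: hx' => //; rewrite lt_neqAle eq_sym h1.
    by split; [apply: contraTneq h => ->; rewrite gleNgt xx'|exact: le_trans (ltW xx') h].
  have e2 : lincomb (C^~ x') = lincomb (C^~ x) + ev la.
    rewrite /ev big_map big_filter /lincomb [X in _ + X]big_mkcond -big_split /=.
    apply: eq_big_seq => M MR; rewrite /trm /=; case: ifP => [_|/negbT ne].
      by rewrite -scalerDl addrC subrK.
    by rewrite hC // addr0.
  by rewrite /st e1 e2; ring.
rewrite ex; exact: vge_lt xx' (vst x'y).
Qed.

Lemma alarm_path : (exists m, reachn (degree_step v S) m.+1 (B - ev l + lincomb c) (B + lincomb cf)) /\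
  vge v y (B + lincomb cf).
Proof.
split; last by rewrite -st_end; exact: vst.
by have [x xT <-] := st_start; rewrite -st_end; exact: (sorted_reach Ty st_step).
Qed.
End Path.
End Run.
End Alarm.

(** * Reaching prescribed values with pending terms *)

Section AlarmStep.
Variables (K : fieldType) (G : ordAbGroupType).
Variable v : valuation {fraction {poly K}} G.
Implicit Types (Q F f h a b B M N : {poly K}) (g : G) (S : set {poly K}).
Hypothesis arch : archi v.
Variables (F : {poly K}) (S : set {poly K}).
Hypothesis kF : key_pair v F S.
Let Fm := kp_monic kF. Let F1 := kp_size kF. Let hS := kp_mon kF.

Definition no_max n : Prop := forall f, f \is monic -> size f = n ->
  exists f', [/\ f' \is monic, size f' = n & vl v f < vl v f'].

(** Multiples of [e] are values of constants, so [M] can be shifted by them; the least shift that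
    reaches [x] stays below [x + e]. The shift by [n] makes the multiples start below [x], whatever
    its sign. *)
Lemma class_window M x e : M != 0 -> hull v (vl v M) -> hull v x -> G0 v e -> 0 < e ->
  exists c : K, [/\ c != 0, x <= vl v (c *: M) & vl v (c *: M) < x + e].
Proof.
move=> M0 hM hx he e0; pose y := x - vl v M.
have hy : hull v y by exact: hullB.
have hhe : hull v e by exact: hullG0.
have [n hn] := arch hhe (hullN hy) e0.
have ex : exists m, y + e *+ n <= e *+ m.
  by apply: arch => //; apply: hullD => //; exact: hullMn.
have [m hm mmin] := ex_minnP ex.
have [c c0 vc] : exists2 c : K, c != 0 & vl v c%:P = e *+ m - e *+ n.
  by apply/G0P/G0B; exact: G0Mn.
exists c; rewrite vlZ // vc; split=> //; first by apply: (gle_of hm); rewrite /y; gring.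
have h : e *+ m < y + e *+ n + e.
  case: m hm mmin {vc} => [|m] hm mmin.
    have h0 : 0 <= y + e *+ n by apply: (gle_of hn); gring.
    by rewrite mulr0n; apply: (glt_of (gleltD h0 e0)); gring.
  have : ~~ (y + e *+ n <= e *+ m) by apply/negP => /mmin; rewrite ltnn.
  rewrite -gltNge => h; rewrite mulrS; apply: (glt_of h); gring.
by apply: (glt_of h); rewrite /y; gring.
Qed.

(** Without a maximum one can climb forever; the gain is made uniform by taking the least of
    finitely many increments. *)
Lemma room f n : no_max (size F) -> f \is monic -> size f = size F ->
  exists e (g : {poly K}), [/\ G0 v e, 0 < e, g \is monic, size g = size F & vl v f + e *+ n <= vl v g].
Proof.
move=> nm fm sf; case: (kp_exp kF) => e0 e00 he.
have /choice[up hup] : forall h, exists h', h \is monic -> size h = size F ->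
    [/\ h' \is monic, size h' = size F & vl v h < vl v h'].
  move=> h; case: (pselect (h \is monic /\ size h = size F)) => [[hm hs]|no].
    by have [h' hh'] := nm h hm hs; exists h'.
  by exists h => hm hs; case: no.
pose u k := iter k up f.
have hu k : [/\ u k \is monic, size (u k) = size F & vl v (u k) < vl v (u k.+1)].
  elim: k => [|k [h1 h2 h3]]; first by case: (hup f fm sf) => _ _; split.
  by have [h4 h5 _] := hup _ h1 h2; have [_ _ h6] := hup _ h4 h5; split.
have hv k : G0 v (vl v (u k) *+ e0).
  have [h1 h2 h3] := hu k; have [h4 h5 _] := hu k.+1.
  have /pvalP[d0 <-] : pval v (u k.+1 - u k) = Some (vl v (u k)).
    by apply: pvalD_lt'; rewrite ?pvalN ?pval_vl ?vgtE ?monic_neq0.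
  by apply: he => //; rewrite /small -h2; apply: same_size_small; rewrite ?h5.
pose d k := (vl v (u k.+1) - vl v (u k)) *+ e0.
have d0 k : 0 < d k.
  have [_ _ h] := hu k; rewrite -(mul0rn _ e0); apply: gltMn => //.
  by apply: (glt_of h); gring.
(* Increments are multiplied by [e0] to become values of constants, so [e0 * n] of them are needed
   to gain [n] times the least. *)
have [k _ kmin] := seq_min (s := iota 0 (e0 * n).+1) d (mem_head 0%N _).
have hs m : (m <= e0 * n)%N -> d k *+ m <= (vl v (u m) - vl v f) *+ e0.
  elim: m => [|m IH] hm; first by rewrite mulr0n /u /= subrr mul0rn.
  have h1 := IH (ltnW hm); have h2 : d k <= d m by apply: kmin; rewrite mem_iota add0n ltnS (ltnW hm).
  rewrite mulrS; apply: (gle_of (gleD h1 h2)); rewrite /d; gring.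
exists (d k), (u (e0 * n)%N); have [h1 h2 _] := hu (e0 * n)%N; split=> //.
  by rewrite /d mulrnBl; apply: G0B.
have := hs _ (leqnn _); rewrite mulnC mulrnA => /gleMn_inv -/(_ e00) h.
by apply: (gle_of h); gring.
Qed.

Variable R : seq {poly K}.
Hypothesis hR : classes v F S R.
Let R0 M : M \in R -> M != 0. Proof. by move/(cl_mon hR)/hS => []. Qed.
Let Rs M : M \in R -> small F M. Proof. by move/(cl_mon hR)/hS => []. Qed.

(* The pending terms are the [c M *: M]. *)
Definition alarm Q : Prop := exists B (c : {poly K} -> K),
  [/\ B \is monic, size B = size F, Q = B + lincomb R c &
      forall M, M \in R -> c M != 0 /\ vl v (c M *: M) < vl v B].

Lemma classes_n0 : R != [::].
Proof.
have s1 : small F 1 by rewrite /small size_poly1.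
by have [M MR _] := cl_cov hR (oner_neq0 _) s1; apply: contraTneq MR => ->.
Qed.

Lemma small_valued f : f != 0 -> small F f -> hull v (vl v f).
Proof. by case: (kp_exp kF) => e e0 he f0 sf; exists e => //; exact: he. Qed.

Lemma no_max_hull f : no_max (size F) -> f \is monic -> size f = size F -> hull v (vl v f).
Proof.
move=> nm fm sf; have [f' [fm' sf' lt]] := nm f fm sf.
have /pvalP[d0 <-] : pval v (f' - f) = Some (vl v f).
  by apply: pvalD_lt'; rewrite ?pvalN ?pval_vl ?vgtE ?monic_neq0.
by apply: small_valued => //; rewrite /small -sf; apply: same_size_small; rewrite ?sf'.
Qed.

Lemma final_alarms x e : hull v x -> G0 v e -> 0 < e -> exists cf : {poly K} -> K,
  forall M, M \in R -> [/\ cf M != 0, x <= vl v (cf M *: M) & vl v (cf M *: M) < x + e].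
Proof.
move=> hx he e0.
have /choice[cf h] : forall M, exists c : K, M \in R ->
   [/\ c != 0, x <= vl v (c *: M) & vl v (c *: M) < x + e].
  move=> M; have [MR|no] := boolP (M \in R); last by exists 0.
  have [c hc] := class_window (R0 MR) (small_valued (R0 MR) (Rs MR)) hx he e0.
  by exists c.
by exists cf.
Qed.

(** Pigeonhole: there is one more disjoint window than there are elements of [l]. *)
Lemma free_window (x e : G) (l : seq G) : 0 < e ->
  exists2 j, (j <= size l)%N & forall w, w \in l -> ~~ ((x + e *+ j <= w) && (w < x + e *+ j.+1)).
Proof.
move=> e0; apply: contrapT => no.
have /choice[w hw] : forall j : 'I_(size l).+1, exists w,
    [/\ w \in l, x + e *+ j <= w & w < x + e *+ j.+1].
  move=> j; apply: contrapT => nw; apply: no; exists j; first by rewrite -ltnS.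
  by move=> z zl; apply/negP => /andP[h1 h2]; apply: nw; exists z.
have lt (i j : 'I_(size l).+1) : (i < j)%N -> w i < w j.
  move=> ij; have [_ _ h1] := hw i; have [_ h2 _] := hw j.
  apply: lt_le_trans h1 (le_trans _ h2); have := gleMn (j - i.+1) (ltW e0); rewrite mul0rn => h.
  apply: (gle_of h); have -> : e *+ j = e *+ i.+1 + e *+ (j - i.+1) by rewrite -mulrnDr subnKC.
  gring.
have inj : injective w.
  move=> i j e'; apply/val_inj; apply/eqP; rewrite eqn_leq.
  by apply/andP; split; rewrite leqNgt; apply/negP => /lt; rewrite e' ltxx.
have := uniq_leq_size (s1 := [seq w j | j <- enum 'I_(size l).+1]) (s2 := l).
rewrite map_inj_uniq // enum_uniq size_map size_enum_ord ltnn => /(_ isT) h.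
by suff : false by []; apply: h => z /mapP[j _ ->]; case: (hw j).
Qed.

(** The target [g] leaves room for [N.+1] windows of length [e], and [g - B] has at most [N] terms,
    so one window contains none of their values. The final pending terms are placed in this window.
    Terms of larger value are not added but subtracted from [g], which gives the base [B'], of value
    above the window; the pending terms are thus ready for the next move. *)
Lemma alarm_step Q f : no_max (size F) -> alarm Q -> f \is monic -> size f = size F ->
  exists m Q', [/\ reachn (degree_step v S) m.+1 Q Q', alarm Q', vl v f <= vl v Q' & size Q' = size F].
Proof.
move=> nm [B [c [Bm sB -> hc]]] fm sf; have B0 := monic_n0 Bm.
have [f0 [f0m sf0 ff0 Bf0]] : exists f0, [/\ f0 \is monic, size f0 = size F, vl v f <= vl v f0 & vl v B <= vl v f0].
  by have /orP[h|h] := gtotal (vl v f) (vl v B); [exists B|exists f].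
case: (kp_se kF) => N hN.
have [e [g [eG e0 gm sg hg]]] := room N.+1 nm f0m sf0.
have h0x m : (0 : G) <= e *+ m by have := gleMn m (ltW e0); rewrite mul0rn.
have g0 := monic_n0 gm.
have Bg : vl v B < vl v g.
  apply: le_lt_trans Bf0 _; apply: lt_le_trans hg; rewrite -[X in X < _]addr0 glt_addl mulrS.
  by apply: (glt_of (gleltD (h0x N) e0)); gring.
have /pvalP[d0 vd] : pval v (g - B) = Some (vl v B).
  by apply: pvalD_lt'; rewrite ?pvalN ?pval_vl ?vgtE.
have sd : small F (g - B) by rewrite /small -sB; apply: same_size_small; rewrite ?sB.
have [l [el [gl al] sl]] := hN _ d0 sd.
have tl p : p \in l -> trm p != 0 by exact: (trm_neq0 hS el).
have tB p : p \in l -> vl v B <= time v p by move=> pl; rewrite -vgeE ?tl // -vd; exact: al.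
pose l1 := [seq p <- l | p.2 \notin R].
have [j jl1 hj] := free_window (vl v f0) [seq time v p | p <- l1] e0.
rewrite size_map in jl1; set x := vl v f0 + e *+ j in hj.
have jN : (j <= N)%N.
  by apply: leq_trans jl1 (leq_trans _ sl); rewrite size_filter count_size.
have hx : hull v x.
  by apply: hullD; [exact: no_max_hull|apply: hullMn; exact: hullG0].
have f0x : vl v f0 <= x by rewrite -[X in X <= _]addr0 gle_addl.
have Bx : vl v B <= x by exact: le_trans f0x.
have xe : x + e = vl v f0 + e *+ j.+1 by rewrite mulrS /x; gring.
have xg : x + e <= vl v g.
  apply: le_trans hg; rewrite xe gle_addl; have := h0x (N.+1 - j.+1)%N => h.
  apply: (gle_of h); have -> : e *+ N.+1 = e *+ j.+1 + e *+ (N.+1 - j.+1) by rewrite -mulrnDr subnKC.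
  gring.
have [cf hcf] := final_alarms hx eG e0.
pose l2 := [seq p <- l1 | time v p < x].
have sl1 p : p \in l1 -> p \in l by rewrite mem_filter => /andP[].
have sl2 p : p \in l2 -> p \in l1 by rewrite mem_filter => /andP[].
pose l3 := [seq p <- l1 | ~~ (time v p < x)].
have l3x p : p \in l3 -> x + e <= time v p.
  rewrite mem_filter => /andP[h pl]; rewrite gleNgt; apply/negP => h2.
  by have := hj (time v p) (map_f _ pl); rewrite -xe h2 andbT gleNgt h.
pose B' := g - ev l3.
have sm3 : small F (- ev l3).
  by rewrite smallN; apply: (ev_small F1 hS); do 2!apply: expansion_filter.
have [B'm sB'] : B' \is monic /\ size B' = size F.
  have g1 : (1 < size g)%N by rewrite sg.
  have smg : small g (- ev l3) by rewrite /small sg.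
  by rewrite -sg; have [] := same_monic gm g1 smg.
have B'x : x + e <= vl v B'.
  rewrite -vgeE ?monic_neq0 //; apply: vgeB; first by rewrite vgeE.
  by apply: vge_sum => p pl _; rewrite vgeE ?tl ?l3x // sl1 //; move: pl; rewrite mem_filter => /andP[].
have xxe : x < x + e by rewrite -[X in X < _]addr0 glt_addl.
(* Terms of [g - B] on representatives are merged into the pending coefficients. Their values are at
   least that of [B], so those of the pending terms do not change. *)
pose d M : K := \sum_(p <- l | p.2 == M) p.1.
have eR : ev [seq p <- l | p.2 \in R] = lincomb R d.
  rewrite ev_filter /lincomb /d.
  under [RHS]eq_bigr do rewrite scaler_suml.
  rewrite (exchange_big_dep predT) //= [LHS]big_mkcond /=; apply: eq_bigr => p _.
  rewrite [RHS]big_mkcond; case: ifP => pR.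
    rewrite (bigD1_seq p.2) ?(cl_uniq hR) //= eqxx big1 ?addr0 // => M.
    by rewrite eq_sym => /negPf ->.
  rewrite big_seq big1 // => M MR; case: eqP => // e1.
  by rewrite e1 MR in pR.
pose c' M := c M - d M.
have hd M : M \in R -> vge v (vl v B) (d M *: M).
  move=> MR; rewrite /d scaler_suml; apply: vge_sum => p pl /eqP <-.
  by rewrite -/(trm p) vgeE ?tl ?tB.
have hc' M : M \in R -> c' M != 0 /\ vl v (c' M *: M) = vl v (c M *: M).
  move=> MR; have [cM0 cMB] := hc M MR; have M0 := R0 MR.
  have /pvalP[h1 h2] : pval v (c' M *: M) = Some (vl v (c M *: M)).
    rewrite /c' scalerBl; apply: pvalD_lt; first by rewrite pval_vl // scaler_eq0 negb_or cM0.
    by rewrite vgtN; apply: vge_lt (hd M MR).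
  by split=> //; apply: contraNneq h1 => ->; rewrite scale0r.
have eQ : B + lincomb R c = B' - ev l2 + lincomb R c'.
  have -> : lincomb R c = lincomb R c' + lincomb R d.
    by rewrite /lincomb -big_split /=; apply: eq_bigr => M _; rewrite -scalerDl subrK.
  have e1 : g - B = lincomb R d + (ev l2 + ev l3).
    by rewrite gl (ev_split (fun p => p.2 \in R)) eR -(ev_split (fun p => time v p < x)).
  have -> : B = g - (g - B) by rewrite subKr.
  by rewrite /B' e1; ring.
have [] := alarm_path (l := l2) (c := c') (cf := cf) (y := x) kF hR B'm sB'.
- by do 2!apply: expansion_filter.
- by move=> p /sl2; rewrite mem_filter => /andP[].
- by move=> p; rewrite mem_filter => /andP[].
- by move=> M /hc'[].
- by move=> M /hcf[].
- move=> M p MR pl; have [_ ->] := hc' M MR; have [_ h] := hc M MR.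
  by apply: lt_le_trans h _; apply: tB; exact/sl1/sl2.
- by move=> M MR; have [_ ->] := hc' M MR; have [_ h] := hc M MR; exact: lt_le_trans Bx.
- by move=> M /hcf[].
- by apply: le_trans B'x; exact: ltW.
- exact: classes_n0.
rewrite -eQ => -[m hm] hx'; exists m, (B' + lincomb R cf).
have [Qm' sQ' _] : [/\ B' + lincomb R cf \is monic, size (B' + lincomb R cf)%R = size B' & (1 < size (B' + lincomb R cf)%R)%N].
  by apply: same_monic => //; rewrite ?sB' // /small sB'; exact: (small_lincomb kF hR).
split=> //; last by rewrite sQ'.
  exists B', cf; split=> // M /hcf[h1 _ h2]; split=> //.
  exact: lt_le_trans B'x.
by apply: le_trans ff0 (le_trans f0x _); rewrite -vgeE ?monic_neq0.
Qed.

Lemma alarm_start f : no_max (size F) -> f \is monic -> size f = size F ->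
  exists Q, [/\ alarm Q, Q \is monic, size Q = size F & vl v f <= vl v Q].
Proof.
move=> nm fm sf; have [e [g [eG e0 gm sg hg]]] := room 1 nm fm sf.
have [cf hcf] := final_alarms (no_max_hull nm fm sf) eG e0.
rewrite mulr1n in hg.
have [Qm' sQ' _] : [/\ g + lincomb R cf \is monic, size (g + lincomb R cf)%R = size g & (1 < size (g + lincomb R cf)%R)%N].
  by apply: same_monic => //; rewrite ?sg // /small sg; exact: (small_lincomb kF hR).
exists (g + lincomb R cf); split=> //; last 1 first.
- rewrite -vgeE ?monic_neq0 //; apply: vgeD.
    rewrite vgeE ?monic_neq0 //; apply: le_trans hg; rewrite -[X in X <= _]addr0 gle_addl.
    exact: ltW.
  by apply: vge_sum => M MR _; have [h1 h2 _] := hcf M MR; rewrite vgeE ?scaler_eq0 ?negb_or ?h1 ?R0.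
- exists g, cf; split=> // M /hcf[h1 _ h2]; split=> //; exact: lt_le_trans hg.
by rewrite sQ'.
Qed.
End AlarmStep.

(** * Rows of key polynomials *)


Section RunLemma.
Variables (T : Type) (R : T -> T -> Prop) (Good Stop : T -> Prop) (Goal : nat -> T -> Prop).
Hypothesis H : forall k s, Good s -> Stop s \/
  exists m s', [/\ reachn R m.+1 s s', Good s' & Goal k s \/ Goal k s'].

(** Dependent choice: the [k]-th finite path serves the [k]-th goal, and the paths are concatenated.
    As none is empty, goal [k] is met at an index at least [k]. *)
Lemma run s0 : Good s0 ->
  (exists m s', [/\ reachn R m s0 s', Good s' & Stop s']) \/
  exists u : nat -> T, [/\ u 0%N = s0, forall i, R (u i) (u i.+1) &
    forall k, exists2 t, (k <= t)%N & Goal k (u t)].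
Proof.
move=> g0; case: (pselect (exists m s', [/\ reachn R m s0 s', Good s' & Stop s'])) => [|no]; first by left.
right.
pose GR s := Good s /\ exists m, reachn R m s0 s.
have hx (ks : nat * T) : exists y : nat * (nat -> T), GR ks.2 ->
    [/\ y.2 0%N = ks.2, forall i, (i < y.1.+1)%N -> R (y.2 i) (y.2 i.+1), GR (y.2 y.1.+1) &
        Goal ks.1 ks.2 \/ Goal ks.1 (y.2 y.1.+1)].
  case: ks => k s /=; case: (pselect (GR s)) => [[gs [m0 r0]]|ng]; last by exists (0%N, fun _ => s).
  case: (H k gs) => [st|[m [s' [r gs' gl]]]]; first by case: no; exists m0, s.
  have [p [p0 pm hp]] := reachn_fun r; exists (m, p) => _ /=; split=> //; rewrite pm //.
  by split=> //; exists (m0 + m.+1)%N; exact: reachn_cat r0 r.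
have [nx hnx] := choice hx.
pose fix sk k := if k is k'.+1 then (nx (k', sk k')).2 (nx (k', sk k')).1.+1 else s0.
have gsk k : GR (sk k).
  by elim: k => [|k IH] /=; [split=> //; exists 0%N|case: (hnx (k, sk k) IH)].
pose len k := (nx (k, sk k)).1.+1; pose p k := (nx (k, sk k)).2.
have hp k : [/\ p k 0%N = sk k, forall i, (i < len k)%N -> R (p k i) (p k i.+1), p k (len k) = sk k.+1 &
    Goal k (sk k) \/ Goal k (sk k.+1)].
  by have [h1 h2 h3 h4] := hnx (k, sk k) (gsk k); split.
(* The pair [(k, i)] is the point [i] of the path [k]; the end of a path is identified with the
   start of the next one. *)
pose nxt (ki : nat * nat) := if (ki.2.+1 < len ki.1)%N then (ki.1, ki.2.+1) else (ki.1.+1, 0%N).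
pose it t := iter t nxt (0%N, 0%N).
pose u t := p (it t).1 (it t).2.
have itl t : ((it t).2 < len (it t).1)%N.
  by elim: t => [|t IH] //=; rewrite /nxt; case: ifP => /=.
exists u; split.
- by rewrite /u /=; have [-> _ _ _] := hp 0%N.
- move=> t; rewrite /u /=; case E: (it t) (itl t) => [k i] /= lt; rewrite /nxt /=.
  have [h1 h2 h3 _] := hp k; case: ifP => [h|/negbT h] /=; first exact: h2.
  have e : i.+1 = len k by apply/eqP; rewrite eqn_leq lt leqNgt.
  by have [-> _ _ _] := hp k.+1; rewrite -h3 -e; exact: h2.
have hit k : exists2 t, (k <= t)%N & it t = (k, 0%N).
  elim: k => [|k [t kt et]]; first by exists 0%N.
  have hi i : (i < len k)%N -> it (t + i)%N = (k, i).
    elim: i => [|i IH] hi; first by rewrite addn0.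
    by rewrite addnS /= -/(it _) IH ?(ltnW hi) // /nxt /= hi.
  exists (t + len k)%N; first by rewrite /len addnS ltnS (leq_trans kt) // leq_addr.
  have -> : len k = (len k).-1.+1 by [].
  by rewrite addnS /= -/(it _) hi // /nxt /= ltnn.
move=> k; have [_ _ _ [h|h]] := hp k.
  have [t kt et] := hit k; exists t => //; rewrite /u et /=.
  by have [-> _ _ _] := hp k.
have [t kt et] := hit k.+1; exists t; first exact: ltnW.
by rewrite /u et /=; have [-> _ _ _] := hp k.+1.
Qed.
End RunLemma.

(** * Countable cofinal sequences of values *)

Section Cofinal.
Variables (K : fieldType) (G : ordAbGroupType).
Variable v : valuation {fraction {poly K}} G.
Implicit Types (Q F f h a b B M N : {poly K}) (g : G) (S : set {poly K}).
Hypothesis arch : archi v.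
Hypothesis nt : exists2 g, G0 v g & 0 < g.

Definition cofinal_seq n (w : nat -> {poly K}) : Prop :=
  [/\ forall k, w k \is monic /\ size (w k) = n,
      forall j k, (j <= k)%N -> vl v (w j) <= vl v (w k) &
      forall f, f \is monic -> size f = n -> exists k, vl v f <= vl v (w k)].

(** If there is no maximum, the values lie in an Archimedean group, where countably many fractions
    of one element [g] separate points. One polynomial is chosen for each fraction that is reached,
    and the running maxima form the sequence. *)
Lemma cofinal_exists F S : key_pair v F S -> exists w, cofinal_seq (size F) w.
Proof.
move=> kF; have Fm := kp_monic kF.
case: (pselect (no_max v (size F))) => [nm|no]; last first.
  have [f fm [sf hf]] : exists2 f, f \is monic & size f = size F /\
      forall f', f' \is monic -> size f' = size F -> vl v f' <= vl v f.
    apply: contrapT => nf; apply: no => f fm sf; apply: contrapT => nf'; apply: nf.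
    exists f => //; split=> // f' fm' sf'; rewrite gleNgt; apply/negP => lt.
    by apply: nf'; exists f'.
  exists (fun _ => f); split=> // f' fm' sf'; exists 0%N; exact: hf.
have [g gG g0] := nt.
(* The pairs [(n, m)] stand for the fractions [n / m], multiplying [g]. *)
pose ok f (nm : nat * nat) := g *+ nm.1 <= (vl v f - vl v F) *+ nm.2.
have /choice[e he] (ij : nat * nat) : exists f, [/\ f \is monic, size f = size F &
    (exists f', [/\ f' \is monic, size f' = size F & ok f' ij]) -> ok f ij].
  case: (pselect (exists f', [/\ f' \is monic, size f' = size F & ok f' ij])) => [[f' [h1 h2 h3]]|no].
    by exists f'.
  by exists F; split=> // h; case: no.
pose e' k := if (choice.unpickle k : option (nat * nat)%type) is Some ij then e ij else F.
have he' k : e' k \is monic /\ size (e' k) = size F.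
  by rewrite /e'; case: (choice.unpickle k) => // ij; case: (he ij).
pose fix w k := if k is k'.+1 then if vl v (w k') <= vl v (e' k') then e' k' else w k' else F.
have hw k : w k \is monic /\ size (w k) = size F.
  by elim: k => [|k IH] //=; case: ifP.
have wS k : vl v (w k) <= vl v (w k.+1) by rewrite /=; case: ifP => // _; exact: lexx.
have we k : vl v (e' k) <= vl v (w k.+1).
  rewrite /=; case: ifP => [_|/negbT]; first exact: lexx.
  by rewrite -gltNge => /ltW.
have wm j k : (j <= k)%N -> vl v (w j) <= vl v (w k).
  elim: k => [|k IH]; first by rewrite leqn0 => /eqP ->; exact: lexx.
  rewrite leq_eqVlt => /orP[/eqP ->|/IH h]; first exact: lexx.
  exact: le_trans h (wS k).
exists w; split=> // f fm sf.
have /orP[h|hF] := gtotal (vl v f) (vl v F); first by exists 0%N.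
have [f' [fm' sf' lt]] := nm f fm sf.
have hh x : x \is monic -> size x = size F -> hull v (vl v x) by exact: no_max_hull kF x nm.
have d0 : 0 < vl v f' - vl v f by apply: (glt_of lt); gring.
(* Multiplied by [m], the gap between the values of [f] and [f'] is at least [g *+ 2], so a multiple
   of [g] falls in it. The polynomial chosen for that fraction has value at least that of [f]. *)
have [m hm] := arch (hullB (hh _ fm' sf') (hh _ fm sf)) (hullMn 2 (hullG0 gG)) d0.
have m0 : (0 < m)%N.
  case: m hm => // h; have : g *+ 2 <= 0 by move: h; rewrite mulr0n.
  have := gleD (ltW g0) (ltW g0); rewrite addr0 -mulr2n => h1 h2.
  have : g <= 0 by apply: le_trans h2; rewrite mulr2n -[X in X <= _]addr0 gle_addl ltW.
  by rewrite gleNgt g0.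
have hn : exists n, (vl v f - vl v F) *+ m <= g *+ n.
  by apply: arch => //; [exact: hullG0|apply/hullMn/hullB; exact: hh].
have [n hn1 nmin] := ex_minnP hn.
have hn2 : g *+ n <= (vl v f' - vl v F) *+ m.
  have hd : g <= (vl v f' - vl v f) *+ m.
    by apply: le_trans hm; rewrite mulr2n -[X in X <= _]addr0 gle_addl ltW.
  have h0 : 0 <= (vl v f - vl v F) *+ m.
    have := gleMn m (_ : 0 <= vl v f - vl v F); rewrite mul0rn; apply.
    by apply: (gle_of hF); gring.
  case: n hn1 nmin => [|n] hn1 nmin.
    by rewrite mulr0n; apply: (gle_of (gleD h0 (le_trans (ltW g0) hd))); gring.
  have : ~~ ((vl v f - vl v F) *+ m <= g *+ n) by apply/negP => /nmin; rewrite ltnn.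
  rewrite -gltNge => /ltW h; rewrite mulrS; apply: (gle_of (gleD h hd)); gring.
have [_ _ hek] := he (n, m).
have h3 : ok (e (n, m)) (n, m) by apply: hek; exists f'.
exists (choice.pickle (n, m)).+1; apply: le_trans (we _); rewrite /e' choice.pickleK.
have := le_trans hn1 h3; rewrite /= => /gleMn_inv -/(_ m0) h4.
by apply: (gle_of h4); gring.
Qed.
End Cofinal.

(** * Rows and their links *)

Section Rows.
Variables (K : fieldType) (G : ordAbGroupType).
Variable v : valuation {fraction {poly K}} G.
Implicit Types (Q F f h a b B M N : {poly K}) (g : G) (S : set {poly K}).

Definition full Q : Prop := forall f, exact_at v Q f.

(* The indices of the row, its key polynomials, the monomials attached to them, and
   the degrees [alpha]. *)
Record krow := KRow {
  pr : nat -> bool; rq : nat -> {poly K}; rs : nat -> set {poly K}; ra : nat -> nat }.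

Record good_row (r : krow) : Prop := GoodRow {
  gr_start : pr r 0;
  gr_pred : forall t, pr r t.+1 -> pr r t;
  gr_step : forall t, pr r t.+1 -> key_step v (rq r t) (rs r t) (ra r t.+1) (rq r t.+1) /\
     rs r t.+1 = next_mon (rs r t) (rq r t) (ra r t.+1);
  gr_end : forall t, pr r t -> pr r t.+1 \/ full (rq r t);
  gr_pair : pr r 1 -> key_pair v (rq r 0) (rs r 0) }.

Definition infinite r : Prop := forall t, pr r t.

Definition row_step (s s' : {poly K} * set {poly K}) : Prop :=
  exists2 al, key_step v s.1 s.2 al s'.1 & s'.2 = next_mon s.2 s.1 al.

Lemma row_of_run (Good : {poly K} * set {poly K} -> Prop) (Goal : nat -> {poly K} * set {poly K} -> Prop) s0 (a0 : nat) :
  (forall k s, Good s -> full s.1 \/ exists m s',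
     [/\ reachn row_step m.+1 s s', Good s' & Goal k s \/ Goal k s']) ->
  Good s0 -> key_pair v s0.1 s0.2 -> exists r,
  [/\ good_row r, rq r 0 = s0.1, rs r 0 = s0.2, ra r 0 = a0 &
      infinite r /\ (forall k, exists2 t, (k <= t)%N & Goal k (rq r t, rs r t)) \/
      exists s t, [/\ pr r t, Good s, s.1 = rq r t & full s.1]].
Proof.
move=> H g0 k0; have fin (u : nat -> {poly K} * set {poly K}) :
    exists al : nat -> nat, (al 0%N = a0) /\ forall i, row_step (u i) (u i.+1) ->
      key_step v (u i).1 (u i).2 (al i.+1) (u i.+1).1 /\ (u i.+1).2 = next_mon (u i).2 (u i).1 (al i.+1).
  have /choice[al hal] : forall i, exists al, row_step (u i) (u i.+1) ->
      key_step v (u i).1 (u i).2 al (u i.+1).1 /\ (u i.+1).2 = next_mon (u i).2 (u i).1 al.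
    move=> i; case: (pselect (row_step (u i) (u i.+1))) => [[al h1 h2]|no]; first by exists al.
    by exists 0%N.
  by exists (fun i => if i is i'.+1 then al i' else a0).
case: (run H g0) => [[m [s' [rm gs' st]]]|[u [u0 hu hG]]].
  have [p [p0 pm hp]] := reachn_fun rm; have [al [al0 hal]] := fin p.
  exists (KRow (fun t => (t <= m)%N) (fun t => (p t).1) (fun t => (p t).2) al); split=> //=; rewrite ?p0 //.
    split=> //=; rewrite ?p0 //.
    - by move=> t /ltnW.
    - by move=> t tm; apply/hal/hp.
    - move=> t; rewrite leq_eqVlt => /orP[/eqP ->|h]; first by right; rewrite pm.
      by left.
  by right; exists s', m; rewrite pm.
have [al [al0 hal]] := fin u.
exists (KRow (fun t => true) (fun t => (u t).1) (fun t => (u t).2) al); split=> //=; rewrite ?u0 //.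
  by split=> //=; rewrite ?u0 // => t _; [exact: hal|left].
by left; split=> // k; have [t kt h] := hG k; exists t => //; rewrite -surjective_pairing.
Qed.

Section Good.
Variable r : krow.
Hypothesis gr : good_row r.

Lemma pr_le t t' : (t <= t')%N -> pr r t' -> pr r t.
Proof.
elim: t' => [|t' IH]; first by rewrite leqn0 => /eqP ->.
by rewrite leq_eqVlt => /orP[/eqP ->//|h /(gr_pred gr)]; exact: IH.
Qed.

Lemma row_pair t : pr r t.+1 -> key_pair v (rq r t) (rs r t).
Proof.
elim: t => [|t IH] h; first exact: gr_pair.
have h1 := gr_pred gr h; have [st ->] := gr_step gr h1.
exact (key_step_key (IH h1) st).
Qed.

Lemma row_dg t : pr r t.+1 -> dg (rq r t.+1) = (dg (rq r t) * ra r t.+1)%N.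
Proof. by move=> h; have [st _] := gr_step gr h; case: (key_step_shape (row_pair h) st). Qed.


Lemma row_al t : pr r t.+1 -> (0 < ra r t.+1)%N.
Proof. by move=> h; have [[]] := gr_step gr h. Qed.

Lemma row_vlt t : pr r t.+1 -> ra r t.+1 = 1%N -> vl v (rq r t) < vl v (rq r t.+1).
Proof.
move=> h e; have [st _] := gr_step gr h; have [m _ _] := key_step_shape (row_pair h) st.
by case: st => _ _ + _; rewrite e mulr1n vgtE ?monic_neq0.
Qed.

Lemma row_size t : pr r t.+1 -> ra r t.+1 = 1%N -> size (rq r t.+1) = size (rq r t).
Proof.
move=> h e; have := row_dg h; rewrite e muln1 /dg => h1.
have [st _] := gr_step gr h; have [m _ _] := key_step_shape (row_pair h) st.
have hm := kp_monic (row_pair h).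
by rewrite -(prednK (n := size (rq r t.+1))) ?size_poly_gt0 ?monic_neq0 // h1 prednK ?size_poly_gt0 ?monic_neq0.
Qed.

Lemma row_rs t : pr r t.+1 -> ra r t.+1 = 1%N -> rs r t.+1 = rs r t.
Proof. by move=> h e; have [_ ->] := gr_step gr h; rewrite e next_mon1. Qed.

(** The first inessential index of a row that is followed by another; the exponent at [t1] itself
    must already be 1. *)
Definition tail_start t1 : Prop := (forall s, ra r (t1 + s)%N = 1%N) /\
  forall t, (forall s, ra r (t + s)%N = 1%N) -> (t1 <= t)%N.
Definition tail t1 s : {poly K} := rq r (t1 + s)%N.

Hypothesis inf : infinite r.

Lemma tail_rs t1 s : (forall s, ra r (t1 + s)%N = 1%N) -> rs r (t1 + s)%N = rs r t1.
Proof.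
move=> h; elim: s => [|s IH]; first by rewrite addn0.
by rewrite addnS row_rs // -addnS.
Qed.

Lemma tail_chain t1 : (forall s, ra r (t1 + s)%N = 1%N) -> chain v (tail t1) (rs r t1).
Proof.
move=> h s; split.
- by rewrite -(tail_rs s h); apply: row_pair.
- elim: s => [|s IH] //; rewrite -IH /tail addnS; apply: row_size => //.
  by rewrite -addnS.
by rewrite /tail addnS; apply: row_vlt => //; rewrite -addnS.
Qed.

Lemma row_dg_mono t t' : (t <= t')%N -> (dg (rq r t) <= dg (rq r t'))%N.
Proof.
elim: t' => [|t' IH]; first by rewrite leqn0 => /eqP ->.
rewrite leq_eqVlt => /orP[/eqP ->//|/IH h]; apply: leq_trans h _.
by rewrite row_dg // leq_pmulr // row_al.
Qed.

Lemma row_stable (N : nat) : (forall t, (dg (rq r t) <= N)%N) ->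
  exists t1, forall s, ra r (t1 + s)%N = 1%N.
Proof.
move=> hN; have [t1 ht1] : exists t1, forall t, (t1 <= t)%N -> dg (rq r t) = dg (rq r t1).
  have ex : exists k, `[< exists t, (N - dg (rq r t) <= k)%N >].
    by exists N; apply/asboolP; exists 0%N; exact: leq_subr.
  have [k /asboolP[t1 h1] kmin] := ex_minnP ex; exists t1 => t le.
  apply/eqP; rewrite eqn_leq (row_dg_mono le) andbT.
  have /kmin h2 : `[< exists t', (N - dg (rq r t') <= N - dg (rq r t))%N >] by apply/asboolP; exists t.
  have h3 := hN t; have h4 := hN t1; lia.
(* The exponent of the first member of stable degree may still exceed 1, hence the successor. *)
exists t1.+1 => s; rewrite addSn; have := row_dg (inf (t1 + s).+1).
rewrite (ht1 (t1 + s).+1) ?(ht1 (t1 + s)%N) ?leq_addr // 1?ltnW ?ltnS ?leq_addr //.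
have := dgQ_gt0 (kp_size (row_pair (inf t1.+1))).
by move: (dg _) (ra _ _) => n m n0; rewrite -{1}(muln1 n) => /eqP; rewrite eqn_pmul2l // => /eqP <-.
Qed.

Lemma tail_start_exists f t0 : (forall t, (t0 <= t)%N -> ~ exact_at v (rq r t) f) ->
  exists t1, tail_start t1.
Proof.
move=> ex; have [|t1 h] := @row_stable (size f).
  move=> t'; apply: leq_trans (row_dg_mono (leq_maxl t' t0)) _; set t := maxn t' t0.
  rewrite leqNgt; apply/negP => h; apply: (ex t); first exact: leq_maxr.
  have kt := row_pair (inf t.+1); apply: exact_small; [exact: kp_monic kt|exact: kp_size kt|].
  by rewrite /small (sizeQ (kp_size kt)) ltnS ltnW.
have exm : exists t, `[< forall s, ra r (t + s)%N = 1%N >] by exists t1; apply/asboolP.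
have [m /asboolP hm mmin] := ex_minnP exm; exists m; split=> // t ht; apply: mmin; exact/asboolP.
Qed.
End Good.

(* A limit index is either maximal in its degree, or the values of its row are
   cofinal in those of the monic polynomials of its degree. *)
Definition top_row r : Prop := forall f, f \is monic -> size f = size (rq r 0) ->
  exists t, [/\ pr r t, size (rq r t) = size (rq r 0) & vl v f <= vl v (rq r t)].

(** The two alternatives are the bounded and the unbounded limit. In the second one the size bound
    lets the limit be expanded with the number of powers prescribed by its exponent. *)
Definition link r r' : Prop := exists t1,
  [/\ tail_start r t1, rq r' 0 \is monic, (0 < ra r' 0)%N, min_exceeds v (tail r t1) (rq r' 0) &
   [/\ bounded_chain v (tail r t1), dg (rq r' 0) = (dg (rq r t1) * ra r' 0)%N,
       key_pair v (rq r' 0) (rs r' 0) &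
       rs r' 0 = lim_mon (tail r t1) (rs r t1) (ra r' 0)] \/
   [/\ ~ bounded_chain v (tail r t1), full (rq r' 0) &
       (size (rq r' 0) <= dg (rq r t1) * (ra r' 0).+1)%N]].

(** The coefficient of [Q] in the expansion of [f] is 1, and exactness bounds the value of [f] by
    that of this term. *)
Lemma full_top Q f : Q \is monic -> (1 < size Q)%N -> full Q -> f \is monic -> size f = size Q ->
  vl v f <= vl v Q.
Proof.
move=> Qm Q1 fQ fm sf; have := fQ f _ (vge_vl v f) 1%N.
have dF : dg f = (dg Q * 1)%N by rewrite muln1 /dg sf.
by have [_ ->] := monic_top Qm Q1 fm dF; rewrite mul1r expr1 vgeE ?monic_neq0.
Qed.

Lemma natural_row Q S (a0 : nat) : key_pair v Q S -> exists r,
  [/\ good_row r, rq r 0 = Q, rs r 0 = S & ra r 0 = a0].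
Proof.
move=> kQ; have [] := @row_of_run (fun s => key_pair v s.1 s.2) (fun _ _ => True) (Q, S) a0 _ kQ kQ.
  move=> _ s ks; case: (pselect (full s.1)) => [|nf]; first by left.
  right; have [al [Q' st]] := key_step_exists ks nf.
  exists 0%N, (Q', next_mon s.2 s.1 al); split; [|exact: key_step_key st|by left].
  by exists (Q', next_mon s.2 s.1 al) => //; exists al.
by move=> r [h1 h2 h3 h4 _]; exists r.
Qed.

Lemma reach_stp S m Q Q' : reachn (degree_step v S) m Q Q' -> reachn row_step m (Q, S) (Q', S).
Proof.
elim: m Q => [|m IH] Q /=; first by move=> ->.
by case=> Q1 st /IH h; exists (Q1, S) => //; exists 1%N; rewrite //= next_mon1.
Qed.

Lemma reach_pair S m Q Q' : reachn (degree_step v S) m Q Q' -> key_pair v Q S -> key_pair v Q' S.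
Proof.
elim: m Q => [|m IH] Q /=; first by move=> ->.
by case=> Q1 st h kQ; have := key_step_key kQ st; rewrite next_mon1; exact: IH.
Qed.

Lemma reach_strong S m Q Q' : reachn (degree_step v S) m Q Q' -> key_pair v Q S -> strong_pair v Q S ->
  strong_pair v Q' S.
Proof.
elim: m Q => [|m IH] Q /=; first by move=> ->.
case=> Q1 st h kQ sQ; have := key_step_key kQ st; have := key_step_strong kQ sQ st.
by rewrite next_mon1 => h1 h2; exact: IH h h2 h1.
Qed.
End Rows.

(** * Construction of the tower of rows *)

Section Tower.
Variables (K : fieldType) (G : ordAbGroupType).
Variable v : valuation {fraction {poly K}} G.
Implicit Types (Q F f h a b B M N : {poly K}) (g : G) (S : set {poly K}).
Hypothesis arch : archi v.
Hypothesis nt : exists2 g, G0 v g & 0 < g.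

Lemma smallX (f : {poly K}) : small 'X f -> f = (f`_0)%:P.
Proof. by rewrite /small size_polyX ltnS => /size1_polyC. Qed.

Lemma key_pairX : key_pair v 'X [set 1] /\ strong_pair v 'X [set 1].
Proof.
have X1 : (1 < size ('X : {poly K}))%N by rewrite size_polyX.
have ex f : f != 0 -> small 'X f -> exists c : K, [/\ c != 0, f = c%:P & f = ev [:: (c, 1)]].
  move=> f0 /smallX e; exists f`_0; rewrite -e; split=> //.
    by apply: contraNneq f0 => h; rewrite e h.
  by rewrite /ev big_seq1 /trm /= {1}e -mul_polyC mulr1.
have exS (c : K) : c != 0 -> expansion [set 1] [:: (c, 1)].
  by move=> c0; split=> // p; rewrite inE => /eqP ->.
split; last first.
  move=> f f0 sf; have [c [c0 _ e]] := ex f f0 sf; exists [:: (c, 1)]; split=> //; first exact: exS.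
  move=> P g; rewrite big_cons big_nil => h p; rewrite inE => /eqP -> Pp.
  by move: h; rewrite Pp addr0.
split=> //.
- exact: monicX.
- move=> a b g /smallX -> /smallX ->; rewrite -polyCM => h.
  have sm : (size ((a`_0 * b`_0)%:P : {poly K}) < size ('X : {poly K}))%N.
    by rewrite size_polyX; apply: leq_ltn_trans (size_polyC_leq1 _) _.
  by rewrite modp_small // divp_small // mul0r vgt0.
- by move=> M -> ; rewrite /small size_poly1 oner_neq0.
- exists 1%N => // f f0 sf; have [c [c0 -> _]] := ex f f0 sf.
  by rewrite mulr1n; apply/G0P; exists c.
- exists 1%N => f f0 sf; have [c [c0 _ e]] := ex f f0 sf; exists [:: (c, 1)]; split=> //; first exact: exS.
  by split=> // p; rewrite inE => /eqP ->; rewrite e /ev big_seq1 vge_vl.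
exists [:: 1]; first by move=> M; rewrite inE => /eqP ->.
move=> f f0 sf; have [c [c0 -> _]] := ex f f0 sf; exists 1; rewrite ?mem_head //.
by exists c; rewrite // -mul_polyC mulr1.
Qed.

Definition cofinal_row (r : krow K) : Prop := forall t1,
  (forall t, (t1 <= t)%N -> size (rq r t) = size (rq r t1)) ->
  forall f, f \is monic -> size f = size (rq r t1) ->
    exists2 t, (t1 <= t)%N & vl v f <= vl v (rq r t).

(** The [k]-th goal is to pass the [k]-th element of the cofinal sequence of the current degree,
    which is not known in advance. Once the degree is stable, all goals refer to the same
    sequence. *)
Lemma first_row : exists r, [/\ good_row v r, rq r 0 = 'X, rs r 0 = [set 1], ra r 0 = 1%N &
  infinite r -> cofinal_row r].
Proof.
have [kX sX] := key_pairX.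
have /choice[w hw] : forall n, exists w, (exists F S, key_pair v F S /\ size F = n) -> cofinal_seq v n w.
  move=> n; case: (pselect (exists F S, key_pair v F S /\ size F = n)) => [[F [S [kF <-]]]|no].
    by have [w hw] := cofinal_exists arch nt kF; exists w.
  by exists (fun _ => 0) => h; case: no.
pose Goal k (s : {poly K} * set {poly K}) := vl v (w (size s.1) k) <= vl v s.1.
have [] := @row_of_run K G v (fun s => key_pair v s.1 s.2 /\ strong_pair v s.1 s.2) Goal ('X, [set 1]) 1%N.
- move=> k [Q S] [/= kQ sQ]; case: (pselect (full v Q)) => [|nf]; first by left.
  right; have [wm _ _] := hw (size Q) (ex_intro _ Q (ex_intro _ S (conj kQ erefl))).
  have [h|h] := boolP (vl v (w (size Q) k) <= vl v Q).
    have [al [Q' st]] := key_step_exists kQ nf.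
    exists 0%N, (Q', next_mon S Q al); split; last by left.
      by exists (Q', next_mon S Q al) => //; exists al.
    by split; [exact: key_step_key kQ al Q' st|exact: key_step_strong kQ al Q' sQ st].
  rewrite -gltNge in h; have [wkm wks] := wm k.
  have [|m [Q' [rQ hQ sQ']]] := strong_reach kQ sQ wkm wks; first by rewrite vgtE ?monic_neq0.
  exists m, (Q', S); split.
  + exact: reach_stp rQ.
  + by split; [exact: reach_pair rQ kQ|exact: reach_strong rQ kQ sQ].
  by right; rewrite /Goal /= sQ'.
- by split.
- by [].
move=> r [gr r0 rs0 ra0 hG]; exists r; split=> // inf t1 st1 f fm sf.
have [_ wmono wcof] := hw (size (rq r t1)) (ex_intro _ _ (ex_intro _ _ (conj (row_pair gr (inf t1.+1)) erefl))).
have [k hk] := wcof f fm sf.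
case: hG => [[_ hG]|[s [t [_ _ e fs]]]]; last first.
  (* A full member cannot have a successor: the leading coefficient of the latter would force its
     value down to [ra r t.+1] times that of the former. *)
  rewrite e in fs.
  have [st _] := gr_step gr (inf t.+1); have kt := row_pair gr (inf t.+1).
  have [Qm' dQ' _] := key_step_shape kt st; case: st => _ _ h1 _.
  have /(_ _ (vge_vl v _)) h := fs (rq r t.+1).
  have [_ top] := monic_top (kp_monic kt) (kp_size kt) Qm' dQ'.
  have := h (ra r t.+1); rewrite top mul1r vgeE ?expf_neq0 ?(monic_neq0 (kp_monic kt)) // vlX ?(monic_neq0 (kp_monic kt)) //.
  by move: h1; rewrite vgtE ?monic_neq0 // gltNge => /negPf ->.
have [t kt ht] := hG (maxn k t1); have lt1 := leq_trans (leq_maxr k t1) kt; exists t => //.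
rewrite /Goal /= st1 // in ht.
apply: le_trans hk (le_trans _ ht); apply: wmono; exact: leq_maxl.
Qed.

Lemma alarm_row F S R Q (a0 : nat) : key_pair v F S -> no_max v (size F) -> classes v F S R ->
  alarm v F R Q -> key_pair v Q S -> size Q = size F ->
  exists r, [/\ good_row v r, rq r 0 = Q, rs r 0 = S, ra r 0 = a0 & top_row v r].
Proof.
move=> kF nm hR aQ kQ sQ; have [w [wm wmono wcof]] := cofinal_exists arch nt kF.
pose Good (s : {poly K} * set {poly K}) :=
  [/\ s.2 = S, key_pair v s.1 S, alarm v F R s.1 & size s.1 = size F].
pose Goal k (s : {poly K} * set {poly K}) := size s.1 = size F /\ vl v (w k) <= vl v s.1.
have [] := @row_of_run K G v Good Goal (Q, S) a0.
- move=> k [Q1 S1] [/= -> k1 a1 s1]; right; have [wkm wks] := wm k.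
  have [m [Q' [rQ aQ' hQ sQ']]] := alarm_step arch kF hR nm a1 wkm wks.
  exists m, (Q', S); split; [exact: reach_stp rQ| |by right].
  by split=> //=; exact: reach_pair rQ k1.
- by split.
- by [].
move=> r [gr r0 rs0 ra0 hG]; exists r; split=> // f fm; rewrite r0 /= sQ => sf.
have [k hk] := wcof f fm sf.
case: hG => [[inf hG]|[s [t [pt [_ ks _ ss] e fs]]]].
  by have [t kt [h1 h2]] := hG k; exists t; split=> //; exact: le_trans h2.
exists t; rewrite -e; split=> //; apply: full_top => //; first exact: kp_monic ks.
  exact: kp_size ks.
by rewrite ss.
Qed.

Lemma exact_scale Q (k : K) f : k != 0 -> exact_at v Q (k *: f) -> exact_at v Q f.
Proof.
move=> k0 ex g hg j.
have kP : (k%:P : {poly K}) != 0 by rewrite polyC_eq0.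
have /ex/(_ j) : vge v (vl v (k%:P : {poly K}) + g) (k *: f) by rewrite -mul_polyC vge_mull.
have -> : qc Q (k *: f) j = k%:P * qc Q f j by rewrite /qc divpZl modpZl mul_polyC.
by rewrite -mulrA vge_mull.
Qed.

Lemma min_exceeds_exists c f : exceeds v c f -> exists F, min_exceeds v c F.
Proof.
move=> ex; have exm : exists n, `[< exists F, exceeds v c F /\ size F = n >].
  by exists (size f); apply/asboolP; exists f.
have [n /asboolP[F [eF sF]] nmin] := ex_minnP exm; exists F; split=> // h eh.
by rewrite sF; apply: nmin; apply/asboolP; exists h.
Qed.

Lemma min_exceeds_monic c F S : chain v c S -> min_exceeds v c F ->
  exists F', [/\ F' \is monic, size F' = size F & min_exceeds v c F'].
Proof.
move=> hc [eF mF]; have F0 : F != 0.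
  by have /exactN[] := eF 0%N; [exact: (chain_monic hc)|exact: (chain_size_gt1 hc)|].
have l0 : lead_coef F != 0 by rewrite lead_coef_eq0.
exists ((lead_coef F)^-1 *: F); rewrite size_scale ?invr_eq0 //; split=> //.
  by rewrite monicE lead_coefZ mulVf.
split; last by move=> f ef; rewrite size_scale ?invr_eq0 //; exact: mF.
by move=> t et; apply: (eF t); apply: (exact_scale _ et); rewrite invr_eq0.
Qed.

(** An unbounded limit is full, hence a row by itself. A bounded one is replaced, thanks to
    [limit_same_size], by a polynomial of maximal value in its degree if there is one, and by one
    with pending terms otherwise. *)
Lemma next_row r f t0 : good_row v r -> infinite r ->
  (forall t, (t0 <= t)%N -> ~ exact_at v (rq r t) f) ->
  exists r', [/\ good_row v r', link v r r' & top_row v r'].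
Proof.
move=> gr inf ex; have [t1 ts] := tail_start_exists gr inf ex; have [ht1 _] := ts.
pose c := tail r t1; pose S := rs r t1; have hc : chain v c S by exact: tail_chain.
have [F0 mF0] : exists F, min_exceeds v c F.
  apply: (@min_exceeds_exists c f); apply: (exceeds_from hc (n := t0)) => t le; apply: ex.
  exact: leq_trans le (leq_addl _ _).
have c0E : c 0%N = rq r t1 by rewrite /c /tail addn0.
case: (pselect (bounded_chain v c)) => [bc|nb]; last first.
  have [F [Fm sF mF]] := min_exceeds_monic hc mF0.
  have fF := unbounded_exact hc Fm mF nb.
  have F1 : (1 < size F)%N.
    by apply: leq_ltn_trans (exceeds_size hc mF.1); exact: dgQ_gt0 (chain_size_gt1 hc 0).
  (* The exponent of an unbounded limit only has to be large enough for the length of its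
     expansions; [size F] is. *)
  exists (KRow (fun t => t == 0%N) (fun _ => F) (fun _ => set0) (fun _ => size F)); split.
  - by split=> //= t /eqP ->; right.
  - exists t1; split=> //=; first by rewrite ltnW.
    right; split=> //; rewrite -c0E; apply: leq_trans (leqnSn _) _.
    by rewrite leq_pmull // (dgQ_gt0 (chain_size_gt1 hc 0)).
  move=> h hm sh; exists 0%N; split=> //=; exact: full_top.
have [s [F [s0 Fm dF sF eF]]] := limit_monic arch hc bc mF0.
have mF : min_exceeds v c F.
  by split=> // h; rewrite sF; exact: mF0.2.
have kF := limit_key_pair arch hc bc Fm dF mF.
have lk r' : rq r' 0 \is monic -> size (rq r' 0) = size F -> vl v F <= vl v (rq r' 0) ->
    rs r' 0 = lim_mon c S s -> ra r' 0 = s -> link v r r'.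
  move=> Qm sQ hQ eS es; exists t1.
  have mQ : min_exceeds v c (rq r' 0).
    by apply: (limit_same_size hc Fm mF) => //; rewrite vgeE ?monic_neq0.
  have dQ : dg (rq r' 0) = (dg (c 0%N) * s)%N by rewrite -dF /dg sQ.
  rewrite es eS; split=> //; left; split=> //; first by rewrite -c0E.
  exact: (limit_key_pair arch hc bc Qm dQ mQ).
have kQ Q : Q \is monic -> size Q = size F -> vl v F <= vl v Q -> key_pair v Q (lim_mon c S s).
  move=> Qm sQ hQ; apply: (limit_key_pair arch hc bc) => //; first by rewrite -dF /dg sQ.
  by apply: (limit_same_size hc Fm mF) => //; rewrite vgeE ?monic_neq0.
case: (pselect (no_max v (size F))) => [nm|no].
  have [R hR] := classes_exist kF.
  have [Q [aQ Qm sQ hQ]] := alarm_start arch kF hR nm Fm erefl.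
  have [r' [gr' r0 rs0 ra0 tr]] := alarm_row s kF nm hR aQ (kQ Q Qm sQ hQ) sQ.
  by exists r'; split=> //; apply: lk; rewrite ?r0.
have [h hm [sh hh]] : exists2 h, h \is monic & size h = size F /\
    forall f', f' \is monic -> size f' = size F -> vl v f' <= vl v h.
  apply: contrapT => nf; apply: no => h hm sh; apply: contrapT => nf'; apply: nf.
  exists h => //; split=> // f' fm' sf'; rewrite gleNgt; apply/negP => lt.
  by apply: nf'; exists f'.
have [r' [gr' r0 rs0 ra0]] := natural_row s (kQ h hm sh (hh F Fm erefl)).
exists r'; split=> //; first by apply: lk; rewrite ?r0 //; exact: hh.
move=> f' fm' sf'; exists 0%N; split=> //; first exact: gr_start gr'.
by rewrite r0 in sf' *; rewrite sh in sf'; exact: hh.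
Qed.

Definition row_at (P : nat -> nat -> bool) (Q : nat -> nat -> {poly K})
  (S : nat -> nat -> set {poly K}) (A : nat -> nat -> nat) (a : nat) : krow K := KRow (P a) (Q a) (S a) (A a).

Record tower (P : nat -> nat -> bool) (Q : nat -> nat -> {poly K})
    (S : nat -> nat -> set {poly K}) (A : nat -> nat -> nat) : Prop := Tower {
  tw_row : forall a : nat, P a 0%N -> good_row v (row_at P Q S A a);
  tw_pred : forall a t : nat, P a t -> P a 0%N;
  tw_start : [/\ P 0%N 0%N, Q 0%N 0%N = 'X, S 0%N 0%N = [set 1] & A 0%N 0%N = 1%N];
  tw_link : forall a : nat, P a.+1 0%N -> [/\ forall t, P a t,
     link v (row_at P Q S A a) (row_at P Q S A a.+1) & top_row v (row_at P Q S A a.+1)];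
  tw_next : forall (a : nat) f t0, (forall t, P a t) ->
     (forall t, (t0 <= t)%N -> ~ exact_at v (Q a t) f) -> P a.+1 0%N;
  tw_cofinal : (forall t, P 0%N t) -> cofinal_row (row_at P Q S A 0) }.

Theorem tower_exists : exists (P : nat -> nat -> bool) (Q : nat -> nat -> {poly K})
  (S : nat -> nat -> set {poly K}) (A : nat -> nat -> nat), tower P Q S A.
Proof.
have [r0 [gr0 r00 rs0 ra0 cr0]] := first_row.
pose ok r := infinite r /\ exists f t0, forall t, (t0 <= t)%N -> ~ exact_at v (rq r t) f.
have /choice[nx hnx] : forall r, exists r', good_row v r -> ok r ->
    [/\ good_row v r', link v r r' & top_row v r'].
  move=> r; case: (pselect (good_row v r /\ ok r)) => [[gr [inf [f [t0 ex]]]]|no].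
    by have [r' h] := next_row gr inf ex; exists r'.
  by exists r => gr o; case: no.
pose fix rw (a : nat) : krow K * bool := if a is a'.+1 then
  (nx (rw a').1, (rw a').2 && `[< ok (rw a').1 >]) else (r0, true).
have grw (a : nat) : (rw a).2 -> good_row v (rw a).1.
  elim: a => [|a IH] //= /andP[ra /asboolP o]; by have [] := hnx _ (IH ra) o.
pose P (a t : nat) := (rw a).2 && pr (rw a).1 t.
pose Q (a : nat) := rq (rw a).1; pose S (a : nat) := rs (rw a).1; pose A (a : nat) := ra (rw a).1.
have eP (a : nat) : (rw a).2 -> row_at P Q S A a = (rw a).1.
  by move=> ra; rewrite /row_at /P ra /Q /S /A /=; case: (rw a).1.
have P0 (a : nat) : P a 0%N -> (rw a).2 by case/andP.
exists P, Q, S, A; split.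
- by move=> a /P0 ra; rewrite eP //; exact: grw.
- by move=> a t /andP[ra _]; rewrite /P ra (gr_start (grw a ra)).
- by rewrite /P /Q /S /A /= r00 rs0 ra0 (gr_start gr0).
- move=> a /P0 ra1; have := ra1 => /= /andP[ra /asboolP o]; have [inf _] := o.
  have [h1 h2 h3] := hnx _ (grw a ra) o.
  by rewrite !eP //; split=> // t; rewrite /P ra inf.
- move=> a f t0 inf ex; have ra : (rw a).2 := P0 a (inf 0%N).
  have o : ok (rw a).1 by split; [move=> t; have /andP[] := inf t|exists f, t0].
  have ra1 : (rw a.+1).2 by rewrite /= ra; exact/asboolP.
  by rewrite /P ra1 (gr_start (grw _ ra1)).
by move=> inf; rewrite eP //; apply: cr0 => t; have := inf t; rewrite /P => /andP[].
Qed.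
End Tower.

(** * Degrees, completeness and cofinality in a tower *)

Section TowerTheory.
Variables (K : fieldType) (G : ordAbGroupType).
Variable v : valuation {fraction {poly K}} G.
Implicit Types (F f h : {poly K}) (a t s n : nat).
Hypothesis arch : archi v.
Variables (P : nat -> nat -> bool) (Q : nat -> nat -> {poly K})
  (S : nat -> nat -> set {poly K}) (A : nat -> nat -> nat).
Hypothesis tw : tower v P Q S A.

Let gr a (h : P a 0%N) := tw_row tw h.

Lemma tw_le a t t' : (t <= t')%N -> P a t' -> P a t.
Proof. by move=> le h; exact: (pr_le (gr (tw_pred tw h)) le h). Qed.
Lemma tw_inf a t : P a.+1 t -> forall s, P a s.
Proof. by move=> /(tw_pred tw)/(tw_link tw)[]. Qed.
Lemma tw_inf_lt a a' t : (a < a')%N -> P a' t -> forall s, P a s.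
Proof.
elim: a' t => // a' IH t; rewrite ltnS leq_eqVlt => /orP[/eqP -> /tw_inf //|lt /tw_inf h].
exact: (IH 0%N).
Qed.
Lemma tw_pair a t : P a t.+1 -> key_pair v (Q a t) (S a t).
Proof. by move=> h; exact: (row_pair (gr (tw_pred tw h)) h). Qed.
Lemma tw_step a t : P a t.+1 -> key_step v (Q a t) (S a t) (A a t.+1) (Q a t.+1) /\
  S a t.+1 = next_mon (S a t) (Q a t) (A a t.+1).
Proof. by move=> h; exact: (gr_step (gr (tw_pred tw h)) h). Qed.
Lemma tw_dg a t : P a t.+1 -> dg (Q a t.+1) = (dg (Q a t) * A a t.+1)%N.
Proof. by move=> h; exact: (row_dg (gr (tw_pred tw h)) h). Qed.
Lemma tw_al a t : P a t -> (0 < A a t)%N.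
Proof.
case: t => [|t] h; last exact: (row_al (gr (tw_pred tw h)) h).
case: a h => [|a] h; first by have [_ _ _ ->] := tw_start tw.
by have [_ [t1 []] _] := tw_link tw h.
Qed.
Lemma tw_monic a t : P a t -> Q a t \is monic.
Proof.
case: t => [|t] h; last by have [st _] := tw_step h; case: (key_step_shape (tw_pair h) st).
case: a h => [|a] h; first by have [_ -> _ _] := tw_start tw; exact: monicX.
by have [_ [t1 []] _] := tw_link tw h.
Qed.
Lemma tw_tail a t1 : (forall t, P a t) -> (forall s, A a (t1 + s)%N = 1%N) ->
  chain v (tail (row_at P Q S A a) t1) (S a t1).
Proof. by move=> inf h; exact: (tail_chain (gr (inf 0%N)) inf h). Qed.
Lemma tw_size a t : P a t -> (1 < size (Q a t))%N.
Proof.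
case: t => [|t] h; last by have [st _] := tw_step h; case: (key_step_key (tw_pair h) st).
case: a h => [|a] h; first by have [_ -> _ _] := tw_start tw; rewrite size_polyX.
have [inf [t1 [[ht1 _] _ _ mF _]] _] := tw_link tw h.
have hc := tw_tail inf ht1.
by apply: leq_ltn_trans (exceeds_size hc mF.1); exact: dgQ_gt0 (chain_size_gt1 hc 0).
Qed.
Lemma tw_sizeE a t : P a t -> size (Q a t) = (dg (Q a t)).+1.
Proof. by move=> h; rewrite (sizeQ (tw_size h)). Qed.

Lemma tw_dg_row a t t' : (t <= t')%N -> P a t' -> (dg (Q a t) <= dg (Q a t'))%N.
Proof.
elim: t' => [|t' IH]; first by rewrite leqn0 => /eqP ->.
rewrite leq_eqVlt => /orP[/eqP ->//|le h]; apply: leq_trans (IH le (tw_le (leqnSn _) h)) _.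
by rewrite (tw_dg h) leq_pmulr // tw_al.
Qed.
Lemma tw_dg_next a t : P a.+1 0%N -> (dg (Q a t) <= dg (Q a.+1 0))%N.
Proof.
move=> h; have [inf [t1 [[ht1 _] Fm _ mF _]] _] := tw_link tw h.
have hc := tw_tail inf ht1; have := exceeds_size hc mF.1.
rewrite /= (tw_sizeE h) ltnS /tail /= addn0; apply: leq_trans.
have [le|/ltnW le] := leqP t t1; first exact: tw_dg_row.
have := chain_dg hc (t - t1) 0; rewrite /tail /= subnKC // addn0 => ->.
exact: leqnn.
Qed.
Lemma tw_dg_mono a t a' t' : (a < a')%N || (a == a') && (t <= t')%N -> P a' t' ->
  (dg (Q a t) <= dg (Q a' t'))%N.
Proof.
move=> + h; case/orP=> [lt|/andP[/eqP -> le]]; last exact: tw_dg_row.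
elim: a' t' lt h => // a' IH t' lt h.
apply: leq_trans (tw_dg_row (leq0n t') h); have h0 := tw_pred tw h.
move: lt; rewrite ltnS leq_eqVlt => /orP[/eqP ->|lt]; first exact: tw_dg_next.
by apply: leq_trans (tw_dg_next 0 h0); apply: IH => //; exact: (tw_inf h).
Qed.

Lemma exact_same_size F f : F \is monic -> (1 < size F)%N -> f \is monic -> size f = size F ->
  vl v f <= vl v F -> exact_at v F f.
Proof.
move=> Fm F1 fm sf le g; rewrite vgeE ?monic_neq0 // => hg.
rewrite -[f](subrK F); apply: tgeD.
  apply: tge_small => //; first exact: same_size_small.
  by apply: vgeB; rewrite vgeE ?monic_neq0 // (le_trans hg).
apply: (tge_le (le_trans hg le)).
by have := tge_X v Fm F1 1; rewrite mulr1n expr1.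
Qed.

(** If the degree were the same, the whole row in between would stay in it, and as a [top_row] it
    would have a member of value at least that of the next limit, which would be exact there. The
    first row is not a [top_row], whence the shift of the indices. *)
Lemma tw_size_grows a : P a.+2 0%N -> (dg (Q a.+1 0) < dg (Q a.+2 0))%N.
Proof.
move=> h2; have h1 : P a.+1 0%N by exact: (tw_inf h2).
rewrite ltnNge; apply/negP => le.
have [_ _ top] := tw_link tw h1; have [inf [t1 [[ht1 _] Fm _ [eF _] _]] _] := tw_link tw h2.
have same t : dg (Q a.+1 t) = dg (Q a.+2 0).
  apply/eqP; rewrite eqn_leq (tw_dg_next _ h2) (leq_trans le) //.
  by apply: tw_dg_mono => //; rewrite eqxx leq0n orbT.
have sz t : size (Q a.+1 t) = size (Q a.+2 0) by rewrite !tw_sizeE ?same.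
have al1 t : A a.+1 t.+1 = 1%N.
  have := tw_dg (inf t.+1); rewrite !same.
  have := dgQ_gt0 (tw_size h2); move: (dg _) (A _ _) => n m n0.
  by rewrite -{1}(muln1 n) => /eqP; rewrite eqn_pmul2l // => /eqP <-.
have vlm t s : vl v (Q a.+1 t) <= vl v (Q a.+1 (t + s)%N).
  elim: s => [|s IH]; first by rewrite addn0 lexx.
  apply: le_trans IH _; rewrite addnS; apply: ltW.
  by apply: (row_vlt (gr h1)) => //=; exact: inf.
have [t [_ _ ht]] := top _ Fm (esym (sz 0%N)).
apply: (eF t); apply: exact_same_size => //=.
- exact: tw_monic.
- exact: tw_size.
by apply: le_trans ht _; rewrite /= addnC; exact: vlm.
Qed.

Lemma tw_dg_lb a : P a.+1 0%N -> (a < dg (Q a.+1 0))%N.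
Proof.
elim: a => [|a IH] h; first exact: dgQ_gt0 (tw_size h).
by apply: leq_ltn_trans (IH (tw_inf h 0%N)) (tw_size_grows h).
Qed.

(** If [f] were exact nowhere, no row could end and a next row would always exist; but the degrees
    of their starts grow, and [f] is exact wherever its degree is smaller. *)
Theorem tw_complete f : exists a t, P a t /\ exact_at v (Q a t) f.
Proof.
apply: contrapT => no; have ex a t : P a t -> ~ exact_at v (Q a t) f.
  by move=> h e; apply: no; exists a, t.
have inf a : P a 0%N -> forall t, P a t.
  move=> h; elim=> // t IH; case: (gr_end (gr h) IH) => // fu.
  by case: (ex a t IH); exact: fu.
have all a : P a 0%N.
  elim: a => [|a IH]; first by have [] := tw_start tw.
  by apply: (tw_next tw (t0 := 0%N) (inf a IH)) => t _; apply: ex; exact: inf.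
have h := all (size f).+1; apply: (ex _ _ h); apply: exact_small; [exact: tw_monic|exact: tw_size|].
by rewrite /small tw_sizeE // ltnS ltnW // tw_dg_lb.
Qed.

(** Degrees being monotone, some row [a] is eventually of degree [n]. If its values stay below that
    of [f], then [f] is inexact along it, so the next row starts in degree [n] too, and being a
    [top_row] it passes the value of [f]. *)
Theorem tw_cofinal_degree n : (forall m, exists a t, [/\ P a t, dg (Q a t) = n & (m <= a + t)%N]) ->
  forall f, f \is monic -> dg f = n -> exists a t, [/\ P a t, dg (Q a t) = n & vl v f <= vl v (Q a t)].
Proof.
move=> unb f fm df; apply: contrapT => no.
have [a ha] : exists a, forall m, exists2 t, (m <= t)%N & P a t /\ dg (Q a t) = n.
  apply: contrapT => /forallNP nf.
  have /choice[b hb] a : exists b, forall t, P a t -> dg (Q a t) = n -> (t < b)%N.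
    apply: contrapT => /forallNP nb; apply: (nf a) => m.
    have /existsNP[t /not_implyP[h1 /not_implyP[h2 h3]]] := nb m.
    by exists t => //; rewrite leqNgt; apply/negP.
  have big a0 : exists a t, [/\ (a0 < a)%N, P a t & dg (Q a t) = n].
    have [a [t [h1 h2 h3]]] := unb (a0 + \sum_(i < a0.+1) b i)%N.
    exists a, t; split=> //; rewrite ltnNge; apply/negP => le.
    have lt := hb a t h1 h2; have : (b a <= \sum_(i < a0.+1) b i)%N.
      have la : (a < a0.+1)%N by [].
      by rewrite (bigD1 (Ordinal la)) //= leq_addr.
    lia.
  have [a [t [_ h1 h2]]] := big 0%N; have [a' [t' [h3 h4 h5]]] := big a.
  apply: (nf a) => m; exists (maxn m t); first exact: leq_maxl.
  have hp := tw_inf_lt h3 h4 (maxn m t); split=> //; apply/eqP; rewrite eqn_leq; apply/andP; split.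
    by rewrite -h5; apply: tw_dg_mono => //; rewrite h3.
  by rewrite -h2; apply: tw_dg_mono => //; rewrite eqxx leq_maxr orbT.
have inf t : P a t by have [t' le [h _]] := ha t; exact: tw_le h.
have [t0 _ [_ d0]] := ha 0%N.
have st t : (t0 <= t)%N -> dg (Q a t) = n.
  move=> le; have [t' le' [h d']] := ha t; apply/eqP; rewrite eqn_leq; apply/andP; split.
    by rewrite -d'; apply: tw_dg_row.
  by rewrite -d0; apply: tw_dg_row.
have ft t : (t0 <= t)%N -> vl v (Q a t) < vl v f.
  by move=> le; rewrite gltNge; apply/negP => h; apply: no; exists a, t; split=> //; exact: st.
have ex t : (t0 <= t)%N -> ~ exact_at v (Q a t) f.
  move=> le e; have := e _ (vge_vl v f) 1%N.
  have dF : dg f = (dg (Q a t) * 1)%N by rewrite muln1 st.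
  have [_ ->] := monic_top (tw_monic (inf t)) (tw_size (inf t)) fm dF.
  rewrite mul1r expr1 vgeE ?monic_neq0 ?tw_monic // => h.
  by have := ft t le; rewrite gltNge h.
have h1 := tw_next tw inf ex.
have [_ [t1 [[ht1 _] Fm _ mF _]] top] := tw_link tw h1.
have d1 : dg (Q a.+1 0) = n.
  apply/eqP; rewrite eqn_leq; apply/andP; split; last by rewrite -d0; exact: tw_dg_next.
  have : (size (Q a.+1 0) <= size f)%N.
    apply: mF.2; apply: (exceeds_from (tw_tail inf ht1) (n := t0)) => t le; apply: ex.
    exact: leq_trans le (leq_addl _ _).
  by rewrite tw_sizeE // -df /dg; move: (size f) => m; lia.
have [|t [/= pt ts tv]] := top f fm.
  rewrite /= tw_sizeE // d1 -df /dg prednK // size_poly_gt0; exact: monic_neq0.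
apply: no; exists a.+1, t; split=> //; rewrite -d1 /dg; exact: (congr1 predn ts).
Qed.

(** A successor has leading coefficient 1 and value larger than that of its leading term, so it is
    inexact at its predecessor, which is then not full. A further row would need this one to be
    infinite. *)
Lemma tw_unbounded_last a : P a.+1 0%N -> full v (Q a.+1 0) -> ~~ P a.+1 1%N /\ ~~ P a.+2 0%N.
Proof.
move=> h fu; have nf : ~~ P a.+1 1%N.
  apply/negP => h1; have [st _] := tw_step h1; have kt := tw_pair h1.
  have [Qm' dQ' _] := key_step_shape kt st; case: st => _ _ hl _.
  have Q0 := monic_n0 (kp_monic kt); have hfu := fu _ _ (vge_vl v (Q a.+1 1)).
  have [_ top] := monic_top (kp_monic kt) (kp_size kt) Qm' dQ'.
  have := hfu (A a.+1 1%N); rewrite top mul1r vgeE ?expf_neq0 // vlX //.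
  by move: hl; rewrite vgtE ?monic_neq0 // gltNge => /negPf ->.
by split=> //; apply: contra nf => /tw_inf; apply.
Qed.

Hypothesis un : units_nat v.

Theorem char0_rows : P 1 0%N -> [/\ ~~ P 1 1%N, ~~ P 2 0%N & forall x, G0 v x -> x < vl v (Q 1 0)].
Proof.
move=> h; have [inf [t1 [[ht1 _] Fm s0 mF hb]] _] := tw_link tw h.
have hc := tw_tail inf ht1; have cof := tw_cofinal tw inf.
case: hb => [[bc dF _ _]|[nb fu _]]; last first.
  have [h1 h2] := tw_unbounded_last h fu; split=> // x hx.
  by apply: (unbounded_value hc mF.1 nb); exact: hullG0.
exfalso; have dF' : dg (Q 1 0) = (dg (tail (row_at P Q S A 0) t1 0) * A 1 0)%N.
  by rewrite dF /tail addn0.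
apply: (char0_no_bounded_limit un arch hc bc Fm dF' mF) => f fm sf.
have sz t : (t1 <= t)%N -> size (Q 0 t) = size (Q 0 t1).
  move=> le; have := chain_size hc (t - t1) 0; by rewrite /tail /= subnKC // addn0.
have [|t le ht] := cof t1 sz f fm; first by rewrite sf /tail addn0.
by exists (t - t1)%N; rewrite /tail /= subnKC.
Qed.
End TowerTheory.

(** * Minimal relations in the graded algebra *)


Lemma monic_tail (R : comNzRingType) n (x : nat -> R) (p := 'X^n + \sum_(j < n) (x j)%:P * 'X^j) :
  [/\ p \is monic, size p = n.+1, forall j, p`_j = (j == n)%:R + (if (j < n)%N then x j else 0) &
      forall t, p.[t] = t ^+ n + \sum_(j < n) x j * t ^+ j].
Proof.
rewrite /p; set W := \sum_(j < n) _; have eW : W = \poly_(j < n) x j.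
  by rewrite poly_def; apply: eq_bigr => j _; rewrite mul_polyC.
have sW : (size W < size ('X^n : {poly R}))%N by rewrite eW size_polyXn ltnS size_poly.
split; first by rewrite monicE lead_coefDl // lead_coefXn.
- by rewrite size_polyDl // size_polyXn.
- by move=> j; rewrite coefD coefXn eW coef_poly.
move=> t; rewrite hornerD hornerXn /W horner_sum; congr (_ + _).
by apply: eq_bigr => j _; rewrite hornerM hornerXn hornerC.
Qed.

Lemma minimal_relation_eq (R : comNzRingType) (B : set R) (t : R) n (x y : nat -> R) :
  (forall j, (j < n)%N -> x j = y j) ->
  minimal_relation B t ('X^n + \sum_(j < n) (x j)%:P * 'X^j) ->
  minimal_relation B t ('X^n + \sum_(j < n) (y j)%:P * 'X^j).
Proof. by move=> h; rewrite (eq_bigr (fun j : 'I_n => (y j)%:P * 'X^j)) // => j _; rewrite h. Qed.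

Lemma horner_scaled0 (R : comNzRingType) (p : {poly R}) (t H : R) n : (size p <= n)%N -> p.[t] = 0 ->
  \sum_(j < n) (H * p`_j) * t ^+ j = 0.
Proof.
move=> sp pt; under eq_bigr do rewrite -mulrA.
by rewrite -mulr_sumr -horner_coef_wide // pt mulr0.
Qed.

Lemma prod_others (R : comNzRingType) n (g h : nat -> R) (p : nat -> R) j (jn : (j < n)%N) :
  p j * h j = g j -> (\prod_(i < n) h i) * p j = g j * \prod_(i < n | i != Ordinal jn) h i.
Proof. by move=> <-; rewrite (bigD1 (Ordinal jn)) //=; ring. Qed.

Section GrClass.
Local Open Scope quotient_scope.
Variables (F : fieldType) (G : ordAbGroupType) (v : valuation F G).
Implicit Types (x y : F) (b c d : G).

Definition fge b y : bool := top_le (Some b) (v y).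
Definition fgt b y : bool := top_lt (Some b) (v y).

Let cls b y : rees v := insubd 0 (<< y *g b >> : group_alg F G).

Let clsE b y : fge b y -> val (cls b y) = (<< y *g b >> : group_alg F G).
Proof.
move=> h; rewrite insubdK //; apply/rees_predP => c; rewrite mcoeffU.
by case: eqP => [<-|_]; rewrite ?mulr1n ?mulr0n ?Defs.val0.
Qed.

Let pi (r : rees v) : gr v := \pi_(gr v) r.
Let piD r s : pi (r + s) = pi r + pi s.
Proof. exact: (rmorphD \pi_{ideal_quot (rees_plus (v := v))}). Qed.
Let piM r s : pi (r * s) = pi r * pi s.
Proof. exact: (rmorphM \pi_{ideal_quot (rees_plus (v := v))}). Qed.
Let pi1 : pi 1 = 1.
Proof. exact: (rmorph1 \pi_{ideal_quot (rees_plus (v := v))}). Qed.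
Let pi0 : pi 0 = 0.
Proof. exact: (rmorph0 \pi_{ideal_quot (rees_plus (v := v))}). Qed.
Let pi_eq0 r : (pi r == 0) = (r \in rees_plus (v := v)).
Proof. by rewrite -pi0 /pi -Quotient.idealrBE subr0. Qed.

Lemma gr_classD b x y : fge b x -> fge b y -> gr_class v b (x + y) = gr_class v b x + gr_class v b y.
Proof.
move=> hx hy; rewrite -[LHS]/(pi (cls b (x + y))) -[RHS]/(pi (cls b x) + pi (cls b y)) -piD.
by congr pi; apply/val_inj; rewrite /= !clsE //; [rewrite monalgUD|exact: val_leD].
Qed.

Lemma gr_classM b c x y : fge b x -> fge c y ->
  gr_class v (b + c) (x * y) = gr_class v b x * gr_class v c y.
Proof.
move=> hx hy; rewrite -[LHS]/(pi (cls (b + c) (x * y))) -[RHS]/(pi (cls b x) * pi (cls c y)) -piM.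
congr pi; apply/val_inj; rewrite /= !clsE //; first by rewrite -gmulUU.
by rewrite /fge valuationM; exact: top_leD hx hy.
Qed.

Lemma gr_class1 : gr_class v 0 1 = 1.
Proof.
rewrite -[LHS]/(pi (cls 0 1)) -pi1; congr pi; apply/val_inj.
by rewrite /= clsE // /fge Defs.val1 /= lexx.
Qed.

Lemma gr_class0 b y : fgt b y -> gr_class v b y = 0.
Proof.
move=> h; apply/eqP; rewrite gr_class_eq0 //.
by move: h; rewrite /fgt /top_lt; case: (v y) => //= a; rewrite -oag_ltNge => /ltW.
Qed.

(** Equal degrees are allowed in [l]; grouping them gives the homogeneous components, which vanish
    separately. *)
Lemma gr_class_sum_eq0 (l : seq (G * F)) : (forall p, p \in l -> fge p.1 p.2) ->
  (\sum_(p <- l) gr_class v p.1 p.2 == 0) = `[< forall d, fgt d (\sum_(p <- l | p.1 == d) p.2) >].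
Proof.
move=> hl; have -> : \sum_(p <- l) gr_class v p.1 p.2 = pi (\sum_(p <- l) cls p.1 p.2).
  by rewrite (big_morph pi piD pi0).
have hv d : (val (\sum_(p <- l) cls p.1 p.2))@_d = \sum_(p <- l | p.1 == d) p.2.
  rewrite raddf_sum raddf_sum /= [RHS]big_mkcond; apply: eq_big_seq => p pl.
  by rewrite /= clsE ?hl // mcoeffU; case: eqP; rewrite ?mulr1n ?mulr0n.
rewrite pi_eq0; apply/rees_plusP/asboolP => h d; have := h d; by rewrite hv.
Qed.

Lemma homogeneous_unit h : homogeneous h -> h != 0 -> exists h' : gr v, h' * h = 1.
Proof.
case=> b [y [hy ->]]; rewrite gr_class_eq0 // => nz.
have vy : v y = Some b.
  move: hy nz; rewrite /top_lt; case: (v y) => //= a h1 /negPn h2.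
  by congr Some; apply/le_anti/andP.
have y0 : y != 0 by apply/eqP => e; move: vy; rewrite e Defs.val0.
have vi : v y^-1 = Some (- b).
  have := valuationM v y y^-1; rewrite mulfV // Defs.val1 vy; case: (v y^-1) => //= a [e].
  by congr Some; apply: (addrI b); rewrite subrr.
exists (gr_class v (- b) y^-1); rewrite -gr_classM /fge ?vi ?vy /= ?lexx //.
by rewrite addNr mulVf // gr_class1.
Qed.

Lemma in_formE b y : v y = Some b -> in_form v y = gr_class v b y.
Proof. by rewrite /in_form => ->. Qed.

Lemma in_formM x y : in_form v (x * y) = in_form v x * in_form v y.
Proof.
rewrite /in_form valuationM; case E1: (v x) => [a|] /=; last by rewrite mul0r.
case E2: (v y) => [b|] /=; last by rewrite mulr0.
by rewrite gr_classM // /fge ?E1 ?E2 /= lexx.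
Qed.

Lemma in_form1 : in_form v 1 = 1.
Proof. by rewrite (in_formE (Defs.val1 v)) gr_class1. Qed.
End GrClass.

(** * Initial forms of small degree and minimality of relations *)

Section GrRelation.
Variables (K : fieldType) (G : ordAbGroupType).
Variable v : valuation {fraction {poly K}} G.
Implicit Types (Q f h : {poly K}) (b c d : G).

Local Notation cl b f := (gr_class v b (FracField.tofrac f)).

Lemma cl0 b f : vgt v b f -> cl b f = 0. Proof. exact: gr_class0. Qed.
Lemma clD b f h : vge v b f -> vge v b h -> cl b (f + h) = cl b f + cl b h.
Proof. by move=> hf hh; rewrite rmorphD; exact: gr_classD. Qed.
Lemma clM b c f h : vge v b f -> vge v c h -> cl (b + c) (f * h) = cl b f * cl c h.
Proof. by move=> hf hh; rewrite rmorphM; exact: gr_classM. Qed.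
Lemma pinE b f : pval v f = Some b -> pin v f = cl b f.
Proof. exact: in_formE. Qed.
Lemma pinM f h : pin v (f * h) = pin v f * pin v h.
Proof. by rewrite /pin rmorphM in_formM. Qed.
Lemma pin1 : pin v 1 = 1. Proof. by rewrite /pin rmorph1 in_form1. Qed.
Lemma pinX f n : pin v (f ^+ n) = pin v f ^+ n.
Proof. by elim: n => [|n IH]; rewrite ?expr0 ?pin1 // !exprS pinM IH. Qed.
Lemma pin0 : pin v 0 = 0.
Proof. by rewrite /pin rmorph0 /in_form Defs.val0. Qed.

Lemma cl_sum (I : eqType) (r : seq I) (P : pred I) (F : I -> {poly K}) b :
  (forall i, i \in r -> P i -> vge v b (F i)) ->
  cl b (\sum_(i <- r | P i) F i) = \sum_(i <- r | P i) cl b (F i).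
Proof.
elim: r => [|i r IH] h; first by rewrite !big_nil cl0 // vgt0.
have hr j : j \in r -> P j -> vge v b (F j) by move=> jr; apply: h; rewrite inE jr orbT.
rewrite !big_cons; case: ifP => Pi; last exact: IH.
rewrite clD ?IH ?h ?mem_head //; exact: vge_sum.
Qed.

Section Fixed.
Variables (Q : {poly K}).
Hypotheses (Qm : Q \is monic) (Q1 : (1 < size Q)%N) (kQ : keyprop v Q).
Let Q0 : Q != 0 := monic_n0 Qm.

(** By [keyprop] these elements form a subring. It contains the ring generated by the constants and
    the earlier key polynomials, and unlike that ring it can be handled through degrees. *)
Definition small_class (x : gr v) : Prop := exists l : seq (G * {poly K}),
  (forall p, p \in l -> small Q p.2 /\ vge v p.1 p.2) /\ x = \sum_(p <- l) cl p.1 p.2.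

Lemma small_class1 b f : small Q f -> vge v b f -> small_class (cl b f).
Proof.
by move=> sf hf; exists [:: (b, f)]; rewrite big_seq1; split=> // p; rewrite inE => /eqP ->.
Qed.
Lemma small_class0 : small_class 0.
Proof. by exists [::]; rewrite big_nil. Qed.
Lemma small_classD x y : small_class x -> small_class y -> small_class (x + y).
Proof.
move=> [l [hl ->]] [m [hm ->]]; exists (l ++ m); rewrite big_cat; split=> // p.
by rewrite mem_cat => /orP[/hl|/hm].
Qed.
Lemma small_classN x : small_class x -> small_class (- x).
Proof.
move=> [l [hl ->]]; exists [seq (p.1, - p.2) | p <- l]; split.
  by move=> p /mapP[q /hl[h1 h2] ->]; rewrite /= smallN vgeN.
rewrite big_map -sumrN; apply: eq_big_seq => p /hl[h1 h2] /=.
apply/eqP; rewrite eq_sym -subr_eq0 opprK -clD ?vgeN // addNr cl0 //; exact: vgt0.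
Qed.
Lemma small_classM x y : small_class x -> small_class y -> small_class (x * y).
Proof.
move=> [l [hl ->]] [m [hm ->]]; rewrite big_seq mulr_suml.
elim/big_rec: _ => [|p z pl]; first exact: small_class0.
apply: small_classD; rewrite big_seq mulr_sumr.
elim/big_rec: _ => [|q z' qm]; first exact: small_class0.
apply: small_classD; have [h1 h2] := hl p pl; have [h3 h4] := hm q qm.
rewrite -clM //; have [k1 k2] := kQ h1 h3 (vgeM h2 h4).
rewrite (divp_eq (p.2 * q.2) Q) clD //; last exact: vgtW.
by rewrite (cl0 k2) add0r; apply: small_class1 => //; exact: small_mod.
Qed.

Lemma small_class_pin f : small Q f -> small_class (pin v f).
Proof.
move=> sf; have [->|f0] := eqVneq f 0; first by rewrite pin0; exact: small_class0.
by rewrite (pinE (pval_vl v f0)); apply: small_class1 => //; exact: vge_vl.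
Qed.
(** For the earlier key polynomials of the same degree as [Q]: as [Q] has larger value, [f] and
    [f - Q] have the same initial form. *)
Lemma small_class_pin_near f : f \is monic -> size f = size Q -> vl v f < vl v Q ->
  small_class (pin v f).
Proof.
move=> fm sf lt; have f0 := monic_n0 fm.
have s1 : small Q (f - Q) by apply: same_size_small.
rewrite (pinE (pval_vl v f0)) -[X in cl _ X](subrK Q) clD.
- by rewrite (cl0 (f := Q)) ?vgtE // addr0; apply: small_class1 => //; apply: vgeB; rewrite ?vgeE ?lexx ?ltW.
- by apply: vgeB; rewrite ?vgeE ?lexx ?ltW.
by rewrite vgeE ?ltW.
Qed.

Section Relation.
Variables (al : nat).
Hypothesis hex : forall f, (size f <= dg Q * al)%N -> exact_at v Q f.

(** In each degree, the relation says that a polynomial of degree below [dg Q * al] has larger value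
    than its degree. Exactness then bounds every term of its [Q]-adic expansion, so every component
    of every coefficient vanishes. *)
Lemma small_class_free (x : nat -> gr v) : (forall j, small_class (x j)) ->
  \sum_(j < al) x j * pin v Q ^+ j = 0 -> forall j, (j < al)%N -> x j = 0.
Proof.
move=> /choice[l hl] hs j0 jal; pose b := vl v Q.
have hX j : pin v Q ^+ j = cl (b *+ j) (Q ^+ j).
  by rewrite -pinX (pinE (pval_vl v (expf_neq0 j Q0))) vlX.
have hbX j : vge v (b *+ j) (Q ^+ j) by rewrite vgeE ?expf_neq0 // vlX // lexx.
pose L := [seq (p.1 + b *+ j, p.2 * Q ^+ j) | j <- iota 0 al, p <- l j].
have hL p : p \in [seq (p.1, FracField.tofrac p.2) | p <- L] -> fge v p.1 p.2.
  case/mapP => q /allpairsPdep[j [p' [_ hp' ->]]] -> /=.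
  by have [/(_ p' hp')[_ h] _] := hl j; exact: (vgeM h (hbX j)).
have := gr_class_sum_eq0 hL; rewrite big_map big_allpairs_dep /=.
have -> : \sum_(j <- iota 0 al) \sum_(p <- l j) cl (p.1 + b *+ j) (p.2 * Q ^+ j) = 0.
  rewrite -[RHS]hs -(big_mkord predT (fun j => x j * pin v Q ^+ j)) /index_iota subn0.
  apply: eq_bigr => j _; have [h1 ->] := hl j; rewrite mulr_suml hX.
  by apply: eq_big_seq => p /h1[_ h]; rewrite clM.
rewrite eqxx => /esym/asboolP hd.
have comp j c : (j < al)%N -> vgt v c (\sum_(p <- l j | p.1 == c) p.2).
  move=> ja; pose d := c + b *+ j.
  have := hd d; rewrite big_map big_mkcond big_allpairs_dep /=.
  pose u i := \sum_(p <- l i | p.1 + b *+ i == d) p.2.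
  have -> : \sum_(i <- iota 0 al) \sum_(p <- l i) (if p.1 + b *+ i == d then
      FracField.tofrac (p.2 * Q ^+ i) else 0) = FracField.tofrac (\sum_(i < al) u i * Q ^+ i).
    rewrite -(big_mkord predT (fun i => u i * Q ^+ i)) /index_iota subn0.
    rewrite rmorph_sum; apply: eq_bigr => i _ /=.
    by rewrite /u mulr_suml rmorph_sum /= [RHS]big_mkcond.
  move=> hg; have su i : small Q (u i).
    by apply: small_sum => // p pl _; case: (hl i) => /(_ p pl)[].
  have hg' : vgt v d (\sum_(i < al) u i * Q ^+ i) by exact: hg.
  have ej : u j = \sum_(p <- l j | p.1 == c) p.2.
    by apply: eq_bigl => p; rewrite /d (inj_eq (addIr _)).
  rewrite -ej; set U := \sum_(i < al) _ in hg'.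
  have [U0|U0] := eqVneq U 0.
    have := qc_eval Qm Q1 (c := u) (N := al) j (fun i _ => su i).
    by rewrite -/U U0 qc0 ja => <-; exact: vgt0.
  have := hex (size_evalX Qm Q1 (c := u) (N := al) (fun i _ => su i)) (vge_vl v U) j.
  rewrite -/U (qc_eval Qm Q1) // ja => h.
  have : vgt v d (u j * Q ^+ j) by apply: vge_lt h; rewrite -vgtE.
  by rewrite /d -vlX // vgt_mulr ?expf_neq0.
have [h1 e] := hl j0; rewrite e.
have h2 p : p \in [seq (p.1, FracField.tofrac p.2) | p <- l j0] -> fge v p.1 p.2.
  by case/mapP => q /h1[_ h] ->.
have := gr_class_sum_eq0 h2; rewrite big_map /= => h3; apply/eqP; rewrite h3.
apply/asboolP => d; rewrite big_map /= -rmorph_sum /=; exact: comp.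
Qed.

Lemma gen_subring1 (R : comNzRingType) (X : set R) : gen_subring X 1.
Proof. by move=> T h1. Qed.
Lemma gen_subringB (R : comNzRingType) (X : set R) x y :
  gen_subring X x -> gen_subring X y -> gen_subring X (x - y).
Proof. by move=> hx hy T h1 h2 h3 h4; apply: (h2); [exact: hx|exact: hy]. Qed.
Lemma gen_subringM (R : comNzRingType) (X : set R) x y :
  gen_subring X x -> gen_subring X y -> gen_subring X (x * y).
Proof. by move=> hx hy T h1 h2 h3 h4; apply: (h3); [exact: hx|exact: hy]. Qed.
Lemma gen_subring0 (R : comNzRingType) (X : set R) : gen_subring X 0.
Proof. by rewrite -(subrr 1); apply: gen_subringB; exact: gen_subring1. Qed.
Lemma gen_subringD (R : comNzRingType) (X : set R) x y :
  gen_subring X x -> gen_subring X y -> gen_subring X (x + y).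
Proof.
move=> hx hy; rewrite -[y]opprK; apply: gen_subringB => //.
by rewrite -[- y]add0r; apply: gen_subringB => //; exact: gen_subring0.
Qed.
Lemma gen_subringX (R : comNzRingType) (X : set R) x n :
  gen_subring X x -> gen_subring X (x ^+ n).
Proof.
move=> hx; elim: n => [|n IH]; first by rewrite expr0; exact: gen_subring1.
by rewrite exprS; exact: gen_subringM.
Qed.
Lemma gen_subring_in (R : comNzRingType) (X : set R) x : X x -> gen_subring X x.
Proof. by move=> hx T _ _ _; apply. Qed.

Variable X : set (gr v).
Hypothesis hX : forall x, X x -> small_class x.
Let Agr := gen_subring X.

Lemma subring_small x : Agr x -> small_class x.
Proof.
move=> h; apply: (h small_class).
- by rewrite -[X in small_class X]pin1; apply: small_class_pin; exact: small1.
- by move=> y z hy hz; apply: small_classD => //; exact: small_classN.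
- exact: small_classM.
exact: hX.
Qed.

Let A1 : Agr 1 := @gen_subring1 _ X.
Let A0 : Agr 0 := @gen_subring0 _ X.
Let AD x y : Agr x -> Agr y -> Agr (x + y) := @gen_subringD _ X x y.
Let AM x y : Agr x -> Agr y -> Agr (x * y) := @gen_subringM _ X x y.

Lemma homog_fractions_sub x : Agr x -> homog_fractions Agr x.
Proof.
move=> hx; exists x, 1; split=> //; [|exact: oner_neq0|exact: mulr1].
exists 0, 1; split; last by rewrite gr_class1.
by rewrite Defs.val1 /= lexx.
Qed.

(** The relation holds because the sum has larger value than its terms. A shorter one, multiplied by
    the product [H] of its denominators, would have coefficients in [small_class] and vanish by
    [small_class_free]; as nonzero homogeneous elements are units, [H] can be cancelled. *)
Theorem key_relation (L : nat -> tms K) :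
  (0 < al)%N -> (forall j p, (j < al)%N -> p \in L j -> pval v (trm p * Q ^+ j) = pval v (Q ^+ al)) ->
  vgt v (vl v Q *+ al) (Q ^+ al + \sum_(j < al) ev (L j) * Q ^+ j) ->
  (forall j p, (j < al)%N -> p \in L j -> Agr (pin v p.1%:P) /\ Agr (pin v p.2)) ->
  minimal_relation (homog_fractions Agr) (pin v Q)
    ('X^al + \sum_(j < al) (\sum_(p <- L j) pin v p.1%:P * pin v p.2)%:P * 'X^j).
Proof.
move=> al0 hv hQ' hA; pose x j := \sum_(p <- L j) pin v p.1%:P * pin v p.2.
have hx j : (j < al)%N -> Agr (x j).
  move=> ja; rewrite /x big_seq; elim/big_rec: _ => [|p z pl hz]; first exact: A0.
  by apply: AD => //; have [h1 h2] := hA j p ja pl; exact: AM.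
have [mP sP cP hP] := monic_tail al x.
split.
- exact: mP.
- move=> j; rewrite cP; apply: homog_fractions_sub; apply: AD.
    by case: eqP => _; [exact: A1|exact: A0].
  by case: ifP => [/hx|_]; [apply|exact: A0].
- have hQal : pval v (Q ^+ al) = Some (vl v Q *+ al) by rewrite pval_vl ?expf_neq0 // vlX.
  rewrite hP -[RHS](cl0 hQ') clD; last first.
  + apply: vge_sum => j _ _; rewrite mulr_suml; apply: vge_sum => p pl _.
    by apply: vge_eq; rewrite hv.
  + exact: vge_eq.
  rewrite -pinX (pinE hQal); congr (_ + _); rewrite cl_sum; last first.
    by move=> j _ _; rewrite mulr_suml; apply: vge_sum => p pl _; apply: vge_eq; rewrite hv.
  apply: eq_bigr => j _; rewrite mulr_suml [in RHS]mulr_suml cl_sum; last first.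
    by move=> p pl _; apply: vge_eq; rewrite hv.
  apply: eq_big_seq => p pl; rewrite -(pinE (etrans (hv j p (ltn_ord j) pl) hQal)) pinM pinX.
  by rewrite /trm -mul_polyC pinM.
move=> P' P'0 hP' rP'; rewrite sP ltnNge; apply/negP => sz.
have /choice[gh hgh] : forall j, exists gh : gr v * gr v, [/\ Agr gh.1, Agr gh.2,
    homogeneous gh.2, gh.2 != 0 & P'`_j * gh.2 = gh.1].
  by move=> j; have [g [h h1]] := hP' j; exists (g, h).
pose H := \prod_(j < al) (gh j).2.
have [H' hH'] : exists H', H' * H = 1.
  rewrite /H; elim/big_rec: _ => [|j y _ [y' hy']]; first by exists 1; exact: mulr1.
  have [_ _ h1 h2 _] := hgh j; have [z hz] := homogeneous_unit h1 h2.
  exists (z * y'); rewrite mulrACA hz hy'; exact: mulr1.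
have hHj j : (j < al)%N -> Agr (H * P'`_j).
  move=> ja; have [h1 _ _ _ e] := hgh j.
  rewrite (prod_others (g := fun j => (gh j).1) (h := fun j => (gh j).2) (p := fun j => P'`_j) ja e).
  apply: AM => //; elim/big_rec: _ => [|i y _ hy]; first exact: A1.
  by apply: AM => //; case: (hgh i).
pose y j := if (j < al)%N then H * P'`_j else 0.
have hy j : small_class (y j).
  rewrite /y; case: ifP => [/hHj|_]; [exact: subring_small|exact: small_class0].
have s0 : \sum_(j < al) y j * pin v Q ^+ j = 0.
  rewrite -[RHS](horner_scaled0 H sz rP'); apply: eq_bigr => j _.
  by rewrite /y ltn_ord.
have h := small_class_free hy s0.
move/negP: P'0; apply; apply/eqP/polyP => j; rewrite coef0.
have [ja|ja] := ltnP j al; last by rewrite nth_default // (leq_trans sz).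
have := h j ja; rewrite /y ja => e; rewrite -[LHS]mul1r -hH' -mulrA e; exact: mulr0.
Qed.
End Relation.
End Fixed.
End GrRelation.

(** * The index set and its standard monomials *)


(** The proof that [(0, 0)] is an index is bundled so that the type of indices has a bottom element
    by its mere form. *)
Record index_data := IndexData { ip : nat -> nat -> bool; ip0 : ip 0 0 }.
Fact lam_display : Order.disp_t. Proof. exact: Order.Disp tt tt. Qed.

Section Lam.
Import Order.LexiSyntax.
Variable D : index_data.
(* [(a, t)] is the index of the [t]-th member of the row [a]; the limit indices are
   the [(a.+1, 0)]. *)
Definition lam := {x : nat *l nat | ip D x.1 x.2}.
HB.instance Definition _ := SubChoice.on lam.
HB.instance Definition _ := [Countable of lam by <:].
HB.instance Definition _ := [SubChoice_isSubOrder of lam by <: with lam_display].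
Definition lam_bot : lam := exist _ ((0%N, 0%N) : nat *l nat) (ip0 D).
Definition ro (x : lam) : nat := (val x).1.
Definition co (x : lam) : nat := (val x).2.

Lemma lam_leE (x y : lam) : (x <= y)%O = (ro x < ro y)%N || (ro x == ro y) && (co x <= co y)%N.
Proof.
by rewrite leEsub leEprodlexi !leEnat /ro /co; case: ltngtP.
Qed.
Lemma lam_bot_le x : (lam_bot <= x)%O.
Proof. by rewrite lam_leE /=; case: (ro x). Qed.
HB.instance Definition _ := Order.hasBottom.Build lam_display lam lam_bot_le.

Lemma lam_inj (x y : lam) : ro x = ro y -> co x = co y -> x = y.
Proof.
move=> e1 e2; apply/val_inj; move: e1 e2; rewrite /ro /co.
by case: (val x) (val y) => [a b] [c d] /= -> ->.
Qed.
Lemma lam_ltE (x y : lam) : (x < y)%O = (ro x < ro y)%N || (ro x == ro y) && (co x < co y)%N.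
Proof.
rewrite lt_neqAle lam_leE; have [->|ne] /= := eqVneq x y; first by rewrite eqxx !ltnn.
case: ltngtP => //= e; rewrite ltn_neqAle; case: eqP => //= e2.
by move: ne; rewrite (lam_inj e e2) eqxx.
Qed.
Lemma ip_lam (x : lam) : ip D (ro x) (co x). Proof. exact: (valP x). Qed.
Definition lam_of a t (h : ip D a t) : lam := exist _ ((a, t) : nat *l nat) h.

Lemma lam_well_ordered : well_ordered (Lam := lam).
Proof.
move=> X [x0 x0X]; have ex1 : exists a, `[< exists2 x, X x & ro x = a >].
  by exists (ro x0); apply/asboolP; exists x0.
have [a /asboolP[x xX xa] amin] := ex_minnP ex1.
have ex2 : exists t, `[< exists2 x, X x & ro x = a /\ co x = t >].
  by exists (co x); apply/asboolP; exists x.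
have [t /asboolP[m mX [ma mt]] tmin] := ex_minnP ex2; exists m => // y yX.
have h1 : (a <= ro y)%N by apply: amin; apply/asboolP; exists y.
rewrite lam_leE ma mt; move: h1; rewrite leq_eqVlt => /orP[/eqP e|->//].
by apply/orP; right; rewrite {1}e eqxx /=; apply: tmin; apply/asboolP; exists y.
Qed.
Lemma lam_countable : countable [set: lam].
Proof. exact: countableP. Qed.
End Lam.

Section LamTower.
Variables (K : fieldType) (G : ordAbGroupType).
Variable v : valuation {fraction {poly K}} G.
Hypothesis arch : archi v.
Variables (P : nat -> nat -> bool) (Q : nat -> nat -> {poly K})
  (S : nat -> nat -> set {poly K}) (A : nat -> nat -> nat).
Hypothesis tw : tower v P Q S A.

Let P00 : P 0 0. Proof. by have [] := tw_start tw. Qed.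
Definition ldat := IndexData P00.
Notation Lm := (lam ldat).
Implicit Types (i j k l m p : Lm).
Definition al i := A (ro i) (co i).
Definition key_poly i := Q (ro i) (co i).

Lemma aliveP i : P (ro i) (co i). Proof. exact: (ip_lam i). Qed.
Definition ix a t (h : P a t) : Lm := @lam_of ldat a t h.

Lemma ro_ix a t (h : P a t) : ro (ix h) = a. Proof. by []. Qed.
Lemma co_ix a t (h : P a t) : co (ix h) = t. Proof. by []. Qed.

Lemma succ_idxE i j : succ_idx i j <-> ro j = ro i /\ co j = (co i).+1.
Proof.
split=> [[lt nb]|[e1 e2]]; last first.
  split; first by rewrite lam_ltE e1 e2 eqxx ltnSn orbT.
  by move=> k []; rewrite !lam_ltE e1 e2; lia.
move: lt; rewrite lam_ltE => /orP[lt|/andP[/eqP e lt]].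
  have h : P (ro i) (co i).+1 by exact: (tw_inf_lt tw lt (aliveP j)).
  by case: (nb (ix h)); rewrite !lam_ltE ro_ix co_ix; lia.
split=> //; apply/eqP; rewrite eqn_leq lt andbT leqNgt; apply/negP => lt2.
have h : P (ro i) (co i).+1 by apply: (tw_le tw lt); rewrite e; exact: aliveP.
by case: (nb (ix h)); rewrite !lam_ltE ro_ix co_ix; lia.
Qed.

Lemma add_idxE t i j : add_idx t i j <-> ro j = ro i /\ co j = (co i + t)%N.
Proof.
elim: t j => [|t IH] j /=.
  rewrite addn0; split=> [->//|[e1 e2]]; exact/esym/lam_inj.
split=> [[k /IH[e1 e2] /succ_idxE[e3 e4]]|[e1 e2]].
  by rewrite e3 e4 e1 e2 addnS.
have h : P (ro i) (co i + t)%N.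
  by apply: (tw_le tw (leqnSn _)); rewrite -addnS -e2 -e1; exact: aliveP.
by exists (ix h); [apply/IH|apply/succ_idxE; rewrite e1 e2 addnS].
Qed.

Lemma add_ix i s (h : P (ro i) (co i + s)%N) : add_idx s i (ix h).
Proof. by apply/add_idxE. Qed.

Lemma add_omegaE i j : add_omega_idx i j <-> ro j = (ro i).+1 /\ co j = 0%N.
Proof.
split=> [[h1 h2]|[e1 e2]].
  have lt : (ro i < ro j)%N.
    have [k /add_idxE[k1 k2]] := h1 (co j).+1; rewrite lam_ltE k1 k2 => /orP[//|/andP[_]].
    lia.
  have h : P (ro i).+1 0%N.
    have := lt; rewrite leq_eqVlt => /orP[/eqP e|lt'].
      by rewrite e; exact: (tw_pred tw (aliveP j)).
    exact: (tw_inf_lt tw lt' (aliveP j)).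
  have : (j <= ix h)%O.
    by apply: h2 => t k /add_idxE[k1 k2]; rewrite lam_ltE k1 ro_ix ltnSn.
  rewrite lam_leE ro_ix co_ix; move: lt.
  by move: (ro i) (ro j) (co j) => a b c; split; lia.
have h0 : P (ro i).+1 (co j) by rewrite -e1; exact: aliveP.
have inf := tw_inf tw h0; split.
  move=> t; exists (ix (inf (co i + t)%N)); first exact/add_idxE.
  by rewrite lam_ltE e1 ro_ix ltnSn.
move=> l hl; rewrite lam_leE e1 e2.
have lt : (ro i < ro l)%N.
  have := hl _ _ (add_ix (inf (co i + (co l).+1)%N)).
  by rewrite lam_ltE ro_ix co_ix; lia.
by move: lt; move: (ro i) (ro l) => a b; lia.
Qed.

Definition in_tail i : Prop := forall s, A (ro i) (co i + s)%N = 1%N.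

Lemma add_alphaE i : (forall s, P (ro i) s) ->
  (forall t k, add_idx t i k -> al k = 1%N) <-> in_tail i.
Proof.
move=> inf; split=> [h s|h t k /add_idxE[k1 k2]]; last by rewrite /al k1 k2.
exact: (h s _ (add_ix (inf (co i + s)%N))).
Qed.

Notation Dl l := [set q : Lm | (q <= l)%O].

(** The index [i + omega] is the start of the row after that of [i]; it lies below [l] exactly when
    [l] is in a later row than [i]. *)
Lemma inessential_E l i : inessential al (Dl l) i <-> (ro i < ro l)%N /\ in_tail i.
Proof.
split=> [[[j /= jl /add_omegaE[e1 e2]] h]|[lt h]].
  have inf : forall s, P (ro i) s by apply: (tw_inf tw (t := co j)); rewrite -e1; exact: aliveP.
  split; last exact/add_alphaE.
  by move: jl; rewrite lam_leE e1 e2; lia.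
have inf := tw_inf_lt tw lt (aliveP l); split; last exact/add_alphaE.
have h1 : P (ro i).+1 0%N.
  move: lt; rewrite leq_eqVlt => /orP[/eqP e|lt']; first by rewrite e; exact: (tw_pred tw (aliveP l)).
  exact: (tw_inf_lt tw lt' (aliveP l)).
exists (ix h1); last exact/add_omegaE.
by rewrite /= lam_leE ro_ix co_ix; lia.
Qed.

Lemma inessential_T i : inessential al setT i <-> P (ro i).+1 0%N /\ in_tail i.
Proof.
split=> [[[j _ /add_omegaE[e1 e2]] h]|[h1 h]].
  have hj : P (ro i).+1 0%N by rewrite -e1 -e2; exact: aliveP.
  by split=> //; apply/add_alphaE => //; exact: (tw_inf tw hj).
have inf := tw_inf tw h1; split; last exact/add_alphaE.
by exists (ix h1) => //; exact/add_omegaE.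
Qed.

Lemma next_idxE l i j : next_idx al (Dl l) i j <-> (j <= l)%O /\
  (((ro i < ro l)%N /\ in_tail i) /\ (ro j = (ro i).+1 /\ co j = 0%N) \/
   ~ ((ro i < ro l)%N /\ in_tail i) /\ (ro j = ro i /\ co j = (co i).+1)).
Proof.
rewrite /next_idx; split=> -[jl h]; split=> //; case: h => [[h1 h2]|[h1 h2]].
- by left; split; [exact/inessential_E|exact/add_omegaE].
- by right; split; [rewrite -inessential_E|exact/succ_idxE].
- by left; split; [exact/inessential_E|exact/add_omegaE].
- by right; split; [rewrite inessential_E|exact/succ_idxE].
Qed.

Lemma next_idxT i j : next_idx al setT i j <->
  (P (ro i).+1 0%N /\ in_tail i) /\ (ro j = (ro i).+1 /\ co j = 0%N) \/
   ~ (P (ro i).+1 0%N /\ in_tail i) /\ (ro j = ro i /\ co j = (co i).+1).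
Proof.
rewrite /next_idx; split=> [[_ h]|h]; [|split=> //]; case: h => [[h1 h2]|[h1 h2]].
- by left; split; [exact/inessential_T|exact/add_omegaE].
- by right; split; [rewrite -inessential_T|exact/succ_idxE].
- by left; split; [exact/inessential_T|exact/add_omegaE].
- by right; split; [rewrite inessential_T|exact/succ_idxE].
Qed.

Lemma not_maxE i : ~ is_max i <-> P (ro i) (co i).+1.
Proof.
split=> [nm|h]; last first.
  by move=> /(_ (ix h)); rewrite lam_leE ro_ix co_ix; lia.
apply: contrapT => /negP no; apply: nm => j; rewrite lam_leE.
have [lt|lt|e] //= := ltngtP (ro j) (ro i).
  by case/negP: no; exact: (tw_inf_lt tw lt (aliveP j)).
rewrite leqNgt; apply/negP => lt; case/negP: no; apply: (tw_le tw lt).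
by rewrite -e; exact: aliveP.
Qed.
End LamTower.

(** * Exponents of monomials *)

Section Expo.
Local Open Scope fset_scope.
Variables (K : fieldType) (d : Order.disp_t) (I : bOrderType d) (q : I -> {poly K}).
Implicit Types (g : expo (Lam := I)) (i p : I).

Lemma mono_wide (X : {fset I}) g : finsupp g `<=` X -> monomial q g = \prod_(i <- X) q i ^+ g i.
Proof.
move=> h; rewrite /monomial; apply: big_fset_incl => // i _.
by rewrite memNfinsupp => /eqP ->; rewrite expr0.
Qed.

Lemma mono_upd g p k : g p = 0%N -> monomial q [fsfun g with p |-> k] = monomial q g * q p ^+ k.
Proof.
move=> gp; have pn : p \notin finsupp g by rewrite memNfinsupp gp.
rewrite (@mono_wide (p |` finsupp g)); last first.
  by rewrite finsupp_with; case: eqP => // _; apply: fsubset_trans (fsubsetUr _ _); exact: fsubD1set.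
rewrite big_fsetU1 //= fsfun_with mulrC; congr (_ * _).
apply: eq_big_seq => i ig; rewrite fsfun_withE; case: eqP => // e.
by rewrite -e ig in pn.
Qed.

Lemma mono_split g p : monomial q g = monomial q [fsfun g with p |-> 0%N] * q p ^+ g p.
Proof.
rewrite -(mono_upd _ (p := p)) ?fsfun_with //; congr monomial; apply/fsfunP => i.
by rewrite !fsfun_withE; case: eqP => // ->.
Qed.

Lemma mono0 : monomial q [fsfun] = 1.
Proof. by rewrite /monomial finsupp0 big_seq_fset0. Qed.

End Expo.

Section ExpoTower.
Variables (K : fieldType) (G : ordAbGroupType).
Variable v : valuation {fraction {poly K}} G.
Variables (P : nat -> nat -> bool) (Q : nat -> nat -> {poly K})
  (S : nat -> nat -> set {poly K}) (A : nat -> nat -> nat).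
Hypothesis tw : tower v P Q S A.
Notation Lm := (lam (ldat tw)).
Notation q := (@key_poly K G v P Q S A tw).
Notation al := (@al K G v P Q S A tw).
Notation ix := (ix tw).
Notation in_tail := (@in_tail K G v P Q S A tw).
Implicit Types (i j k l m p : Lm) (a t s : nat).
Notation expo := (expo (Lam := Lm)).

(* The exponents of the standard monomials free of the index [(a, t)]. *)
Record free_expo a t (g : expo) : Prop := FreeExpo {
  fe_zero : forall i, (a < ro i)%N || (a == ro i) && (t <= co i)%N -> g i = 0%N;
  fe_tail : forall i, (ro i < a)%N -> in_tail i -> (g i < A (ro i).+1 0)%N;
  fe_succ : forall i, (ro i < a)%N /\ ~ in_tail i \/ ro i = a /\ (co i < t)%N ->
    (g i < A (ro i) (co i).+1)%N;
  fe_uniq : forall i j, (ro i < a)%N -> ro i = ro j -> in_tail i -> in_tail j ->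
    g i <> 0%N -> g j <> 0%N -> i = j }.

Lemma free_expoE l (g : expo) : standard_expo al l g /\ g l = 0%N <-> free_expo (ro l) (co l) g.
Proof.
split=> [[[h1 h2 h3] h4]|[h1 h2 h3 h4]].
  have lim a : (a < ro l)%N -> P a.+1 0%N.
    rewrite leq_eqVlt => /orP[/eqP e|lt']; first by rewrite e; exact: (tw_pred tw (aliveP l)).
    exact: (tw_inf_lt tw lt' (aliveP l)).
  split.
  - move=> i; case: (eqVneq i l) => [-> //|ne] h; apply: h1; rewrite lt_neqAle eq_sym ne /=.
    by rewrite lam_leE.
  - move=> i lt ti; apply: (h2 i (ix (lim _ lt))); first by rewrite lam_ltE lt.
    apply/next_idxE; rewrite lam_leE ro_ix co_ix; split; last by left.
    by lia.
  - move=> i h; have il : (i < l)%O by rewrite lam_ltE; case: h => [[->]//|[-> ->]]; rewrite eqxx orbT.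
    have hP : P (ro i) (co i).+1.
      case: h => [[lt _]|[e lt]]; first exact: (tw_inf_lt tw lt (aliveP l)).
      by apply: (tw_le tw lt); rewrite e; exact: aliveP.
    apply: (h2 i (ix hP)) => //; apply/next_idxE; rewrite lam_leE ro_ix co_ix; split.
      by move: il; rewrite lam_ltE; case: h => [[]|[]]; lia.
    right; split=> //; case: h => [[_ nt] [_ /nt]//|[e _] [lt _]]; by rewrite e ltnn in lt.
  move=> i j lt e ti tj gi gj.
  have nx k : ro k = ro i -> in_tail k -> next_idx al [set q | (q <= l)%O] k (ix (lim _ lt)).
    move=> e1 tk; apply/next_idxE; rewrite lam_leE ro_ix co_ix e1; split; last by left.
    by lia.
  apply: (h3 i _ i j) => //; [exact/inessential_E|exact: nx|exact: nx|by apply: nx].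
split; last by apply: h1; rewrite eqxx leqnn orbT.
split.
- by move=> i; rewrite lam_ltE => h; apply: h1; lia.
- move=> i j; rewrite lam_ltE => il /next_idxE[jl [[[lt ti] [e1 e2]]|[nt [e1 e2]]]].
    by rewrite /al e1 e2; exact: h2.
  rewrite /al e1 e2; apply: h3; case/orP: il => [lt|/andP[/eqP e lt]]; last by right.
  by left; split=> // ti; apply: nt.
move=> i m j j' /inessential_E[lt ti] /next_idxE[_ hm] /next_idxE[_ hj] /next_idxE[_ hj'] gj gj'.
case: hm => [[_ [m1 m2]]|[nt]]; last by case: nt.
case: hj => [[[ltj tj] [j1 j2]]|[_ [_ e]]]; last by rewrite m2 in e.
case: hj' => [[[ltj' tj'] [j1' j2']]|[_ [_ e]]]; last by rewrite m2 in e.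
by apply: h4 => //; apply: succn_inj; rewrite -j1.
Qed.

Lemma tail_startP a : P a.+1 0%N -> exists t1, [/\ tail_start (row_at P Q S A a) t1,
  forall t, P a t & forall i, ro i = a -> in_tail i <-> (t1 <= co i)%N].
Proof.
move=> h; have [inf [t1 [ts _ _ _ _]] _] := tw_link tw h; exists t1; split=> // i ri.
have [h1 h2] := ts; split=> [ti|le s]; first by apply: h2 => s; move: (ti s); rewrite ri.
by rewrite ri -(subnKC le) -addnA; exact: h1.
Qed.

Lemma tw_bounded a : P a.+1 1%N -> exists t1, [/\ tail_start (row_at P Q S A a) t1,
  bounded_chain v (tail (row_at P Q S A a) t1), dg (Q a.+1 0) = (dg (Q a t1) * A a.+1 0)%N,
  S a.+1 0 = lim_mon (tail (row_at P Q S A a) t1) (S a t1) (A a.+1 0) &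
  min_exceeds v (tail (row_at P Q S A a) t1) (Q a.+1 0)].
Proof.
move=> h1; have h := tw_pred tw h1; have [inf [t1 [ts _ _ mF hb]] _] := tw_link tw h; exists t1.
case: hb => [[bc dF _ eS]|[nb fu _]]; first by split.
by have [] := tw_unbounded_last tw h fu; rewrite h1.
Qed.

Lemma ix_eq a t (h : P a t) i : (i == ix h) = (ro i == a) && (co i == t).
Proof.
apply/eqP/andP => [->|[/eqP e1 /eqP e2]]; first by rewrite !eqxx.
exact: lam_inj.
Qed.

Lemma mon_expo_succ a t M : P a t.+1 ->
  (forall M, S a t M -> exists2 g : expo, free_expo a t g & monomial q g = M) ->
  S a t.+1 M -> exists2 g : expo, free_expo a t.+1 g & monomial q g = M.
Proof.
move=> hP IH; have [_ ->] := tw_step tw hP => -[M' [k [SM ka ->]]].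
have [g' [z b1 b2 u] <-] := IH M' SM.
have hp := tw_le tw (leqnSn _) hP; pose p := ix hp.
have gp : g' p = 0%N by apply: z; rewrite eqxx leqnn orbT.
exists [fsfun g' with p |-> k]; last by rewrite mono_upd.
split.
- move=> i hi; rewrite fsfun_withE ix_eq; case: eqP => [e1|_] /=; last by apply: z; lia.
  by case: eqP => [e2|_]; [lia|apply: z; lia].
- move=> i lt ti; rewrite fsfun_withE ix_eq (ltn_eqF lt) /=; exact: b1.
- move=> i hi; rewrite fsfun_withE ix_eq; case: eqP => [e1|ne] /=; last first.
    by apply: b2; case: hi => [|[e _]]; [left|case: ne].
  case: eqP => [e2|ne]; first by rewrite e1 e2.
  by apply: b2; right; case: hi => [[lt _]|[_ lt]]; [move: lt; rewrite e1 ltnn|split=> //; lia].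
move=> i j lt e ti tj; rewrite !fsfun_withE !ix_eq -e (ltn_eqF lt) /=.
exact: u.
Qed.

(** The new factor is a power of one tail member, and the previous exponents vanish on the tail, so
    the tail carries at most one nonzero exponent. *)
Lemma mon_expo_limit a M : P a.+1 1%N ->
  (forall t M, P a t.+1 -> S a t M -> exists2 g : expo, free_expo a t g & monomial q g = M) ->
  S a.+1 0%N M -> exists2 g : expo, free_expo a.+1 0 g & monomial q g = M.
Proof.
move=> hP IH; have [t1 [ts bc dF -> mF]] := tw_bounded hP; case=> t [M' [k [SM ka ->]]].
have hP0 := tw_pred tw hP; have [t1' [ts' inf ti]] := tail_startP hP0.
have et : t1' = t1.
  have [h1 h2] := ts; have [h3 h4] := ts'; apply/eqP; rewrite eqn_leq.
  by rewrite h4 // h2.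
rewrite {}et {ts'} in ti.
have [g' [z b1 b2 u] <-] := IH t1 M' (inf _) SM.
pose p := ix (inf (t1 + t)%N).
have gp : g' p = 0%N by apply: z; rewrite eqxx leq_addr orbT.
exists [fsfun g' with p |-> k]; last by rewrite mono_upd.
have A0 := tw_al tw hP0.
have zt i : ro i = a -> in_tail i -> g' i = 0%N.
  by move=> e /(ti i e) h; apply: z; rewrite e eqxx h orbT.
split.
- move=> i hi; rewrite fsfun_withE ix_eq; case: eqP => [e1|_] /=; first by lia.
  by apply: z; lia.
- move=> i; rewrite ltnS leq_eqVlt => /orP[/eqP e|lt] tli; rewrite fsfun_withE ix_eq.
    by rewrite e eqxx /=; case: ifP => // _; rewrite zt.
  by rewrite (ltn_eqF lt) /=; exact: b1.
- move=> i [[lt nt]|[_]]; last by rewrite ltn0.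
  have ne : i != p.
    rewrite ix_eq; apply/negP => /andP[/eqP e1 /eqP e2]; apply: nt; apply/(ti i e1).
    by rewrite e2 leq_addr.
  rewrite fsfun_withE (negPf ne); apply: b2; move: lt; rewrite ltnS leq_eqVlt => /orP[/eqP e|lt]; last by left.
  right; split=> //; rewrite ltnNge; apply/negP => /(ti i e); exact: nt.
move=> i j; rewrite ltnS leq_eqVlt => /orP[/eqP e|lt] eij tli tlj; rewrite !fsfun_withE.
  case: eqP => [-> _|_]; last by rewrite zt.
  by case: eqP => [->|_] //; rewrite zt // -eij.
have ne k' : ro k' = ro i -> (k' == p) = false by move=> e; rewrite ix_eq e (ltn_eqF lt).
by rewrite !ne //; exact: u.
Qed.

Lemma mon_expo a t M : P a t.+1 -> S a t M -> exists2 g : expo, free_expo a t g & monomial q g = M.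
Proof.
elim: a t M => [|a IHa] t; elim: t => [|t IHt] M hP.
- have [_ _ -> _] := tw_start tw => ->; exists [fsfun]; last exact: mono0.
  by split=> //; [move=> i _; rewrite fsfun0E|move=> i []; [case|case=> _]].
- have hP' := tw_le tw (leqnSn _) hP; apply: mon_expo_succ => // M'; exact: IHt.
- apply: mon_expo_limit => // t' M'; exact: IHa.
have hP' := tw_le tw (leqnSn _) hP; apply: mon_expo_succ => // M'; exact: IHt.
Qed.

Lemma small_powX (Q1 Q2 M : {poly K}) (k n : nat) : Q1 \is monic -> (1 < size Q1)%N ->
  size Q2 = (dg Q1 * n).+1 -> (k < n)%N -> small Q1 M -> small Q2 (M * Q1 ^+ k).
Proof.
move=> Qm s1 s2 kn sM; rewrite /small s2 ltnS.
by apply: leq_trans (size_smallX Qm s1 k sM) _; rewrite leq_mul2l kn orbT.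
Qed.

Lemma free_expo_small_succ a t (g : expo) : P a t.+1 ->
  (forall g, free_expo a t g -> small (Q a t) (monomial q g)) ->
  free_expo a t.+1 g -> small (Q a t.+1) (monomial q g).
Proof.
move=> hP IH [z b1 b2 u]; have hp := tw_le tw (leqnSn _) hP; pose p := ix hp.
rewrite (mono_split q g p); apply: (small_powX (n := A a t.+1)).
- exact: (tw_monic tw).
- exact: (tw_size tw).
- by rewrite (tw_sizeE tw hP) (tw_dg tw hP).
- by apply: (b2 p); right.
apply: IH; split.
- move=> i hi; rewrite fsfun_withE ix_eq; case: eqP => [e1|ne] /=; last by apply: z; lia.
  by case: eqP => // e2; apply: z; lia.
- by move=> i lt ti; rewrite fsfun_withE ix_eq (ltn_eqF lt) /=; exact: b1.
- move=> i hi; rewrite fsfun_withE ix_eq; case: eqP => [e1|ne] /=.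
    case: hi => [[lt _]|[_ lt]]; first by rewrite e1 ltnn in lt.
    by rewrite (ltn_eqF lt); apply: b2; right; split=> //; lia.
  by apply: b2; case: hi => [|[e _]]; [left|case: ne].
move=> i j lt e ti tj; rewrite !fsfun_withE !ix_eq -e (ltn_eqF lt) /=.
exact: u.
Qed.

(** At most one tail index [p] occurs, and all tail members have the same degree. Removing the power
    of [p] leaves a monomial small for the tail, and the exponent bound at [p] keeps the product
    below the degree of the limit. *)
Lemma free_expo_small_limit a (g : expo) : P a.+1 1%N ->
  (forall t g, P a t.+1 -> free_expo a t g -> small (Q a t) (monomial q g)) ->
  free_expo a.+1 0 g -> small (Q a.+1 0) (monomial q g).
Proof.
move=> hP IH [z b1 b2 u]; have [t1 [ts bc dF _ mF]] := tw_bounded hP.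
have hP0 := tw_pred tw hP; have [t1' [ts' inf ti]] := tail_startP hP0.
have et : t1' = t1.
  have [h1 h2] := ts; have [h3 h4] := ts'; apply/eqP; rewrite eqn_leq.
  by rewrite h4 // h2.
rewrite {}et {ts'} in ti.
have A0 := tw_al tw hP0.
have hc := tw_tail tw inf ts.1.
have [p [rp tp hu]] : exists p, [/\ ro p = a, (t1 <= co p)%N &
    forall i, ro i = a -> in_tail i -> i <> p -> g i = 0%N].
  case: (pselect (exists p, [/\ ro p = a, in_tail p & g p <> 0%N])) => [[p [rp tp gp]]|no].
    exists p; split=> //; first exact/(ti p rp).
    move=> i ri tli ne; apply: contrapT => gi; apply: ne.
    by apply: u => //; rewrite ?ri ?rp.
  (* If no tail index occurs, the first one serves, with exponent 0. *)
  exists (ix (inf t1)); split=> // i ri tli _; apply: contrapT => gi.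
  by apply: no; exists i.
have tlp : in_tail p by apply/(ti p rp).
have sQp : size (Q (ro p) (co p)) = size (Q a t1).
  by have := chain_size hc (co p - t1) 0; rewrite /tail /= subnKC // addn0 rp.
rewrite (mono_split q g p); apply: (small_powX (n := A a.+1 0)).
- exact: (tw_monic tw (aliveP p)).
- exact: (tw_size tw (aliveP p)).
- by rewrite (tw_sizeE tw hP0) dF /dg sQp.
- by rewrite -rp; apply: b1 => //; rewrite rp.
rewrite /small sQp; apply: (IH t1 _ (inf _)); split.
- move=> i hi; rewrite fsfun_withE; case: eqP => // ne.
  have [e|ne'] := eqVneq (ro i) a; last by apply: z; lia.
  by apply: hu => //; apply/(ti i e); lia.
- by move=> i lt tli; rewrite fsfun_withE; case: eqP => [e|_]; [rewrite e rp ltnn in lt|apply: b1 => //; lia].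
- move=> i hi; rewrite fsfun_withE; case: eqP => [e|_].
    by case: hi => [[lt _]|[_ lt]]; [rewrite e rp ltnn in lt|rewrite e ltnNge tp in lt].
  apply: b2; left; case: hi => [[lt nt]|[e lt]]; first by split=> //; lia.
  by split; [rewrite e|move/(ti i e); rewrite leqNgt lt].
move=> i j lt e tli tlj; rewrite !fsfun_withE.
case: eqP => [e1|_]; first by rewrite e1 rp ltnn in lt.
case: eqP => [e1|_]; first by rewrite e e1 rp ltnn in lt.
by apply: u => //; lia.
Qed.

Lemma free_expo_small a t (g : expo) : P a t.+1 -> free_expo a t g -> small (Q a t) (monomial q g).
Proof.
elim: a t g => [|a IHa] t; elim: t => [|t IHt] g hP.
- move=> [z _ _ _]; have -> : g = [fsfun].
    by apply/fsfunP => i; rewrite fsfun0E; apply: z; rewrite leq0n andbT; case: (ro i).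
  by rewrite mono0; apply: small1; apply: (tw_size tw); have [] := tw_start tw.
- have hP' := tw_le tw (leqnSn _) hP; apply: free_expo_small_succ => // g'; exact: IHt.
- apply: free_expo_small_limit => // t' g'; exact: IHa.
have hP' := tw_le tw (leqnSn _) hP; apply: free_expo_small_succ => // g'; exact: IHt.
Qed.

Lemma uniq_map_inj (T1 T2 : eqType) (f : T1 -> T2) (s : seq T1) : uniq (map f s) -> {in s &, injective f}.
Proof.
elim: s => //= x s IH /andP[xs us] y z; rewrite !inE.
move=> /orP[/eqP ->|ys] /orP[/eqP ->|zs] e //; last exact: IH.
  by rewrite e map_f in xs.
by rewrite -e map_f in xs.
Qed.

Lemma terms_sum a t (L : tms K) : P a t.+1 -> expansion (S a t) L ->
  exists C : monomial_sum (K := K) (Lam := Lm), perm_eq [seq (C g, monomial q g) | g <- finsupp C] L /\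
    forall g, g \in finsupp C -> free_expo a t g.
Proof.
move=> hP [uL hL].
have /choice[ga hga] : forall M, exists g : expo, S a t M -> free_expo a t g /\ monomial q g = M.
  move=> M; case: (pselect (S a t M)) => [SM|no]; last by exists [fsfun].
  by have [g h1 h2] := mon_expo hP SM; exists g.
have mg (z : K * {poly K}) : z \in L -> monomial q (ga z.2) = z.2.
  by move=> pl; have [_ Sp] := hL z pl; have [] := hga z.2 Sp.
pose gs := [seq ga z.2 | z <- L].
have ugs : uniq gs.
  have -> : gs = [seq ga M | M <- [seq z.2 | z <- L]] by rewrite -map_comp.
  rewrite map_inj_in_uniq // => M M' /mapP[z pl ->] /mapP[z' pl' ->] e.
  by rewrite -(mg z pl) -(mg z' pl') e.
pose cf (g : expo) : K := \sum_(z <- L | ga z.2 == g) z.1.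
have ecf (z : K * {poly K}) : z \in L -> cf (ga z.2) = z.1.
  move=> pl; rewrite /cf big_mkcond (bigD1_seq z) ?(map_uniq uL) //= eqxx.
  rewrite big_seq_cond big1 ?addr0 // => z' /andP[pl' ne]; case: eqP => // e.
  have e2 : z'.2 = z.2 by rewrite -(mg z pl) -(mg z' pl') e.
  by rewrite (uniq_map_inj uL pl' pl e2) eqxx in ne.
pose C : monomial_sum (K := K) (Lam := Lm) := [fsfun g in seq_fset tt gs => cf g].
have eC g : C g = if g \in gs then cf g else 0.
  by rewrite fsfunE seq_fsetE.
have sC : finsupp C =i gs.
  move=> g; rewrite mem_finsupp eC; case: ifP => [/mapP[z pl ->]|]; last by rewrite eqxx.
  by rewrite ecf //; have [] := hL z pl.
exists C; split; last first.
  move=> g; rewrite sC => /mapP[z pl ->]; have [_ Sp] := hL z pl.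
  by have [] := hga z.2 Sp.
have -> : L = [seq (C g, monomial q g) | g <- gs].
  rewrite -map_comp -[LHS]map_id; apply/eq_in_map => z pl /=.
  by rewrite eC map_f // ecf // mg // -surjective_pairing.
apply: perm_map; apply: uniq_perm => //; exact: fset_uniq.
Qed.
End ExpoTower.

(** * Standard expansions *)


Section TopMin.
Variable G : ordAbGroupType.
Implicit Types a b c : option G.

Lemma top_le_trans a b c : top_le a b -> top_le b c -> top_le a c.
Proof. by case: a b c => [a|] [b|] [c|] //=; exact: le_trans. Qed.
Lemma top_le_anti a b : top_le a b -> top_le b a -> a = b.
Proof. by case: a b => [a|] [b|] //= h1 h2; congr Some; apply/le_anti/andP. Qed.
Lemma top_le_total a b : top_le a b || top_le b a.
Proof. by case: a b => [a|] [b|] //=; exact: gtotal. Qed.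
Lemma top_leNone a : top_le a None. Proof. by case: a. Qed.
Lemma top_le_min c a b : top_le c (top_min a b) = top_le c a && top_le c b.
Proof.
rewrite /top_min; case: ifP => h.
  by apply/idP/andP => [h1|[]//]; split=> //; exact: top_le_trans h1 h.
apply/idP/andP => [h1|[]//]; split=> //; apply: top_le_trans h1 _.
by have := top_le_total a b; rewrite h.
Qed.
Lemma top_le_bigmin (I : eqType) (r : seq I) (F : I -> option G) c :
  top_le c (\big[top_min/None]_(i <- r) F i) <-> forall i, i \in r -> top_le c (F i).
Proof.
elim: r => [|i r IH]; first by rewrite big_nil; split=> // _; exact: top_leNone.
rewrite big_cons top_le_min; split=> [/andP[h1 /IH h2] j|h].
  by rewrite inE => /orP[/eqP ->|/h2].
by rewrite h ?mem_head //; apply/IH => j jr; apply: h; rewrite inE jr orbT.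
Qed.
Lemma bigmin_top_le (I : eqType) (r : seq I) (F : I -> option G) i : i \in r ->
  top_le (\big[top_min/None]_(i <- r) F i) (F i).
Proof. by move=> ir; apply: (proj1 (top_le_bigmin r F _) (top_lexx _)). Qed.
End TopMin.

Section Standard.
Variables (K : fieldType) (G : ordAbGroupType).
Variable v : valuation {fraction {poly K}} G.
Hypothesis arch : archi v.
Variables (P : nat -> nat -> bool) (Q : nat -> nat -> {poly K})
  (S : nat -> nat -> set {poly K}) (A : nat -> nat -> nat).
Hypothesis tw : tower v P Q S A.
Notation Lm := (lam (ldat tw)).
Notation q := (@key_poly K G v P Q S A tw).
Notation al := (@al K G v P Q S A tw).
Notation ix := (ix tw).
Notation in_tail := (@in_tail K G v P Q S A tw).
Implicit Types (i l : Lm) (f h : {poly K}).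
Notation msum := (monomial_sum (K := K) (Lam := Lm)).

Lemma top_le_pval f h : f != 0 -> top_le (pval v f) (pval v h) = vge v (vl v f) h.
Proof. by move=> f0; rewrite pval_vl. Qed.

Lemma pval_sum (I : Type) (r : seq I) (F : I -> {poly K}) :
  top_le (\big[top_min/None]_(i <- r) pval v (F i)) (pval v (\sum_(i <- r) F i)).
Proof.
elim: r => [|i r IH]; first by rewrite !big_nil pval0.
rewrite !big_cons; have := valuationD v (FracField.tofrac (F i)) (FracField.tofrac (\sum_(j <- r) F j)).
rewrite -rmorphD; apply: top_le_trans.
rewrite !top_le_min; have : top_le (top_min (pval v (F i)) (\big[top_min/None]_(j <- r) pval v (F j)))
   (top_min (pval v (F i)) (\big[top_min/None]_(j <- r) pval v (F j))) by exact: top_lexx.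
by rewrite {1}top_le_min => /andP[-> h] /=; exact: top_le_trans IH.
Qed.

Lemma pval_sum_eq (I : eqType) (r : seq I) (F : I -> {poly K}) f : f = \sum_(i <- r) F i ->
  (forall x, x \in r -> top_le (pval v f) (pval v (F x))) ->
  pval v f = \big[top_min/None]_(i <- r) pval v (F i).
Proof.
move=> -> h; apply: top_le_anti; last exact: pval_sum.
by apply/top_le_bigmin.
Qed.

Lemma free_terms l (L : tms K) : P (ro l) (co l).+1 -> expansion (S (ro l) (co l)) L ->
  (forall z, z \in L -> top_le (pval v (ev L)) (pval v (trm z))) ->
  exists C : msum, [/\ free_standard_expansion v al q l C, eval_sum q C = ev L &
    perm_eq [seq (C g, monomial q g) | g <- finsupp C] L].
Proof.
move=> hP eL hL; have [C [pC hC]] := terms_sum tw hP eL; exists C.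
have eC : eval_sum q C = ev L.
  by rewrite /eval_sum /ev -(perm_big _ pC) big_map.
split=> //; split; first by move=> g /hC/free_expoE.
rewrite eC; apply: pval_sum_eq; first by rewrite -eC.
move=> g gC; rewrite -[_ *: _]/(trm (C g, monomial q g)); apply: hL.
by rewrite -(perm_mem pC); apply: (map_f (fun g => (C g, monomial q g))).
Qed.

Lemma free_small l (C : msum) : P (ro l) (co l).+1 -> free_standard_expansion v al q l C ->
  small (q l) (eval_sum q C).
Proof.
move=> hP [hC _]; apply: small_sum; first exact: (tw_size tw (aliveP l)).
move=> g gC _; apply: smallZ; apply: (free_expo_small (tw := tw)) => //.
exact/free_expoE/hC.
Qed.

Lemma std_exists l n f : P (ro l) (co l).+1 -> (size f <= dg (q l) * n.+1)%N ->
  exists C, standard_expansion v al q l n f C.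
Proof.
move=> hP sf; have kl := tw_pair tw hP; have [N hN] := kp_se kl.
have Qm := kp_monic kl; have Q1 := kp_size kl.
have /choice[C hC] : forall j, exists C : msum, free_standard_expansion v al q l C /\
    eval_sum q C = qc (q l) f j.
  move=> j; have [e|c0] := eqVneq (qc (q l) f j) 0.
    have [||C [h1 h2 _]] := @free_terms l [::] hP; [by []|by []|].
    by exists C; rewrite e h2 ev_nil.
  have [L [h1 [h2 h3] _]] := hN _ c0 (small_qc Qm f j).
  have [|C [k1 k2 _]] := free_terms hP h1; last by exists C; rewrite k2 -h2.
  by move=> z zL; rewrite -h2 top_le_pval //; exact: h3.
exists C; split; first by move=> j _; case: (hC j).
rewrite {1}(qc_expand Qm sf) /eval_expansion; apply: eq_bigr => j _.
by have [_ ->] := hC j.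
Qed.

Lemma std_coef l n f (C : nat -> msum) : P (ro l) (co l).+1 -> standard_expansion v al q l n f C ->
  forall j, qc (q l) f j = if (j < n.+1)%N then eval_sum q (C j) else 0.
Proof.
move=> hP [hC ->] j; have kl := tw_pair tw hP; rewrite /eval_expansion.
rewrite (qc_eval (kp_monic kl) (kp_size kl) (c := fun j => eval_sum q (C j))) //.
by move=> k kn; apply: free_small => //; exact: hC.
Qed.

Lemma std_min l n f (C : nat -> msum) : P (ro l) (co l).+1 -> standard_expansion v al q l n f C ->
  expansion_min v q l n C = \big[top_min/None]_(j < n.+1) pval v (qc (q l) f j * q l ^+ j).
Proof.
move=> hP hC; apply: eq_bigr => j _; by rewrite (std_coef hP hC) ltn_ord.
Qed.

(** The coefficients of a standard expansion have degree smaller than that of [q l], so they are the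
    [q l]-adic ones: every standard expansion of [f] has the same minimum, the truncated value. *)
Lemma std_exact l n f (C : nat -> msum) : P (ro l) (co l).+1 -> standard_expansion v al q l n f C ->
  top_lt (expansion_min v q l n C) (pval v f) <-> ~ exact_at v (q l) f.
Proof.
move=> hP hC; rewrite (std_min hP hC) /top_lt; set m := \big[_/_]_(j < _) _.
have [e|f0] := eqVneq f 0.
  split=> [h ex|[]]; last by rewrite e => g _; exact: tge0.
  case/negP: h; apply/top_le_bigmin => j _; by rewrite e qc0 mul0r pval0.
split=> [/negP h ex|ne]; first apply: h.
  by apply/top_le_bigmin => j _; rewrite top_le_pval //; apply: ex; exact: vge_vl.
apply/negP => h; apply: ne => g hg j.
rewrite (std_coef hP hC); case: ltnP => jn; last by rewrite mul0r vge0.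
have := proj1 (top_le_bigmin _ _ _) h (Ordinal jn) (mem_index_enum _).
rewrite top_le_pval //= (std_coef hP hC) jn; apply: vge_le.
by rewrite -vgeE.
Qed.

Lemma exceedsP l f : P (ro l) (co l).+1 ->
  exceeds_expansions v al q l f <-> ~ exact_at v (q l) f.
Proof.
move=> hP; have ex : exists n C, standard_expansion v al q l n f C.
  exists (size f); apply: std_exists => //; rewrite mulnS (leq_trans _ (leq_addl _ _)) //.
  by rewrite leq_pmull // (dgQ_gt0 (tw_size tw (aliveP l))).
split=> [[[n [C hC]] h]|h]; first by apply/(std_exact hP hC); exact: h.
by split=> // n C hC; apply/(std_exact hP hC).
Qed.

Lemma truncation_exact i f : exact_at v (q i) f -> truncation v q i f (pval v f).
Proof.
move=> ef; have Qm := tw_monic tw (aliveP i); have Q1 := tw_size tw (aliveP i).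
pose c := \poly_(j < size f) qc (q i) f j.
have cE j : c`_j = qc (q i) f j.
  rewrite coef_poly; case: ltnP => // h; rewrite qc_big // (leq_trans h) //.
  by rewrite leq_pmull // (dgQ_gt0 Q1).
have ec : f = \sum_(j < size c) c`_j * q i ^+ j.
  rewrite {1}(qc_expand_size Qm Q1 f).
  rewrite (big_ord_widen _ (fun j => c`_j * q i ^+ j) (size_poly (size f) (fun j => qc (q i) f j))).
  rewrite [RHS]big_mkcond /=; apply: eq_bigr => j _; rewrite cE; case: ltnP => // h.
  by rewrite -cE nth_default // mul0r.
exists c; first by split; [rewrite horner_coef|move=> j; rewrite cE; exact: small_qc].
rewrite (eq_bigr (fun j : 'I_(size c) => pval v (c`_j * q i ^+ j))); last first.
  move=> j _; rewrite pvalM; congr top_add.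
  have Q0 := monic_n0 Qm; by rewrite (pval_vl v (expf_neq0 j Q0)) vlX // (pval_vl v Q0).
apply: pval_sum_eq => // j _; have [e|f0] := eqVneq f 0.
  by rewrite cE e qc0 mul0r pval0.
by rewrite top_le_pval // cE; apply: ef; exact: vge_vl.
Qed.
End Standard.

(** * The set of key polynomials *)


Section KeyTower.
Variables (K : fieldType) (G : ordAbGroupType).
Variable v : valuation {fraction {poly K}} G.
Hypothesis arch : archi v.
Variables (P : nat -> nat -> bool) (Q : nat -> nat -> {poly K})
  (S : nat -> nat -> set {poly K}) (A : nat -> nat -> nat).
Hypothesis tw : tower v P Q S A.
Notation Lm := (lam (ldat tw)).
Notation q := (@key_poly K G v P Q S A tw).
Notation al := (@al K G v P Q S A tw).
Notation ix := (ix tw).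
Notation in_tail := (@in_tail K G v P Q S A tw).
Implicit Types (i l p : Lm) (f h : {poly K}).
Notation msum := (monomial_sum (K := K) (Lam := Lm)).

Lemma tw_vl_row a t t' : (t < t')%N -> P a t' -> dg (Q a t) = dg (Q a t') ->
  vl v (Q a t) < vl v (Q a t').
Proof.
elim: t' => // t' IH; rewrite ltnS leq_eqVlt => lt hP e.
have hP' := tw_le tw (leqnSn _) hP; have gr := tw_row tw (tw_pred tw hP).
have le : (t <= t')%N by move: lt; rewrite -leq_eqVlt.
have e2 : dg (Q a t') = dg (Q a t'.+1).
  apply/eqP; rewrite eqn_leq -{2}e !(tw_dg_row tw) //.
have al1 : A a t'.+1 = 1%N.
  have := tw_dg tw hP; rewrite -e2; have := dgQ_gt0 (tw_size tw hP').
  move: (dg _) (A _ _) => n m n0.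
  by rewrite -{1}(muln1 n) => /eqP; rewrite eqn_pmul2l // => /eqP <-.
have h : vl v (Q a t') < vl v (Q a t'.+1) by exact: (row_vlt gr hP al1).
case/orP: lt => [/eqP ->//|lt]; apply: lt_trans h; apply: IH => //.
by rewrite e2.
Qed.

Lemma tw_vl_next a t : P a.+1 0%N -> dg (Q a t) = dg (Q a.+1 0) ->
  vl v (Q a t) < vl v (Q a.+1 0).
Proof.
move=> hP e; have [inf [t1 [[ht1 _] Fm _ [eF _] _]] _] := tw_link tw hP.
have e2 : dg (Q a (t1 + t.+1)) = dg (Q a.+1 0).
  apply/eqP; rewrite eqn_leq (tw_dg_next tw) // -e (tw_dg_row tw) //.
  by rewrite addnS ltnW // ltnS leq_addl.
have lt : vl v (Q a t) < vl v (Q a (t1 + t.+1)).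
  by apply: tw_vl_row => //; [rewrite addnS ltnS leq_addl|rewrite e2].
apply: lt_trans lt _; rewrite gltNge; apply/negP => h; apply: (eF t.+1).
have hp := inf (t1 + t.+1)%N.
apply: exact_same_size => //; [exact: (tw_monic tw)|exact: (tw_size tw)|].
by rewrite /tail /= (tw_sizeE tw hP) (tw_sizeE tw hp) e2.
Qed.

(** By [tw_size_grows], two indices of the same degree are in the same row or in consecutive
    ones. *)
Lemma tw_vl i l : (i < l)%O -> dg (q i) = dg (q l) -> vl v (q i) < vl v (q l).
Proof.
rewrite lam_ltE => il e; have hl := aliveP l; have hi := aliveP i.
case/orP: il => [lt|/andP[/eqP er lt]]; last first.
  have := @tw_vl_row (ro l) (co i) (co l) lt hl; rewrite -{1 3}er; apply.
  by move: e; rewrite /key_poly er.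
have h1 : P (ro l) 0%N := tw_pred tw hl.
have er : ro l = (ro i).+1.
  apply/eqP; rewrite eqn_leq lt andbT leqNgt; apply/negP => lt2.
  have h2 : P (ro i).+2 0%N.
    move: lt2; rewrite leq_eqVlt => /orP[/eqP ->//|lt2]; exact: (tw_inf_lt tw lt2 hl).
  have := tw_size_grows tw h2; rewrite ltnNge => /negP; apply.
  apply: leq_trans (_ : dg (q l) <= _)%N; last first.
    by rewrite -e; apply: (tw_dg_next tw); exact: (tw_inf tw h2).
  by apply: (tw_dg_mono tw _ hl); move: lt2; lia.
have hn : P (ro i).+1 0%N by rewrite -er.
have d1 : dg (Q (ro i) (co i)) = dg (Q (ro i).+1 0).
  apply/eqP; rewrite eqn_leq (tw_dg_next tw) //= -/(q i) e /key_poly -er (tw_dg_row tw) //.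
have lt1 := tw_vl_next hn d1; apply: lt_le_trans lt1 _; rewrite -er /key_poly.
have [->|ne] := eqVneq (co l) 0%N; first exact: lexx.
apply: ltW; apply: tw_vl_row => //; first by rewrite lt0n.
by rewrite er -d1 -/(q i) e /key_poly er.
Qed.

Lemma pin_monomial p (g : expo (Lam := Lm)) : free_expo (ro p) (co p) g ->
  initial_subring (v := v) q p (pin v (monomial q g)).
Proof.
move=> [z _ _ _]; rewrite /monomial /initial_subring; elim/big_rec: _ => [|k f _ hf].
  rewrite -[X in gen_subring _ X]/(pin v 1) pin1; exact: gen_subring1.
rewrite pinM; apply: gen_subringM => //; rewrite pinX.
have [kp|kp] := boolP (k < p)%O.
  by apply: gen_subringX; apply: gen_subring_in; right; exists k.
rewrite z ?expr0; first exact: gen_subring1.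
by move: kp; rewrite lam_ltE; lia.
Qed.

Lemma tower_successor p i : succ_idx p i -> successor_key v al q p i.
Proof.
move=> /succ_idxE[er ec]; have hP : P (ro p) (co p).+1 by rewrite -er -ec; exact: aliveP.
have kp := tw_pair tw hP; have [[al0 [L [hL hv hev eQ]] hgt hex] _] := tw_step tw hP.
have Qm := kp_monic kp; have Q1 := kp_size kp; have Q0 := monic_n0 Qm.
have eal : al i = A (ro p) (co p).+1 by rewrite /al er ec.
have eqi : q i = Q (ro p) (co p).+1 by rewrite /key_poly er ec.
have /choice[C hC] : forall j, exists C : msum, (j < al i)%N ->
    [/\ free_standard_expansion v al q p C, eval_sum q C = ev (L j) &
        perm_eq [seq (C g, monomial q g) | g <- finsupp C] (L j)].
  move=> j; case: (ltnP j (al i)) => ja; last by exists [fsfun].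
  rewrite eal in ja; have [|C hC] := free_terms hP (hL j ja); last by exists C.
  move=> z zL; have ne : L j != [::] by apply: contraTneq zL => ->.
  have Qj0 : Q (ro p) (co p) ^+ j != 0 by rewrite expf_neq0.
  have z0 := trm_neq0 (kp_mon kp) (hL j ja) zL.
  rewrite top_le_pval; last first.
    apply/eqP => e; have := hev j ja ne; rewrite e mul0r pval0 pval_vl ?expf_neq0 //.
  rewrite -(vge_mulr v _ _ Qj0); apply: vge_eq; rewrite (hv j z ja zL) -(hev j ja ne).
  rewrite pval_vl; first by rewrite vlM //; apply/eqP => e; have := hev j ja ne; rewrite e mul0r pval0 pval_vl ?expf_neq0.
  rewrite mulf_neq0 //; apply/eqP => e; have := hev j ja ne; rewrite e mul0r pval0 pval_vl ?expf_neq0 //.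
exists C; split.
- by move=> j /hC[].
- rewrite eqi eQ eal; congr (_ + _); apply: eq_bigr => j _.
  by have [|_ -> _] := hC j; first by rewrite eal.
- move=> j g ja gC; have [_ _ pC] := hC j ja.
  rewrite -[_ *: monomial q g]/(trm (C j g, monomial q g)) eal; rewrite eal in ja; apply: hv => //.
  by rewrite -(perm_mem pC); apply: (map_f (fun g => (C j g, monomial q g))).
have eS j : (j < al i)%N -> \sum_(z <- L j) pin v z.1%:P * pin v z.2 =
    \sum_(g <- finsupp (C j)) pin v (C j g)%:P * pin v (monomial q g).
  by move=> ja; have [_ _ pC] := hC j ja; rewrite -(perm_big _ pC) big_map.
apply: (minimal_relation_eq eS); rewrite eal.
have hex' f : (size f <= dg (q p) * A (ro p) (co p).+1)%N -> exact_at v (q p) f by exact: hex.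
apply: (key_relation Qm Q1 (kp_key kp) hex') => //.
(* An earlier key polynomial has either smaller degree, or the same degree and a smaller value; in
   both cases its initial form is in [small_class]. *)
- move=> x [[c _ <-]|[k /= kp' <-]].
    by apply: small_class_pin; apply: leq_ltn_trans (size_polyC_leq1 _) _.
  have := tw_dg_mono tw (a := ro k) (t := co k) _ (aliveP p).
  have kp2 := kp'; rewrite lam_ltE in kp2.
  have -> : (ro k < ro p)%N || (ro k == ro p) && (co k <= co p)%N by lia.
  move/(_ isT); rewrite -/(q k) -/(q p) leq_eqVlt => /orP[/eqP e|lt].
    have sk := tw_sizeE tw (aliveP k); have sp := tw_sizeE tw (aliveP p).
    apply: small_class_pin_near => //; [exact: (tw_monic tw (aliveP k))| |exact: tw_vl].
    by rewrite sk sp -/(q k) -/(q p) e.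
  apply: small_class_pin; rewrite /small (tw_sizeE tw (aliveP k)) (tw_sizeE tw (aliveP p)).
  by rewrite ltnS.
- by rewrite -eQ.
move=> j z ja zL; split; first by apply: gen_subring_in; left; exists z.1.
have [|[hC1 _] _ pC] := hC j; first by rewrite eal.
have : z \in [seq (C j g, monomial q g) | g <- finsupp (C j)] by rewrite (perm_mem pC).
by case/mapP => g gC -> /=; apply: pin_monomial; apply/free_expoE/hC1.
Qed.
End KeyTower.

(** * Limit indices and the remaining conditions *)

Section CompleteTower.
Variables (K : fieldType) (G : ordAbGroupType).
Variable v : valuation {fraction {poly K}} G.
Hypothesis arch : archi v.
Variables (P : nat -> nat -> bool) (Q : nat -> nat -> {poly K})
  (S : nat -> nat -> set {poly K}) (A : nat -> nat -> nat).
Hypothesis tw : tower v P Q S A.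
Notation Lm := (lam (ldat tw)).
Notation q := (@key_poly K G v P Q S A tw).
Notation al := (@al K G v P Q S A tw).
Notation ix := (ix tw).
Notation in_tail := (@in_tail K G v P Q S A tw).
Implicit Types (i l p : Lm) (f h : {poly K}).
Notation msum := (monomial_sum (K := K) (Lam := Lm)).

Lemma limit_index i : (\bot < i)%O -> (forall p, ~ succ_idx p i) ->
  co i = 0%N /\ exists a, ro i = a.+1.
Proof.
move=> i0 np; have c0 : co i = 0%N.
  apply/eqP; rewrite -leqn0 leqNgt; apply/negP => c1.
  have h : P (ro i) (co i).-1 by apply: (tw_le tw (leq_pred _)); exact: aliveP.
  by case: (np (ix h)); apply/succ_idxE; rewrite ro_ix co_ix prednK.
split=> //; case e: (ro i) => [|a]; last by exists a.
by move: i0; rewrite lam_ltE e c0 !ltn0 andbF.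
Qed.

Lemma limit_next i a : ro i = a.+1 -> co i = 0%N -> exists t1,
  [/\ tail_start (row_at P Q S A a) t1, forall t, P a t &
      forall i0, next_idx al setT i0 i <-> ro i0 = a /\ (t1 <= co i0)%N].
Proof.
move=> e1 e2; have hP : P a.+1 0%N by rewrite -e1 -e2; exact: aliveP.
have [t1 [ts inf ti]] := tail_startP tw hP; exists t1; split=> // i0.
rewrite next_idxT e1 e2; split=> [[[[_ h] [[h2] _]]|[_ [_ //]]]|[h1 h2]].
  by split; [|apply/(ti i0 _)].
by left; rewrite h1; split=> //; split=> //; exact/(ti i0 h1).
Qed.

Lemma tail_col i0 a t1 : ro i0 = a -> (t1 <= co i0)%N ->
  tail (row_at P Q S A a) t1 (co i0 - t1) = q i0.
Proof. by move=> e le; rewrite /tail /= subnKC // /key_poly e. Qed.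

Lemma tower_limit i : (\bot < i)%O -> (forall p, ~ succ_idx p i) -> limit_key v al q i.
Proof.
move=> i0 np; have [ci [a ri]] := limit_index i0 np.
have [t1 [ts inf nx]] := limit_next ri ci.
have hP : P a.+1 0%N by rewrite -ri -ci; exact: aliveP.
have hc := tw_tail tw inf ts.1.
have eqi : q i = Q a.+1 0 by rewrite /key_poly ri ci.
have eal : al i = A a.+1 0 by rewrite /al ri ci.
have [_ [t1' [ts' Fm s0 mF hb]] _] := tw_link tw hP.
have et : t1' = t1 by apply/eqP; rewrite eqn_leq (ts'.2 t1 ts.1) (ts.2 t1' ts'.1).
move: mF hb; rewrite {}et {ts' t1'} /= => mF hb.
have F0 := monic_n0 Fm.
have nm l : ro l = a -> P (ro l) (co l).+1 by move=> ->.
have dgl l : next_idx al setT l i -> dg (q l) = dg (Q a t1).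
  move=> /nx[rl cl]; have := chain_dg hc (co l - t1) 0; rewrite (tail_col rl cl) => ->.
  by rewrite /tail addn0.
split.
- by exists (ix (inf t1)); apply/nx; rewrite ro_ix co_ix.
- move=> l hl; have [rl cl] := proj1 (nx l) hl; apply: std_exists; first exact: nm.
  rewrite (dgl l hl) eqi eal; case: hb => [[_ dF _ _]|[_ _ //]].
  rewrite (tw_sizeE tw hP) dF mulnS -[X in (X < _)%N]add0n ltn_add2r.
  exact: dgQ_gt0 (tw_size tw (inf t1)).
- move=> l hl; have [rl cl] := proj1 (nx l) hl; apply/(exceedsP _ (nm l rl)).
  by rewrite -(tail_col rl cl) eqi; exact: mF.1.
- move=> f hf; rewrite eqi /deg; have : (size (Q a.+1 0) <= size f)%N.
    apply: mF.2 => s; have h : P a (t1 + s)%N by exact: inf.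
    have hl : next_idx al setT (ix h) i by apply/nx; rewrite ro_ix co_ix leq_addr.
    by have := hf _ hl => /(exceedsP _ (nm (ix h) erefl)).
  by move: (size _) (size _) => m n; lia.
move=> hbd l C hl hC; have [rl cl] := proj1 (nx l) hl.
(* The hypothesis excludes an unbounded limit: such a limit is the largest index, and the values
   before it have no bound. *)
have hb' : bounded_chain v (tail (row_at P Q S A a) t1) /\
    dg (Q a.+1 0) = (dg (Q a t1) * A a.+1 0)%N.
  case: hb => [[bc dF _ _]|[nb fu _]]; first by split.
  exfalso; have [n1 n2] := tw_unbounded_last tw hP fu.
  case: hbd => [[n n0 [b bG hj]]|]; last by move/not_maxE; rewrite ri ci; exact/negP.
  apply: nb; have [b' b'G [b'0 bb']] : exists2 b', G0 v b' & 0 <= b' /\ b <= b'.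
    have /orP[h|h] := gtotal b 0; last by exists b; rewrite ?lexx.
    by exists 0; [exact: G0_0|rewrite lexx].
  exists b' => // s; have h : P a (t1 + s)%N by exact: inf.
  have lt : (ix h < i)%O by rewrite lam_ltE ro_ix ri ltnSn.
  have := hj _ lt; rewrite /key_poly ro_ix co_ix pval_vl ?(monic_neq0 (tw_monic tw h)) //= => h2.
  have /orP[h3|h3] := gtotal (vl v (Q a (t1 + s))) 0; first exact: le_trans h3 b'0.
  apply: le_trans bb'; apply: le_trans h2; case: n n0 {hj} => // n _.
  by rewrite mulrS -[X in X <= _]addr0 gle_addl; have := gleMn n h3; rewrite mul0rn.
have [bc dF] := hb'.
have dFc : dg (Q a.+1 0) = (dg (tail (row_at P Q S A a) t1 0) * A a.+1 0)%N.
  by rewrite dF /tail addn0.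
have hPl := nm l rl; have Qm := tw_monic tw (aliveP l); have Q1 := tw_size tw (aliveP l).
have Q0 := monic_n0 Qm.
pose s := (co l - t1)%N; have es : tail (row_at P Q S A a) t1 s = q l by exact: tail_col.
have co0 := limit_const arch hc bc Fm dFc mF s; have tg := limit_tge arch hc bc Fm dFc mF s.
rewrite es in co0 tg.
have tmn : top_muln (al i) (pval v (q l)) = Some (vl v (q l) *+ A a.+1 0).
  by rewrite pval_vl // eal.
have c0 : pval v (eval_sum q (C 0%N)) = top_muln (al i) (pval v (q l)).
  have := std_coef hPl hC 0; rewrite ltn0Sn => <-.
  by rewrite eqi tmn -co0 /qc expr0 divp1.
split=> //.
- have := std_coef hPl hC (al i); rewrite ltnSn => <-; rewrite eqi eal.
  by have [_ ->] := monic_top Qm Q1 Fm (etrans dF (congr1 (muln^~ _) (esym (dgl l hl)))).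
rewrite (std_min hPl hC) tmn; apply: top_le_anti.
  have := bigmin_top_le (fun j : 'I_(al i).+1 => pval v (qc (q l) (q i) j * q l ^+ j)) (mem_index_enum ord0).
  by rewrite /= expr0 mulr1 (std_coef hPl hC) ltn0Sn c0 tmn.
apply/top_le_bigmin => j _; rewrite eqi; exact: tg.
Qed.

Lemma tower_prekey : prekey_polynomials al q.
Proof.
have [h0 qX _ a1] := tw_start tw; split.
- by split; [exact: lam_well_ordered|exact: lam_countable].
- by move=> i; exact: (tw_al tw (aliveP i)).
- exact: a1.
- by split; [move=> i; exact: (tw_monic tw (aliveP i))|exact: qX].
move=> i i0 nm lt nx; have [[[hn tl0] [r1 c1]]|[_ [r1 c1]]] := proj1 (next_idxT i0 i) nx.
  have hi : P (ro i0).+1 1%N by move/not_maxE: nm; rewrite r1 c1.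
  have [t1 [ts bc dF _ mF]] := tw_bounded tw hi.
  have [t2 [ts2 inf ti]] := tail_startP tw hn.
  have le : (t1 <= co i0)%N by apply: ts.2; exact: tl0.
  have hc := tw_tail tw inf ts.1; have := chain_dg hc (co i0 - t1) 0.
  rewrite (tail_col erefl le) /tail /= addn0 => e.
  rewrite -[LHS]/(dg (q i)) /key_poly /al r1 c1 dF mulnC; congr muln.
  exact: esym e.
have hi : P (ro i0) (co i0).+1 by rewrite -r1 -c1; exact: aliveP.
rewrite -[LHS]/(dg (q i)) /key_poly /al r1 c1 (tw_dg tw hi) mulnC //.
Qed.

Lemma tower_hull i : ~ is_max i -> exists2 b, pval v (q i) = Some b & div_hull (base_group v) b.
Proof.
move/not_maxE => hP; have [st _] := tw_step tw hP; have kp := tw_pair tw hP.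
exists (vl v (q i)); first by apply: pval_vl; exact: monic_n0 (kp_monic kp).
by have [n n0 h] := key_step_hull kp st; exists n.
Qed.

(** Turns an infinite set of indices into one on which [ro i + co i] is unbounded, the form used by
    [tw_cofinal_degree]. *)
Lemma finite_lam_sum m : finite_set [set i : Lm | (ro i + co i < m)%N].
Proof.
pose g (xy : nat * nat) : Lm := if pselect (P xy.1 xy.2) is left h then ix h else \bot%O.
apply: (sub_finite_set (B := g @` (`I_m `*` `I_m))); last first.
  by apply: finite_image; apply: finite_setX; exact: finite_II.
move=> i /= im; exists (ro i, co i); first by split=> /=; lia.
by rewrite /g /=; case: pselect => [h|[]]; [exact: lam_inj|exact: aliveP].
Qed.

Lemma tower_cofinal n : infinite_set [set i | deg (q i) = n] ->
  forall f, f \is monic -> deg f = n -> exists2 i, deg (q i) = n & top_le (pval v f) (pval v (q i)).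
Proof.
move=> inf f fm df; have [|a [t [h1 h2 h3]]] := tw_cofinal_degree tw _ fm df.
  move=> m; apply: contrapT => no; apply: inf.
  apply: (sub_finite_set _ (finite_lam_sum m)) => i /= di.
  by rewrite ltnNge; apply/negP => le; apply: no; exists (ro i), (co i); split=> //; exact: aliveP.
exists (ix h1); first exact: h2.
by rewrite top_le_pval ?monic_neq0 // vgeE //; exact: monic_neq0 (tw_monic tw h1).
Qed.

Theorem tower_key : complete_key_polynomials v al q.
Proof.
split; last first.
  move=> f f0; have [a [t [h e]]] := tw_complete tw f; exists (ix h).
  exact: truncation_exact.
split; [exact: tower_prekey|exact: tower_hull|exact: tower_successor|exact: tower_limit|exact: tower_cofinal].
Qed.
End CompleteTower.

(** * Residue characteristic and order types *)

Section Final.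
Local Open Scope quotient_scope.
Variables (K : fieldType) (G : ordAbGroupType).
Variable v : valuation {fraction {poly K}} G.

Lemma base_group_pos : rank_one (base_group v) -> exists2 g, G0 v g & 0 < g.
Proof.
case=> ne _; apply: contrapT => no; apply: ne; apply/seteqP; split=> x /=; last first.
  by move=> ->; exact: G0_0.
move=> hx; apply/eqP; apply: contrapT => /negP x0; apply: no.
have /orP[h|h] := gtotal x 0; last by exists x => //; rewrite lt_neqAle eq_sym x0.
exists (- x); first exact: G0N.
have lt : x < 0 by rewrite lt_neqAle x0.
by apply: (glt_of lt); gring.
Qed.

(** A prime number of positive value would vanish in the residue field; the other integers follow by
    factorization. *)
Lemma residue_char0_units : [pchar residue_field (base_val v)] =i pred0 -> units_nat v.
Proof.
move=> ch; have hp p : prime p -> pval v (p%:R : K)%:P = Some 0.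
  move=> pp; have := ch p; rewrite !inE pp /=.
  have -> : p%:R = \pi_(residue_field (base_val v)) (p%:R) :> residue_field (base_val v).
    by rewrite (rmorph_nat \pi_{ideal_quot (val_maxideal (v := base_val v))}).
  have <- : \pi_(residue_field (base_val v)) 0 = 0 :> residue_field (base_val v).
    exact: (rmorph0 \pi_{ideal_quot (val_maxideal (v := base_val v))}).
  rewrite -Quotient.idealrBE subr0 => /negbT; rewrite unfold_in /val_maxideal.
  have := valP (p%:R : val_ring (base_val v)); rewrite unfold_in /val_ring_pred.
  have -> : \val (p%:R : val_ring (base_val v)) = p%:R by exact: (rmorph_nat val).
  have -> : base_val v p%:R = pval v (p%:R : K)%:P by [].
  by rewrite /top_lt; case: (pval v _) => //= a h1; rewrite negbK => h2; congr Some; apply/le_anti/andP.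
move=> n; have [m] := ubnP n; elim: m n => // m IH n nm n0.
have [n1|n1] := leqP n 1.
  have -> : n = 1%N by apply/eqP; rewrite eqn_leq n1 n0.
  by rewrite polyC1 pval1.
have dv := pdiv_dvd n; have pp := pdiv_prime n1.
have [d0 dn] : (0 < n %/ pdiv n)%N /\ (n %/ pdiv n < m)%N.
  rewrite divn_gt0 ?prime_gt0 // dvdn_leq //; split=> //.
  by apply: leq_trans (ltnSE nm); rewrite ltn_Pdiv // prime_gt1.
rewrite -(divnK dv) natrM polyCM pvalM (hp _ pp) (IH _ dn d0) /= addr0 //.
Qed.

Section OrderType.
Variables (P : nat -> nat -> bool) (Q : nat -> nat -> {poly K})
  (S : nat -> nat -> set {poly K}) (A : nat -> nat -> nat).
Hypothesis tw : tower v P Q S A.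
Notation Lm := (lam (ldat tw)).

Lemma lam_omega_squared : order_type_le (<=%O : rel Lm) omega_squared_le.
Proof.
exists (fun i : Lm => (ro i, co i)); split; first by move=> i j; rewrite lam_leE.
move=> i [a t]; rewrite /omega_squared_le /= => h.
have hP : P a t.
  case/orP: h => [lt|/andP[/eqP -> le]]; first exact: (tw_inf_lt tw lt (aliveP i)).
  exact: (tw_le tw le (aliveP i)).
by exists (ix tw hP).
Qed.

Lemma lam_omega_plus_one : (P 1 0%N -> ~~ P 1 1%N /\ ~~ P 2 0%N) ->
  order_type_le (<=%O : rel Lm) omega_plus_one_le.
Proof.
move=> h; have hi (i : Lm) : ro i = 0%N \/ ro i = 1%N /\ co i = 0%N.
  have hP := aliveP i; case E: (ro i) hP => [|a] hP; first by left.
  have h1 : P 1 0%N.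
    case: a E hP => [|a] E hP; first exact: (tw_pred tw hP).
    exact: (@tw_inf_lt K G v P Q S A tw 1 a.+2 _ isT hP).
  have [n1 n2] := h h1; right; case: a E hP => [|a] E hP; last first.
    case/negP: n2; case: a E hP => [|a] E hP; first exact: (tw_pred tw hP).
    exact: (@tw_inf_lt K G v P Q S A tw 2 a.+3 _ isT hP).
  split=> //; case E2: (co i) hP => [|t] // hP; case/negP: n1.
  exact: (tw_le tw _ hP).
pose f (i : Lm) := if ro i == 0%N then Some (co i) else None.
exists f; split.
  move=> i j; rewrite /f lam_leE /omega_plus_one_le.
  by case: (hi i) => [->|[-> ->]]; case: (hi j) => [->|[-> ->]] /=; rewrite ?leEnat.
move=> i [t|] /=; last first.
  by move=> h1; exists i; move: h1; rewrite /f /omega_plus_one_le; case: ifP.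
move=> h1; have hP : P 0%N t.
  move: h1; rewrite /f /omega_plus_one_le; case: (hi i) => [e|[e _]]; rewrite e /=.
    by rewrite leEnat => le; apply: (tw_le tw le); rewrite -e; exact: aliveP.
  by move=> _; have := aliveP i; rewrite e => /(tw_inf tw).
by exists (ix tw hP); rewrite /f ro_ix.
Qed.

Lemma lam_omega : ~~ P 1 0%N -> order_type_le (<=%O : rel Lm) omega_le.
Proof.
move=> h; have hi (i : Lm) : ro i = 0%N.
  have hP := aliveP i; case E: (ro i) hP => [|a] hP //; case/negP: h.
  case: a E hP => [|a] E hP; first exact: (tw_pred tw hP).
  exact: (@tw_inf_lt K G v P Q S A tw 1 a.+2 _ isT hP).
exists (fun i : Lm => co i); split; first by move=> i j; rewrite lam_leE !hi.
move=> i t; rewrite /omega_le => le; have hP : P 0%N t.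
  by apply: (tw_le tw le); rewrite -(hi i); exact: aliveP.
by exists (ix tw hP).
Qed.
End OrderType.
End Final.

Theorem mainTheorem1 (K : fieldType) (G : ordAbGroupType)
    (v : valuation {fraction {poly K}} G)
    (v_X : top_lt (Some 0) (pval v 'X))
    (rank_v_K : rank_one (base_group v)) :
  exists (d : Order.disp_t) (Lam : bOrderType d)
         (alpha : Lam -> nat) (Q : Lam -> {poly K}),
  [/\ complete_key_polynomials v alpha Q,
      order_type_le (<=%O : rel Lam) omega_squared_le,
      [pchar residue_field (base_val v)] =i pred0 ->
        order_type_le (<=%O : rel Lam) omega_plus_one_le &
      [pchar residue_field (base_val v)] =i pred0 ->
        rank_one (value_group v) ->
        order_type_le (<=%O : rel Lam) omega_le].
Proof.
have arch := rank_one_archi rank_v_K.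
have [P [Q [S [A tw]]]] := tower_exists arch (base_group_pos rank_v_K).
exists lam_display, (lam (ldat tw)), (al (tw := tw)), (key_poly (tw := tw)); split.
- exact: tower_key.
- exact: lam_omega_squared.
- by move=> /residue_char0_units un; apply: lam_omega_plus_one => h; have [] := char0_rows arch tw un h.
move=> /residue_char0_units un rk; apply: lam_omega; apply/negP => h.
have [_ _ big] := char0_rows arch tw un h.
exact: (rank_one_values rank_v_K rk (monic_n0 (tw_monic tw h)) big).
Qed.
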